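(* Consider the contextual search problem in dimension $d$ with the pricing loss $\ell(\theta,p)=\theta-p\,\mathbf{1}\{p\le\theta\}$, and let the learner use PricingSearch as described in the context. Then the total loss $\sum_{t=1}^T\ell(\langle u_t,v\rangle,p_t)$ is bounded by $O(d^4\log\log(dT))$, uniformly over the hidden point $v\in[0,1]^d$ and the adversary's choice of contexts.
   Context: Contextual search problem in dimension $d$: an adversary fixes $v\in[0,1]^d$. In each round $t=1,\dots,T$ the adversary chooses a unit vector $u_t\in\mathbb{R}^d$, the learner chooses $p_t\in\mathbb{R}$, incurs loss $\ell(\langle u_t,v\rangle,p_t)$ and learns the sign of $\langle u_t,v\rangle-p_t$. Knowledge sets: $S_1=[0,1]^d$, $S_{t+1}=S_t^+(p_t;u_t):=\{x\in S_t:\langle u_t,x\rangle\ge p_t\}$ if $p_t\le\langle u_t,v\rangle$ was learned, else $S_{t+1}=S_t^-(p_t;u_t):=\{x\in S_t:\langle u_t,x\rangle\le p_t\}$. Let $\underline p_t=\min_{x\in S_t}\langle u_t,x\rangle$, $\overline p_t=\max_{x\in S_t}\langle u_t,x\rangle$. Intrinsic volumes: for compact convex $K\subset\mathbb{R}^d$ and unit ball $B$, $\mathrm{Vol}(K+\varepsilon B)=\sum_{j=0}^d\kappa_{d-j}V_j(K)\varepsilon^{d-j}$ ($\kappa_m$ = volume of the $m$-dimensional unit ball), defining $V_j(K)$. Let $\alpha=1+1/d$, $\ell_k=d^2\exp(-\alpha^k)$ for integers $k$, and $c_i=\frac{1}{2^{i-1}i!}$. PricingSearch in round $t$: let $w=\frac12(\overline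 p_t-\underline p_t)$. For $i=1,\dots,d$: let $\varphi_i=(i!\,V_i(S_t))^{1/i}$ and $k_i$ the integer with $\varphi_i\in(\ell_{k_i+1},\ell_{k_i}]$; if $V_i(S_t)-V_i(S_t^+(\overline p_t;u_t))>\ell_{k_i+1}^i/(2\cdot i!)$, choose $p_i$ with $V_i(S_t)-V_i(S_t^+(p_i;u_t))=\ell_{k_i+1}^i/(2\cdot i!)$, else set $p_i=\overline p_t$; let $K_i=\{x\in S_t:\langle u_t,x\rangle=p_i\}$ and $L_i=(V_i(K_i)/c_i)^{1/i}$; set $L_0=\infty$. If $w<1/T$, guess $p_t=\underline p_t$. Otherwise let $M(i)=\max\{j:k_j=k_i\}$, find $j$ with $L_{j-1}\ge w\ge L_{M(j)}$, let $J=M(j)$ and guess $p_t=p_J$. *)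

(* Defs.v *)
(* MathComp-Analysis, over an arbitrary [R : realType]; points of R^d are row
   vectors ['rV[R]_d]. *)
From HB Require Import structures.
From mathcomp Require Import all_boot all_order all_algebra.
From mathcomp Require Import all_classical all_reals all_analysis.

Set Implicit Arguments.
Unset Strict Implicit.
Unset Printing Implicit Defensive.

Import Order.TTheory GRing.Theory Num.Theory.
Import numFieldNormedType.Exports.

Local Open Scope classical_set_scope.
Local Open Scope ring_scope.

Section IntrinsicVolumes.
Context {R : realType}.

Definition dot d (x y : 'rV[R]_d) : R := \sum_(i < d) x ord0 i * y ord0 i.

(* The norm of ['rV[R]_d] in the library is the sup norm, hence [dot]. *)
Definition unit_ball d : set 'rV[R]_d := [set x | dot x x <= 1].

(* d-dimensional Lebesgue measure of a Borel set, as the d-fold product of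
   [lebesgue_measure]: the first coordinate is integrated out, as in the
   library's [product_measure1]; R^0 is a point of mass 1. The value is
   meaningless on non-measurable sets. *)
Fixpoint volume d : set 'rV[R]_d -> \bar R :=
  match d with
  | 0 => fun A => if `[< A !=set0 >] then 1%E else 0%E
  | n.+1 => fun A =>
      (\int[lebesgue_measure]_(x in [set: R])
         volume [set y : 'rV[R]_n | A (row_mx (const_mx x : 'rV[R]_1) y)])%E
  end.

Definition kappa m : R := fine (volume (@unit_ball m)).

Definition parallel_body d (K : set 'rV[R]_d) (e : R) : set 'rV[R]_d :=
  [set z | exists x b, [/\ K x, unit_ball b & z = x + e *: b]].

Definition steiner_formula d (K : set 'rV[R]_d) (V : nat -> R) : Prop :=
  forall e : R, 0 <= e ->
    volume (parallel_body K e) =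
    (\sum_(j < d.+1) kappa (d - j) * V j * e ^+ (d - j))%:E.

(* [intrinsic_volume K j] is V_j(K). For compact convex K, Steiner's formula
   has a solution, whose entries of index j <= d are uniquely determined; only
   those are meaningful. *)
Definition intrinsic_volume d (K : set 'rV[R]_d) : nat -> R :=
  get [set V : nat -> R | steiner_formula K V].

End IntrinsicVolumes.

Section ContextualSearch.
Context {R : realType}.

Definition unit_cube d : set 'rV[R]_d :=
  [set x | forall i, 0 <= x ord0 i <= 1].

Definition upper_part d (S : set 'rV[R]_d) (u : 'rV[R]_d) (p : R) :=
  [set x | S x /\ p <= dot u x].

Definition lower_part d (S : set 'rV[R]_d) (u : 'rV[R]_d) (p : R) :=
  [set x | S x /\ dot u x <= p].

Definition slice d (S : set 'rV[R]_d) (u : 'rV[R]_d) (p : R) :=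
  [set x | S x /\ dot u x = p].

(* Rounds are numbered from 0: [knowledge_set v u p t] is the set known before
   the round with context [u t] and guess [p t]. *)
Fixpoint knowledge_set d (v : 'rV[R]_d) (u : nat -> 'rV[R]_d) (p : nat -> R)
    (t : nat) : set 'rV[R]_d :=
  match t with
  | 0 => @unit_cube d
  | s.+1 => let S := knowledge_set v u p s in
            if p s <= dot (u s) v then upper_part S (u s) (p s)
            else lower_part S (u s) (p s)
  end.

Definition pricing_loss (theta p : R) : R := theta - p * (p <= theta)%R%:R.

(* Knowledge sets are nonempty and compact, so these are a min and a max. *)
Definition price_min d (S : set 'rV[R]_d) (u : 'rV[R]_d) : R :=
  inf [set dot u x | x in S].
Definition price_max d (S : set 'rV[R]_d) (u : 'rV[R]_d) : R :=
  sup [set dot u x | x in S].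

Definition alpha d : R := 1 + d%:R^-1.

(* l_k = d^2 exp (- alpha^k), together with its limits at k = +oo and -oo *)
Definition ell d (k : \bar int) : R :=
  match k with
  | EFin z => d%:R ^+ 2 * expR (- (alpha d ^ z))
  | +oo%E => 0
  | -oo%E => d%:R ^+ 2
  end.

(* phi \in ]l_(k+1), l_k], where these intervals partition ]0, d^2[. A value
   phi = 0 (the knowledge set may become lower-dimensional) gets the index
   +oo; phi >= d^2 gets -oo, which only happens for d = 1, in the first
   rounds, where phi_1 = d^2 = 1. *)
Definition scale_index d (phi : R) (k : \bar int) : Prop :=
  match k with
  | EFin _ => ell d (k + 1%:E)%E < phi <= ell d k
  | +oo%E => phi = 0
  | -oo%E => d%:R ^+ 2 <= phi
  end.

Definition coef_c (i : nat) : R := (2 ^+ i.-1 * (i`!)%:R)^-1.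

Definition phi d (S : set 'rV[R]_d) (i : nat) : R :=
  ((i`!)%:R * intrinsic_volume S i) `^ (i%:R^-1).

Definition cut_amount d (k : nat -> \bar int) (i : nat) : R :=
  ell d (k i + 1%:E)%E ^+ i / (2 * (i`!)%:R).

Definition candidate_price d (S : set 'rV[R]_d) (u : 'rV[R]_d)
    (k : nat -> \bar int) (i : nat) (q : R) : Prop :=
  let removed r := intrinsic_volume S i
                   - intrinsic_volume (upper_part S u r) i in
  if cut_amount d k i < removed (price_max S u)
  then removed q = cut_amount d k i
  else q = price_max S u.

Definition slice_width d (S : set 'rV[R]_d) (u : 'rV[R]_d) (q : nat -> R)
    (i : nat) : \bar R :=
  if i is 0 then +oo%E
  else ((intrinsic_volume (slice S u (q i)) i / coef_c i) `^ (i%:R^-1))%:E.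

(* M(i) = max {j in 1..d : k_j = k_i} *)
Definition last_same d (k : nat -> \bar int) (i : nat) : nat :=
  (\max_(1 <= j < d.+1 | k j == k i) j)%N.

(* [pricing_search T S u p]: with horizon T, knowledge set S and context u,
   PricingSearch may guess p. It is a relation, as the p_i and the index j may
   be chosen in several ways. *)
Definition pricing_search d (T : nat) (S : set 'rV[R]_d) (u : 'rV[R]_d)
    (p : R) : Prop :=
  let w := (price_max S u - price_min S u) / 2 in
  exists (k : nat -> \bar int) (q : nat -> R),
    [/\ forall i, (1 <= i <= d)%N -> scale_index d (phi S i) (k i),
        forall i, (1 <= i <= d)%N -> candidate_price S u k i (q i) &
        if w < T%:R^-1 then p = price_min S u
        else exists j, [/\ (1 <= j <= d)%N,
               (slice_width S u q (last_same d k j) <= w%:E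
                  <= slice_width S u q j.-1)%E &
               p = q (last_same d k j)]].

End ContextualSearch.

(* Main.v *)
(* Write a_i = i! V_i and phi_i = a_i^(1/i). The sequence a_i is log-concave and
   a_0 = 1, so phi_i is nonincreasing in i. Log-concavity follows from the
   Alexandrov-Fenchel inequality for mixed volumes with segments: a ball is
   approximated by zonotopes, and for segments the inequality goes down to
   Brunn-Minkowski by induction on their number.

   Let a round of half-width w use the index J at scale k, with l = l_k and
   l' = l_(k+1). Since S contains a cone over each of its slices K, the product
   of its height and a_i(K) is at most a_(i+1)(S). With the choice of J this gives
   w = O(l), and a_J(K) <= l'^J / 2 unless J = 1. Underpricing costs O(l)
   and lowers a_J by l'^J / 2, so that by l^(J+1) <= d^2 l'^J it costs
   O(d^2) per scale. Overpricing costs at most d and brings a_J down to the next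
   scale. In the remaining case J = 1 the slice is about as long as S is high, and
   the perimeter of a triangle shows that V_1 still drops by a fraction of order
   d^-2 of l'. A potential summing these effects over all J and all scales
   -d <= k <= 2 d ln (ln (2 d^2 T)) bounds the loss. *)

Require Import Defs.
From HB Require Import structures.
From mathcomp Require Import all_boot all_order all_algebra.
From mathcomp Require Import all_classical all_reals all_analysis.
From mathcomp Require Import measurable_realfun ring lra zify.

Set Implicit Arguments.
Unset Strict Implicit.
Unset Printing Implicit Defensive.

Import Order.TTheory GRing.Theory Num.Theory.
Import numFieldNormedType.Exports.

Local Open Scope classical_set_scope.
Local Open Scope ring_scope.

(** Mixed volumes are introduced only against segments, where they are algebra: the volume of K +
    sum t_i [0, y_i] is affine in each t_i, and its coefficients define a symmetric multilinear
    form. Zonotopes close to the ball come from averaging over reflections and compactness, with no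
    integration on the sphere. Steiner coefficients are interpolated from the volumes at the radii
    0, ..., n; as linear functions of finitely many volumes they inherit limits, additivity under
    cuts and homogeneity. Degenerate bodies are the recurrent obstacle, since signature arguments
    and roots ask for strict positivity. Such inequalities are proved after a perturbation in which
    they are polynomial, and then continued to perturbation 0. In a round, the constants c_i turn
    L_J <= w into a_J(K) <= 2 (w/2)^J, which is at most l'^J / 2 for w <= l' once J >= 2. For J = 1
    only a_1(K) <= w remains, so that overpricing may leave V_1 above l'. Paying for such rounds by
    drops of relative size d^-2 costs O(d^3) per scale, the order that d indices at O(d^2) each cost
    anyway. *)

#[export] Instance filter_nbhs_rV (R : realType) n (x : 'rV[R]_n) : Filter (nbhs x) :=
  nbhs_filter x.

(** * Images and products of sigma-finite measures *)

Section SigmaFinitePushforward.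
Context d1 d2 (T1 : measurableType d1) (T2 : measurableType d2) (R : realType).
Variables (m : {measure set T1 -> \bar R}).
Hypothesis m_fin : sigma_finite setT m.
Variables (f : T1 -> T2) (mf : measurable_fun setT f).
Variables (g : T2 -> T1) (mg : measurable_fun setT g).
Hypothesis fK : cancel f g.

(** An exhausting sequence F_n for [m] is carried to the sets g^-1(F_n), whose preimages under [f]
    are again F_n; this is the purpose of the measurable left inverse [g]. *)
Lemma sigma_finite_pushforward :
  exists mu : {sigma_finite_measure set T2 -> \bar R},
    forall A, mu A = m (f @^-1` A).
Proof.
have [F TF Foo] := m_fin.
have [h hE] : exists h : set T2 -> \bar R, h = fun A => m (f @^-1` A) by eexists.
have sf : sigma_finite setT h.
  exists (fun n => g @^-1` F n).
    by rewrite -preimage_bigcup -TF preimage_setT.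
  move=> n; have [mF Fn] := Foo n; split.
    by rewrite -[X in measurable X]setTI; exact: mg.
  rewrite hE -comp_preimage.
  suff -> : (g \o f) @^-1` F n = F n by [].
  by apply/seteqP; split=> x /=; rewrite fK.
have h0 : h set0 = 0%E by rewrite hE preimage_set0 measure0.
have h_ge0 A : (0 <= h A)%E by rewrite hE; exact: measure_ge0.
have h_s : semi_sigma_additive h.
  move=> E mE tE mUE; rewrite hE preimage_bigcup.
  apply: measure_semi_sigma_additive.
  - by move=> n; rewrite -[X in measurable X]setTI; exact: mf.
  - apply/trivIsetP => /= i j _ _ ij; rewrite -preimage_setI.
    by move/trivIsetP : tE => /(_ _ _ _ _ ij) ->//; rewrite preimage_set0.
  - by rewrite -preimage_bigcup -[X in measurable X]setTI; exact: mf.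
pose H1 := isMeasure.Build _ _ _ h h0 h_ge0 h_s.
pose mu : {measure set T2 -> \bar R} := HB.pack_for (Measure.type T2 R) h H1.
pose H2 := Measure_isSigmaFinite.Build _ _ _ mu sf.
pose nu : {sigma_finite_measure set T2 -> \bar R} :=
  HB.pack_for (SigmaFiniteMeasure.type T2 R) (Measure.sort mu) H2.
by exists nu => A /=; rewrite hE.
Qed.

End SigmaFinitePushforward.

Lemma sigma_finite_product d1 d2 (T1 : measurableType d1)
    (T2 : measurableType d2) (R : realType)
    (m1 : {sigma_finite_measure set T1 -> \bar R})
    (m2 : {sigma_finite_measure set T2 -> \bar R}) :
  sigma_finite setT (m1 \x m2)%E.
Proof.
have /sigma_finiteP[F [TF ndF Foo]] := sigma_finiteT m1.
have /sigma_finiteP[G [TG ndG Goo]] := sigma_finiteT m2.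
exists (fun n => F n `*` G n).
  apply/seteqP; split=> [[x y] _|//].
  have [n _ Fx] : (\bigcup_n F n) x by rewrite -TF.
  have [k _ Gy] : (\bigcup_n G n) y by rewrite -TG.
  exists (maxn n k) => //; split.
    by move: x Fx; exact/subsetPset/ndF/leq_maxl.
  by move: y Gy; exact/subsetPset/ndG/leq_maxr.
move=> k; have [mF Fk] := Foo k; have [mG Gk] := Goo k.
by split; [exact: measurableX|rewrite product_measure1E// lte_mul_pinfty// ge0_fin_numE].
Qed.

(** * The iterated integral as a measure on the Borel sets of R^n *)

Section Volume.
Context {R : realType}.

Definition borel_rV n := g_sigma_algebraType (@open 'rV[R]_n).

Definition vcons n (xy : R * 'rV[R]_n) : 'rV[R]_n.+1 :=
  row_mx (const_mx xy.1 : 'rV_1) xy.2.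

Definition vhead n (x : 'rV[R]_n.+1) : R := x ord0 ord0.
Definition vtail n (x : 'rV[R]_n.+1) : 'rV[R]_n := @rsubmx R 1 1 n x.

Lemma vcons_head n x (y : 'rV[R]_n) : vhead (vcons (x, y)) = x.
Proof.
transitivity (vcons (x, y) ord0 (lshift n (ord0 : 'I_1))).
  by rewrite /vhead; congr (vcons _ _ _); exact/val_inj.
by rewrite /vcons (@row_mxEl _ 1 1 n) mxE.
Qed.

Lemma vcons_tail n x (y : 'rV[R]_n) : vtail (vcons (x, y)) = y.
Proof. exact: (@row_mxKr _ 1 1 n). Qed.

Lemma vcons_lift n x (y : 'rV[R]_n) i : vcons (x, y) ord0 (lift ord0 i) = y ord0 i.
Proof.
by rewrite -rshift1 /vcons (@row_mxEr _ 1 1 n).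
Qed.

Lemma vtailE n (z : 'rV[R]_n.+1) i : vtail z ord0 i = z ord0 (lift ord0 i).
Proof. by rewrite /vtail mxE rshift1. Qed.

Lemma vconsK n (z : 'rV[R]_n.+1) : vcons (vhead z, vtail z) = z.
Proof.
apply/rowP => i; case: (unliftP ord0 i) => [j|] ->.
  by rewrite vcons_lift vtailE.
exact: vcons_head.
Qed.

Lemma vconsD n x x' (y y' : 'rV[R]_n) : vcons (x, y) + vcons (x', y') = vcons (x + x', y + y').
Proof.
apply/rowP => i; rewrite mxE; case: (unliftP ord0 i) => [j|] ->.
  by rewrite !vcons_lift mxE.
by rewrite -!/(vhead _) !vcons_head.
Qed.

Lemma vconsZ n a x (y : 'rV[R]_n) : a *: vcons (x, y) = vcons (a * x, a *: y).
Proof.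
apply/rowP => i; rewrite mxE; case: (unliftP ord0 i) => [j|] ->.
  by rewrite !vcons_lift mxE.
by rewrite -!/(vhead _) !vcons_head.
Qed.

Lemma vheadD n (x y : 'rV[R]_n.+1) : vhead (x + y) = vhead x + vhead y.
Proof. by rewrite /vhead mxE. Qed.
Lemma vheadZ n a (x : 'rV[R]_n.+1) : vhead (a *: x) = a * vhead x.
Proof. by rewrite /vhead mxE. Qed.
Lemma vtailD n (x y : 'rV[R]_n.+1) : vtail (x + y) = vtail x + vtail y.
Proof. by apply/rowP => i; rewrite [RHS]mxE !vtailE mxE. Qed.
Lemma vtailZ n a (x : 'rV[R]_n.+1) : vtail (a *: x) = a *: vtail x.
Proof. by apply/rowP => i; rewrite [RHS]mxE !vtailE mxE. Qed.

Lemma dot_vcons n x x' (y y' : 'rV[R]_n) :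
  dot (vcons (x, y)) (vcons (x', y')) = x * x' + dot y y'.
Proof.
rewrite /dot big_ord_recl; congr (_ + _).
  by rewrite -!/(vhead _) !vcons_head.
by apply: eq_bigr => i _; rewrite !vcons_lift.
Qed.

Lemma volumeS n (A : set 'rV[R]_n.+1) :
  volume A = (\int[lebesgue_measure]_(x in [set: R])
     volume [set y : 'rV[R]_n | A (vcons (x, y))])%E.
Proof. by []. Qed.

Lemma rV_nbhsP n (A : set 'rV[R]_n) (x : 'rV[R]_n) :
  nbhs x A <-> exists2 e : R, 0 < e & forall y : 'rV[R]_n, (forall i, `|x ord0 i - y ord0 i| < e) -> A y.
Proof.
split.
  move=> /nbhs_ballP[e e0 xe]; exists e => // y xy; apply: xe.
  by split=> // i j; rewrite ord1; exact: xy.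
move=> [e e0 xe]; apply/nbhs_ballP; exists e => // y [_ xy]; apply: xe => i.
exact: (xy ord0 i).
Qed.

(** The product sigma-algebra is generated by rectangles, so the preimage of an open set U must be a
    countable union of them. For an interval I with rational ends, V is the interior of the set of y
    whose strip over I lies in U; the rectangles I x V exhaust the preimage. *)
Lemma measurable_vcons n :
  measurable_fun [set: measurableTypeR R * borel_rV n] (@vcons n : _ -> borel_rV n.+1).
Proof.
apply: (@measurability _ _ _ _ _ _ (@open 'rV[R]_n.+1 : set (set (borel_rV n.+1)))) => //.
move=> _ [U oU <-]; rewrite setTI.
pose I (r : rat * rat) := [set x : R | ratr r.1 < x < ratr r.2].
pose V (r : rat * rat) :=
  interior [set y : 'rV[R]_n | forall x, I r x -> U (vcons (x, y))].
have -> : @vcons n @^-1` U = \bigcup_r (I r `*` V r).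
  apply/seteqP; split=> [[x y] /= Uxy|[x y] [r _ [/= Ix]]].
    move: oU; rewrite openE => /(_ _ Uxy) /rV_nbhsP[e e0 eU].
    have [a /andP[xa ax]] : {a : rat | x - e < ratr a < x}.
      by apply: cid; have := rat_in_itvoo (_ : x - e < x); rewrite ltrBlDr ltrDl;
         move=> /(_ e0)[a]; rewrite in_itv /=; exists a.
    have [b /andP[xb bx]] : {b : rat | x < ratr b < x + e}.
      by apply: cid; have := rat_in_itvoo (_ : x < x + e); rewrite ltrDl;
         move=> /(_ e0)[a']; rewrite in_itv /=; exists a'.
    exists (a, b) => //; split => /=; first by rewrite /I /= ax xb.
    apply/rV_nbhsP; exists e => // z yz x' /andP[/= ax' x'b]; apply: eU => i.
    case: (unliftP ord0 i) => [j|] ->; first by rewrite !vcons_lift.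
    rewrite -!/(vhead _) !vcons_head.
    rewrite ltr_norml; apply/andP; split.
      by rewrite ltrBrDr addrC -ltrBrDr opprK (lt_trans x'b).
    by rewrite ltrBlDr addrC -ltrBlDr (lt_trans xa).
  move=> Vy; have := nbhs_singleton Vy; exact.
apply: countable_bigcupT_measurable; first exact: countableP.
move=> r; apply: measurableX.
  have -> : I r = `](ratr r.1 : R), (ratr r.2)[%classic.
    by apply/seteqP; split=> z /=; rewrite in_itv.
  exact: measurable_itv.
by apply: sub_sigma_algebra; exact: open_interior.
Qed.

Lemma continuous_rVP m n (f : 'rV[R]_m -> 'rV[R]_n) :
  (forall i, continuous (fun x => f x ord0 i)) -> continuous f.
Proof.
move=> fc x A /rV_nbhsP[e e0 eA].
have : \forall y \near x, forall i, `|f x ord0 i - f y ord0 i| < e.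
  apply: (@filter_forall _ _ _ _ (nbhs_filter x)) => i.
  exact: ((@cvgrPdist_lt R R _ _ (nbhs_filter x) (fun x => f x ord0 i)
    (f x ord0 i)).1 (fc i x) e e0).
by apply: (@filterS _ _ (nbhs_filter x)) => y fy; exact: eA.
Qed.

Lemma continuous_measurable_rV m n (f : 'rV[R]_m -> 'rV[R]_n) :
  continuous f -> measurable_fun [set: borel_rV m] (f : _ -> borel_rV n).
Proof.
move=> cf; apply: (@measurability _ _ _ _ _ _ (@open 'rV[R]_n : set (set (borel_rV n)))) => //.
move=> _ [U oU <-]; rewrite setTI; apply: sub_sigma_algebra.
by apply: open_comp => // x _; exact: cf.
Qed.

Lemma continuous_measurable_rVR m (f : 'rV[R]_m -> R) :
  continuous f -> measurable_fun [set: borel_rV m] (f : _ -> measurableTypeR R).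
Proof.
move=> cf; apply: (measurability _ (measurable_realfun.RGenOpens.measurableE R)).
move=> _ [_ [a [b ->]] <-]; rewrite setTI; apply: sub_sigma_algebra.
by apply: open_comp => // x _; exact: cf.
Qed.

Lemma closed_borel n (A : set 'rV[R]_n) : closed A -> measurable (A : set (borel_rV n)).
Proof.
move=> cA; rewrite -[A]setCK; apply: measurableC; apply: sub_sigma_algebra.
exact: closed_openC.
Qed.

Lemma continuous_vhead n : continuous (@vhead n).
Proof. exact: coord_continuous. Qed.

Lemma continuous_vtail n : continuous (@vtail n).
Proof.
apply: continuous_rVP => i.
have -> : (fun x : 'rV[R]_n.+1 => vtail x ord0 i) = (fun x => x ord0 (lift ord0 i)).
  by apply/funext => x; rewrite vtailE.
exact: coord_continuous.
Qed.

(** By induction, the measure on R^(n+1) is the image under [vcons] of a product measure. The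
    equation holds for arbitrary sets, because both sides are the same iterated integral; additivity
    is claimed on Borel sets only. *)
Lemma volume_measure n :
  exists mu : {sigma_finite_measure set (borel_rV n) -> \bar R},
    forall A, mu A = volume A.
Proof.
elim: n => [|n [mu muE]].
  have sf : sigma_finite [set: borel_rV 0] (@dirac _ (borel_rV 0) (0 : 'rV[R]_0) R).
    exists (fun=> setT); first by rewrite bigcup_const.
    by move=> _; split => //; rewrite /dirac indicT ltry.
  pose nu : {sigma_finite_measure set (borel_rV 0) -> \bar R} :=
    HB.pack_for (SigmaFiniteMeasure.type (borel_rV 0) R)
      (@dirac _ (borel_rV 0) (0 : 'rV[R]_0) R)
      (Measure_isSigmaFinite.Build _ _ _ (@dirac _ (borel_rV 0) (0 : 'rV[R]_0) R) sf).
  exists nu => A /=; rewrite /nu /= /dirac indicE.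
  case: ifPn => [/asboolP[x Ax]|/asboolPn An].
    by rewrite mem_set// -(thinmx0 x).
  by rewrite memNset// => A0; apply: An; exists 0.
have [nu nuE] := @sigma_finite_pushforward _ _ _ _ R
  (@product_measure1 _ _ (measurableTypeR R) (borel_rV n) R lebesgue_measure mu)
  (@sigma_finite_product _ _ (measurableTypeR R) (borel_rV n) R lebesgue_measure mu) _ (@measurable_vcons n)
  (fun z => (vhead z, vtail z))
  (measurable_fun_pair (continuous_measurable_rVR (@continuous_vhead n))
    (continuous_measurable_rV (@continuous_vtail n)))
  (fun xy => let: (x, y) := xy in f_equal2 pair (vcons_head x y) (vcons_tail x y)).
exists nu => A; rewrite nuE volumeS /product_measure1.
apply: eq_integral => x _ /=; rewrite muE; congr volume.
by apply/seteqP; split=> y; rewrite /xsection /= inE.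
Qed.

Definition vol_measure n : {sigma_finite_measure set (borel_rV n) -> \bar R} :=
  sval (cid (volume_measure n)).

Lemma vol_measureE n A : vol_measure n A = volume A.
Proof. by rewrite /vol_measure; case: cid => mu /= ->. Qed.

End Volume.

(** * Change of variables under translations and linear maps *)

Section VolumeTheory.
Context {R : realType}.
Implicit Types (n : nat).

(** The image of Lebesgue measure under x -> a x + c, scaled by |a|, agrees with Lebesgue measure on
    half-open intervals, hence on all Borel sets. *)
Lemma integral_affine (F : R -> \bar R) (a c : R) :
  measurable_fun [set: R] F -> (forall x, 0 <= F x)%E -> a != 0 ->
  (`|a|%:E * \int[lebesgue_measure]_(x in [set: R]) F (a * x + c)%R
   = \int[lebesgue_measure]_(x in [set: R]) F x)%E.
Proof.
move=> mF F0 a0.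
pose f : R -> R := fun x => a * x + c.
have mf : measurable_fun [set: R] f.
  apply: continuous_measurable_fun => x; apply: cvgD; last exact: cvg_cst.
  by apply: cvgM; [exact: cvg_cst|exact: cvg_id].
have a_gt0 : 0 <= `|a| by [].
have mg : measurable_fun [set: R] (fun x => (x - c) / a).
  apply: continuous_measurable_fun => x; apply: cvgM; last exact: cvg_cst.
  by apply: cvgD; [exact: cvg_id|exact: cvg_cst].
have fK : cancel f (fun x => (x - c) / a) by move=> x; rewrite /f addrK mulrC mulKf.
have [nu' nu'E] := @sigma_finite_pushforward _ _ (measurableTypeR R) (measurableTypeR R)
  R lebesgue_measure (sigma_finiteT _) f mf _ mg fK.
pose nu : {measure set (measurableTypeR R) -> \bar R} := mscale (NngNum a_gt0) nu'.
have E (X : set R) : measurable X -> lebesgue_measure X = nu X.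
  move=> mX; apply: lebesgue_measure_unique => // _ [[p q] /= pq <-].
  rewrite /nu /mscale /= nu'E.
  rewrite lebesgue_measure_itv /=.
  have [a1|a1|a1] := ltgtP 0 a; last by rewrite -a1 eqxx in a0.
  - have -> : f @^-1` [set` `]p, q]] = `] (p - c) / a, (q - c) / a]%classic.
      apply/seteqP; split=> x /=; rewrite !in_itv /= /f ltr_pdivrMr// ler_pdivlMr//
        ltrBlDr lerBrDr mulrC//.
    rewrite lebesgue_measure_itv /= !lte_fin ltr_pM2r ?invr_gt0// ltrD2r.
    case: ifP => _; last by rewrite mule0.
    by rewrite -!EFinB -EFinM gtr0_norm//; congr EFin; field.
  - have -> : f @^-1` [set` `]p, q]] = `[ (q - c) / a, (p - c) / a[%classic.
      apply/seteqP; split=> x /=; rewrite !in_itv /= /f ler_ndivrMr// ltr_ndivlMr//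
        ltrBlDr lerBrDr mulrC andbC//.
    rewrite lebesgue_measure_itv /= !lte_fin ltr_nM2r ?invr_lt0// ltrD2r.
    case: ifP => _; last by rewrite mule0.
    by rewrite -!EFinB -EFinM ltr0_norm//; congr EFin; field.
transitivity (\int[nu]_x F x)%E; last first.
  by apply: eq_measure_integral => A mA _; exact/esym/E.
rewrite ge0_integral_mscale//=; congr (_ * _)%E.
rewrite -[LHS]/(\int[lebesgue_measure]_(x in f @^-1` setT) (F \o f) x)%E.
have e := @ge0_integral_pushforward _ _ (measurableTypeR R) (measurableTypeR R) R
  f mf lebesgue_measure setT F measurableT mF (fun y _ => F0 y).
apply: (etrans (esym e)).
by apply: eq_measure_integral => A mA _; first [exact/esym/nu'E|exact: nu'E].
Qed.

Lemma volume_ge0 n (A : set 'rV[R]_n) : (0 <= volume A)%E.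
Proof. by rewrite -vol_measureE; exact: measure_ge0. Qed.

Lemma volume_set0 n : volume (set0 : set 'rV[R]_n) = 0%E.
Proof. by rewrite -vol_measureE measure0. Qed.

Lemma le_volume n (A B : set 'rV[R]_n) :
  measurable (A : set (borel_rV n)) -> measurable (B : set (borel_rV n)) ->
  A `<=` B -> (volume A <= volume B)%E.
Proof.
by move=> mA mB AB; rewrite -!vol_measureE; apply: le_measure => //; rewrite inE.
Qed.

Lemma measurable_slice n (A : set 'rV[R]_n.+1) x :
  measurable (A : set (borel_rV n.+1)) ->
  measurable ([set y | A (vcons (x, y))] : set (borel_rV n)).
Proof.
move=> mA.
have m1 : measurable (@vcons R n @^-1` A : set (measurableTypeR R * borel_rV n)).
  by rewrite -[X in measurable X]setTI; exact: measurable_vcons.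
have := measurable_xsection x m1; congr measurable.
by apply/seteqP; split=> y; rewrite /xsection /= inE.
Qed.

Lemma measurable_slice_volume n (A : set 'rV[R]_n.+1) :
  measurable (A : set (borel_rV n.+1)) ->
  measurable_fun [set: R]
    (fun x => volume [set y : 'rV[R]_n | A (vcons (x, y))]).
Proof.
move=> mA.
have m1 : measurable (@vcons R n @^-1` A : set (measurableTypeR R * borel_rV n)).
  by rewrite -[X in measurable X]setTI; exact: measurable_vcons.
have := measurable_fun_xsection (vol_measure n) m1.
congr measurable_fun; apply/funext => x /=; rewrite vol_measureE.
by congr volume; apply/seteqP; split=> y; rewrite /xsection /= inE.
Qed.

Lemma measurable_head_slice n (A : set 'rV[R]_n.+1) y :
  measurable (A : set (borel_rV n.+1)) -> measurable ([set x | A (vcons (x, y))] : set R).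
Proof.
move=> mA.
have m1 : measurable (@vcons R n @^-1` A : set (measurableTypeR R * borel_rV n)).
  by rewrite -[X in measurable X]setTI; exact: measurable_vcons.
have := measurable_ysection (y : borel_rV n) m1; congr measurable.
by apply/seteqP; split=> x; rewrite /ysection /= inE.
Qed.

Lemma volume_tonelli n (A : set 'rV[R]_n.+1) :
  measurable (A : set (borel_rV n.+1)) ->
  volume A = (\int[vol_measure n]_y
    lebesgue_measure [set x : R | A (vcons (x, y))])%E.
Proof.
move=> mA.
have m1 : measurable (@vcons R n @^-1` A : set (measurableTypeR R * borel_rV n)).
  by rewrite -[X in measurable X]setTI; exact: measurable_vcons.
have := @indic_fubini_tonelli _ _ _ _ R lebesgue_measure (vol_measure n) _ m1.
have -> := @indic_fubini_tonelli_FE _ _ _ _ R (vol_measure n) _ m1.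
have -> := @indic_fubini_tonelli_GE _ _ _ _ R (@lebesgue_measure R) _ m1.
move=> e.
transitivity (\int[lebesgue_measure]_x (vol_measure n \o xsection (@vcons R n @^-1` A)) x)%E.
  rewrite volumeS; apply: eq_integral => x _ /=; rewrite vol_measureE; congr volume.
  by apply/seteqP; split=> y; rewrite /xsection /= inE.
rewrite e; apply: eq_integral => y _ /=; congr lebesgue_measure.
by apply/seteqP; split=> x; rewrite /ysection /= inE.
Qed.

Lemma measurable_preimage_continuous m n (f : 'rV[R]_m -> 'rV[R]_n) (A : set 'rV[R]_n) :
  continuous f -> measurable (A : set (borel_rV n)) ->
  measurable (f @^-1` A : set (borel_rV m)).
Proof.
move=> cf mA; rewrite -[X in measurable X]setTI.
exact: (continuous_measurable_rV cf).
Qed.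

Lemma continuous_mulmx m n (T : 'M[R]_(m, n)) : continuous (fun x : 'rV[R]_m => x *m T).
Proof.
apply: continuous_rVP => i.
have -> : (fun x : 'rV[R]_m => (x *m T) ord0 i) =
    (fun x : 'rV[R]_m => \sum_j x ord0 j * T j i).
  by apply/funext => x; rewrite mxE.
elim: (index_enum _) => [|j s IH].
  have -> : (fun x : 'rV[R]_m => \sum_(j <- [::]) x ord0 j * T j i) = fun=> 0.
    by apply/funext => x; rewrite big_nil.
  by move=> x; exact: cvg_cst.
have -> : (fun x : 'rV[R]_m => \sum_(k <- j :: s) x ord0 k * T k i) =
    fun x => x ord0 j * T j i + \sum_(k <- s) x ord0 k * T k i.
  by apply/funext => x; rewrite big_cons.
move=> x; apply: cvgD; last exact: IH.
by apply: cvgM; [exact: (@coord_continuous R 1 m ord0 j x)|exact: cvg_cst].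
Qed.

Lemma continuous_addrV n (b : 'rV[R]_n) : continuous (fun x : 'rV[R]_n => x + b).
Proof.
apply: continuous_rVP => i.
have -> : (fun x : 'rV[R]_n => (x + b) ord0 i) = fun x => x ord0 i + b ord0 i.
  by apply/funext => x; rewrite mxE.
by move=> x; apply: cvgD; [exact: (@coord_continuous R 1 n ord0 i x)|exact: cvg_cst].
Qed.

Lemma volume_translate n (A : set 'rV[R]_n) b :
  measurable (A : set (borel_rV n)) -> volume [set x | A (x + b)] = volume A.
Proof.
elim: n A b => [|n IH] A b mA.
  by congr volume; apply/seteqP; split=> x /=; rewrite (thinmx0 (x + b)) (thinmx0 x).
rewrite !volumeS -[in RHS](@integral_affine _ 1 (vhead b))//; last 2 first.
  exact: measurable_slice_volume.
  by move=> x; exact: volume_ge0.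
rewrite normr1 mul1e; apply: eq_integral => x _; rewrite mul1r.
rewrite -[RHS](IH _ (vtail b)); last exact: measurable_slice.
by congr volume; apply/seteqP; split=> y /=; rewrite -vconsD vconsK.
Qed.

Definition scales_volume n (T : 'M[R]_n) := forall A : set 'rV[R]_n,
  measurable (A : set (borel_rV n)) ->
  (`|\det T|%:E * volume [set x | A (x *m T)] = volume A)%E.

Lemma scales_volumeM n (T U : 'M[R]_n) :
  scales_volume T -> scales_volume U -> scales_volume (T *m U).
Proof.
move=> sT sU A mA; rewrite det_mulmx normrM EFinM -(sU A mA).
rewrite -(sT [set x | A (x *m U)]); last first.
  exact: (measurable_preimage_continuous (@continuous_mulmx _ _ U)).
rewrite muleA [X in (X * _)%E]muleC; congr (_ * _)%E; congr volume.
by apply/seteqP; split=> x /=; rewrite mulmxA.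
Qed.

Lemma mulmx_vcons n x (y : 'rV[R]_n) a b c (D : 'M[R]_n) :
  vcons (x, y) *m (block_mx a b c D : 'M[R]_(1 + n)) =
  vcons (x * a ord0 ord0 + (y *m c) ord0 ord0, x *: b + y *m D).
Proof.
rewrite /vcons /= (@mul_row_block _ 1 1 n 1 n); congr row_mx.
  apply/rowP => i; rewrite [LHS]mxE [RHS]mxE [X in X + _]mxE big_ord1 mxE.
  by rewrite !ord1.
congr (_ + _); apply/rowP => i; rewrite [LHS]mxE big_ord1 !mxE.
by [].
Qed.

Lemma scales_volume_upper n (a : 'M[R]_1) b (D : 'M[R]_n) :
  a ord0 ord0 != 0 -> scales_volume D ->
  scales_volume (block_mx a b 0 D : 'M[R]_(1 + n)).
Proof.
move=> a0 sD A mA; rewrite (@det_ublock _ 1 n) det_mx11 normrM EFinM -muleA.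
rewrite [in RHS]volumeS -[in RHS](@integral_affine _ (a ord0 ord0) 0)//; last 2 first.
  exact: measurable_slice_volume.
  by move=> x; exact: volume_ge0.
congr (_ * _)%E; rewrite volumeS -ge0_integralZl//; last 2 first.
- apply: (@measurable_slice_volume n [set x0 | A (x0 *m block_mx a b 0 D)]).
  exact: (measurable_preimage_continuous (@continuous_mulmx _ _ (block_mx a b 0 D))).
- by move=> x _; exact: volume_ge0.
apply: eq_integral => x _; rewrite addr0.
rewrite -[RHS](volume_translate (x *: b)); last exact: measurable_slice.
rewrite -[RHS]sD; last first.
  apply: (measurable_preimage_continuous (f := fun y => y + x *: b)).
    exact: continuous_addrV.
  exact: measurable_slice.
congr (_ * _)%E; congr volume; apply/seteqP; split=> y /=;
  by rewrite mulmx_vcons mulmx0 mxE addr0 mulrC addrC.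
Qed.

(** This shear moves the first coordinate by an amount depending on the tail. Integrating over the
    first coordinate innermost, by Tonelli, makes it a translation of each line. *)
Lemma scales_volume_lower n (c : 'M[R]_(n, 1)) :
  scales_volume (block_mx 1%:M 0 c 1%:M : 'M[R]_(1 + n)).
Proof.
move=> A mA; rewrite (@det_lblock _ 1 n) !det1 mulr1 normr1 mul1e.
rewrite !volume_tonelli//; last first.
  exact: (measurable_preimage_continuous (@continuous_mulmx _ _ (block_mx 1%:M 0 c 1%:M))).
apply: eq_integral => y _.
set B := [set x | A (vcons (x, y))].
have mB : measurable (B : set R) by exact: measurable_head_slice.
have mI : measurable_fun [set: R] (EFin \o \1_B : R -> \bar R).
  by apply/measurable_EFinP; exact: measurable_indic.
have I0 (x : R) : (0 <= (EFin \o \1_B : R -> \bar R) x)%E by rewrite lee_fin.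
have := integral_affine ((y *m c) ord0 ord0) mI I0 (oner_neq0 _).
rewrite normr1 mul1e [RHS]integral_indic//= setIT => <-.
rewrite -[LHS](congr1 _ (setIT _)) -integral_indic//; last first.
  apply: (@measurable_head_slice n [set x | A (x *m block_mx 1%:M 0 c 1%:M)] y).
  exact: (measurable_preimage_continuous (@continuous_mulmx _ _ (block_mx 1%:M 0 c 1%:M))).
apply: eq_integral => x _ /=.
rewrite !indicE; congr (_%:R%:E); congr (nat_of_bool _).
have one : (1%:M : 'M[R]_1) ord0 ord0 = 1 by rewrite mxE eqxx.
by apply/idP/idP; rewrite !inE /B /= mulmx_vcons one mulr1 mul1r scaler0 add0r mulmx1.
Qed.

(** Elimination on the first column: with a nonzero pivot, [T] is a unipotent lower block matrix
    times an upper block matrix, and both factors respect iterated integration. A zero pivot is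
    first made nonzero by adding another row to the first one. *)
Lemma scales_volume_unit n (T : 'M[R]_n) : T \in unitmx -> scales_volume T.
Proof.
elim: n T => [|n IH] T uT.
  move=> A mA; rewrite det_mx00 normr1 mul1e; congr volume.
  by apply/seteqP; split=> x /=; rewrite (thinmx0 (x *m T)) (thinmx0 x).
have corner (T' : 'M[R]_(1 + n)) : T' \in unitmx -> T' ord0 ord0 != 0 -> scales_volume T'.
  move=> uT' T0.
  pose a := ulsubmx T'; pose b := ursubmx T'; pose c := dlsubmx T'; pose D := drsubmx T'.
  pose a0 := T' ord0 ord0.
  have aE : a = a0%:M.
    apply/matrixP => i j; rewrite !ord1 !mxE eqxx mulr1n /a0.
    by congr (T' _ _); exact: val_inj.
  have T'E : T' = block_mx 1%:M 0 (a0^-1 *: c) 1%:M *m block_mx a b 0 (D - (a0^-1 *: c) *m b).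
    rewrite mulmx_block !mul1mx !mul0mx !addr0.
    rewrite -[LHS](@submxK _ 1 n 1 n); congr block_mx.
      by rewrite aE mul_mx_scalar scalerA divff// scale1r.
    by rewrite addrC subrK.
  rewrite T'E; apply: scales_volumeM; first exact: scales_volume_lower.
  apply: scales_volume_upper.
    by rewrite aE !mxE eqxx mulr1n.
  apply: IH; move: uT'; rewrite T'E unitmx_mul => /andP[_].
  by rewrite !unitmxE (@det_ublock _ 1 n) unitrM => /andP[].
have [T0|T0] := eqVneq (T ord0 ord0) 0; last exact: corner.
have [i Ti] : exists i : 'I_n, T (lift ord0 i) ord0 != 0.
  apply/existsP; apply: contraT; rewrite negb_exists => /forallP Tn.
  have : \det T = 0.
    rewrite (expand_det_col _ ord0) big1// => i _.
    case: (unliftP ord0 i) => [j|] ->; last by rewrite T0 mul0r.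
    by have := Tn j; rewrite negbK => /eqP ->; rewrite mul0r.
  by move: uT; rewrite unitmxE => /[swap] ->; rewrite unitr0.
pose E : 'M[R]_(1 + n) := block_mx 1%:M (- delta_mx ord0 i) 0 1%:M.
pose E' : 'M[R]_(1 + n) := block_mx 1%:M (delta_mx ord0 i) 0 1%:M.
have EE' : E *m E' = 1%:M.
  rewrite mulmx_block !mul1mx !mulmx1 !mul0mx !mulmx0 !addr0 add0r subrr.
  by rewrite -(@scalar_mx_block _ 1 n).
have -> : T = E *m (E' *m T) by rewrite mulmxA EE' mul1mx.
apply: scales_volumeM.
  apply: scales_volume_upper; first by rewrite mxE eqxx oner_neq0.
  by move=> A mA; rewrite det1 normr1 mul1e; congr volume; apply/seteqP; split=> x /=; rewrite mulmx1.
apply: corner.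
  by rewrite unitmx_mul uT andbT; move: (mulmx1_unit EE') => [].
have -> : (E' *m T) ord0 ord0 = T (lift ord0 i) ord0.
  have E'j j : E' ord0 (lift ord0 j) = (j == i)%:R.
    transitivity (E' (lshift n (ord0 : 'I_1)) (rshift 1 j)).
      by congr (E' _ _); exact: val_inj.
    by rewrite /E' (@block_mxEur _ 1 n 1 n) mxE.
  rewrite mxE big_ord_recl T0 mulr0 add0r (bigD1 i)//= big1.
    by rewrite E'j eqxx mul1r addr0.
  by move=> j ji; rewrite E'j (negPf ji) mul0r.
by [].
Qed.

Lemma volume_linear n (T : 'M[R]_n) (A : set 'rV[R]_n) :
  T \in unitmx -> measurable (A : set (borel_rV n)) ->
  (`|\det T|%:E * volume [set x | A (x *m T)] = volume A)%E.
Proof. by move=> uT; exact: scales_volume_unit. Qed.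

End VolumeTheory.

(** * Compact convex sets, Minkowski sums and the dot product *)

Section ConvexBodies.
Context {R : realType}.
Implicit Types (n : nat).

Definition minksum n (A B : set 'rV[R]_n) : set 'rV[R]_n :=
  [set z | exists x y, [/\ A x, B y & z = x + y]].

Definition mscal n (s : R) (A : set 'rV[R]_n) : set 'rV[R]_n := [set s *: x | x in A].

Definition seg n (x : 'rV[R]_n) : set 'rV[R]_n := [set t *: x | t in [set t : R | 0 <= t <= 1]].

Definition cvx n (A : set 'rV[R]_n) :=
  forall x y (s t : R), A x -> A y -> 0 <= s -> 0 <= t -> s + t = 1 -> A (s *: x + t *: y).

(** The empty set is a body, so that slices and halves of bodies are bodies without a case
    distinction. *)
Definition body n (A : set 'rV[R]_n) := compact A /\ cvx A.

Lemma compact_rVP n (A : set 'rV[R]_n) :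
  compact A <-> closed A /\ exists M, forall x, A x -> forall i, `|x ord0 i| <= M.
Proof.
split=> [cA|[clA [M AM]]].
  split; first exact: (compact_closed (@norm_hausdorff _ _)).
  have [M [_ HM]] := compact_bounded cA.
  exists (M + 2) => x Ax i.
  have : ball (0 : 'rV[R]_n) (M + 2) x.
    rewrite -ball_normE /= sub0r normrN.
    apply: (le_lt_trans (HM (M + 1) _ x Ax)); first by rewrite ltrDl.
    by rewrite ltrD2l ltr1n.
  by move=> [_ /(_ ord0 i)]; rewrite /ball /= mxE sub0r normrN => /ltW.
apply: bounded_closed_compact => //; exists `|M|; split; first exact: num_real.
move=> N MN x Ax; have N0 : 0 < N by exact: le_lt_trans MN.
have : ball (0 : 'rV[R]_n) N x.
  split=> // i j; rewrite ord1 mxE /ball /= sub0r normrN.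
  exact: le_lt_trans (le_trans (AM x Ax j) (ler_norm M)) MN.
by rewrite -ball_normE /= sub0r normrN => /ltW.
Qed.

Lemma compact_borel n (A : set 'rV[R]_n) : compact A -> measurable (A : set (borel_rV n)).
Proof. by move=> /compact_rVP[cA _]; exact: closed_borel. Qed.

Lemma compact_preimage n m (f : 'rV[R]_n -> 'rV[R]_m) (A : set 'rV[R]_m) :
  continuous f -> compact A ->
  (exists M, forall x, A (f x) -> forall i, `|x ord0 i| <= M) -> compact (f @^-1` A).
Proof.
move=> cf /compact_rVP[cA _] b; apply/compact_rVP; split=> //.
by apply: closed_comp => // x _; exact: cf.
Qed.

Lemma compact_image n m (f : 'rV[R]_n -> 'rV[R]_m) (A : set 'rV[R]_n) :
  continuous f -> compact A -> compact (f @` A).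
Proof. by move=> cf cA; apply: continuous_compact => //; exact: continuous_subspaceT. Qed.

Lemma compact_minksum n (A B : set 'rV[R]_n) : compact A -> compact B -> compact (minksum A B).
Proof.
move=> cA cB.
have -> : minksum A B = (fun z : 'rV[R]_n * 'rV[R]_n => z.1 + z.2) @` (A `*` B).
  apply/seteqP; split=> [z [x [y [Ax By ->]]]|_ [[x y] [/= Ax By] <-]].
    by exists (x, y).
  by exists x, y.
apply: continuous_compact; last exact: compact_setX.
by apply: continuous_subspaceT; exact: add_continuous.
Qed.

Lemma compact_mscal n s (A : set 'rV[R]_n) : compact A -> compact (mscal s A).
Proof.
move=> cA; apply: compact_image => //.
have -> : (fun x : 'rV[R]_n => s *: x) = fun x => x *m s%:M.
  by apply/funext => x; rewrite mul_mx_scalar.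
exact: continuous_mulmx.
Qed.

Lemma compact_seg n (x : 'rV[R]_n) : compact (seg x).
Proof.
have -> : seg x = (fun t : R => t *: x) @` `[0, 1]%classic.
  by congr image; apply/seteqP; split=> t /=; rewrite in_itv.
apply: continuous_compact; last exact: segment_compact.
apply: continuous_subspaceT => t A /rV_nbhsP[e e0 eA].
have : \forall u \near t, forall i, `|(t *: x) ord0 i - (u *: x) ord0 i| < e.
  apply: (@filter_forall _ _ _ _ (nbhs_filter t)) => i.
  have : (fun u : R => u * x ord0 i) u @[u --> t] --> t * x ord0 i.
    by apply: cvgM; [exact: cvg_id|exact: cvg_cst].
  move/cvgrPdist_lt => /(_ e e0); apply: filterS => u; by rewrite !mxE.
by apply: filterS => u ue; exact: eA.
Qed.

Lemma closed_le_continuous n (f : 'rV[R]_n -> R) (a : R) :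
  continuous f -> closed [set x | f x <= a].
Proof.
move=> cf; apply: (@closed_comp _ _ f [set y | y <= a]); last exact: closed_le.
by move=> x _; exact: cf.
Qed.

Lemma closed_ge_continuous n (f : 'rV[R]_n -> R) (a : R) :
  continuous f -> closed [set x | a <= f x].
Proof.
move=> cf; apply: (@closed_comp _ _ f [set y | a <= y]); last exact: closed_ge.
by move=> x _; exact: cf.
Qed.

Lemma compact_closedI n (A B : set 'rV[R]_n) : compact A -> closed B -> compact (A `&` B).
Proof.
move=> /compact_rVP[cA [M AM]] cB; apply/compact_rVP; split; first exact: closedI.
by exists M => x [Ax _]; exact: AM.
Qed.

Lemma continuous_dot n (u : 'rV[R]_n) : continuous (fun x : 'rV[R]_n => dot u x).
Proof.
rewrite /dot; elim: (index_enum _) => [|j s IH].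
  have -> : (fun x : 'rV[R]_n => \sum_(i <- [::]) u ord0 i * x ord0 i) = fun=> 0.
    by apply/funext => x; rewrite big_nil.
  by move=> x; exact: cvg_cst.
have -> : (fun x : 'rV[R]_n => \sum_(i <- j :: s) u ord0 i * x ord0 i) =
    fun x => u ord0 j * x ord0 j + \sum_(i <- s) u ord0 i * x ord0 i.
  by apply/funext => x; rewrite big_cons.
move=> x; apply: cvgD; last exact: IH.
by apply: cvgM; [exact: cvg_cst|exact: (@coord_continuous R 1 n ord0 j x)].
Qed.

Lemma continuous_sqnorm n : continuous (fun x : 'rV[R]_n => dot x x).
Proof.
rewrite /dot; elim: (index_enum _) => [|j s IH].
  have -> : (fun x : 'rV[R]_n => \sum_(i <- [::]) x ord0 i * x ord0 i) = fun=> 0.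
    by apply/funext => x; rewrite big_nil.
  by move=> x; exact: cvg_cst.
have -> : (fun x : 'rV[R]_n => \sum_(i <- j :: s) x ord0 i * x ord0 i) =
    fun x => x ord0 j * x ord0 j + \sum_(i <- s) x ord0 i * x ord0 i.
  by apply/funext => x; rewrite big_cons.
move=> x; apply: cvgD; last exact: IH.
by apply: cvgM; exact: (@coord_continuous R 1 n ord0 j x).
Qed.

Lemma dotC n (x y : 'rV[R]_n) : dot x y = dot y x.
Proof. by apply: eq_bigr => i _; rewrite mulrC. Qed.
Lemma dotDl n (x y z : 'rV[R]_n) : dot (x + y) z = dot x z + dot y z.
Proof. by rewrite -big_split; apply: eq_bigr => i _; rewrite mxE mulrDl. Qed.
Lemma dotDr n (x y z : 'rV[R]_n) : dot z (x + y) = dot z x + dot z y.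
Proof. by rewrite !(dotC z) dotDl. Qed.
Lemma dotZl n a (x z : 'rV[R]_n) : dot (a *: x) z = a * dot x z.
Proof. by rewrite mulr_sumr; apply: eq_bigr => i _; rewrite mxE mulrA. Qed.
Lemma dotZr n a (x z : 'rV[R]_n) : dot z (a *: x) = a * dot z x.
Proof. by rewrite !(dotC z) dotZl. Qed.
Lemma dotNl n (x z : 'rV[R]_n) : dot (- x) z = - dot x z.
Proof. by rewrite -scaleN1r dotZl mulN1r. Qed.
Lemma dotNr n (x z : 'rV[R]_n) : dot z (- x) = - dot z x.
Proof. by rewrite !(dotC z) dotNl. Qed.
Lemma dotBl n (x y z : 'rV[R]_n) : dot (x - y) z = dot x z - dot y z.
Proof. by rewrite dotDl dotNl. Qed.
Lemma dotBr n (x y z : 'rV[R]_n) : dot z (x - y) = dot z x - dot z y.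
Proof. by rewrite dotDr dotNr. Qed.
Lemma dot0l n (z : 'rV[R]_n) : dot 0 z = 0.
Proof. by rewrite -(scale0r 0) dotZl mul0r. Qed.
Lemma dot0r n (z : 'rV[R]_n) : dot z 0 = 0.
Proof. by rewrite dotC dot0l. Qed.
Lemma dot_ge0 n (x : 'rV[R]_n) : 0 <= dot x x.
Proof. by apply: sumr_ge0 => i _; rewrite -expr2 sqr_ge0. Qed.
Lemma dot_eq0 n (x : 'rV[R]_n) : (dot x x == 0) = (x == 0).
Proof.
apply/eqP/eqP => [|->]; last by rewrite dot0l.
move=> /eqP; rewrite psumr_eq0; last by move=> i _; rewrite -expr2 sqr_ge0.
move=> /allP h; apply/rowP => i; rewrite mxE.
by have := h i; rewrite mem_index_enum -expr2 sqrf_eq0 => /(_ isT)/eqP.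
Qed.
Lemma dot_mulmx_orth n (Q : 'M[R]_n) (x y : 'rV[R]_n) :
  Q *m Q^T = 1%:M -> dot (x *m Q) (y *m Q) = dot x y.
Proof.
have dE (a b : 'rV[R]_n) : dot a b = (a *m b^T) ord0 ord0.
  by rewrite mxE; apply: eq_bigr => i _; rewrite mxE.
by move=> QQ; rewrite !dE trmx_mul mulmxA -(mulmxA x) QQ mulmx1.
Qed.

Lemma coord_sqr_le_dot n (x : 'rV[R]_n) i : x ord0 i ^+ 2 <= dot x x.
Proof.
rewrite /dot (bigD1 i)//= -expr2 lerDl; apply: sumr_ge0 => j _.
by rewrite -expr2 sqr_ge0.
Qed.

Lemma cauchy_schwarz n (x y : 'rV[R]_n) : dot x y ^+ 2 <= dot x x * dot y y.
Proof.
have [->|x0] := eqVneq x 0; first by rewrite !dot0l mul0r expr0n.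
have xx : 0 < dot x x by rewrite lt_neqAle dot_ge0 eq_sym dot_eq0 x0.
have := dot_ge0 (dot x x *: y - dot x y *: x).
rewrite dotBl !dotBr !dotZl !dotZr (dotC y x) => h.
have : 0 <= dot x x * (dot x x * dot y y - dot x y ^+ 2) by apply: le_trans h _; lra.
by rewrite pmulr_rge0// subr_ge0.
Qed.

Lemma dot_le_sqr n (x y : 'rV[R]_n) : 2 * dot x y <= dot x x + dot y y.
Proof. by have := dot_ge0 (x - y); rewrite dotBl !dotBr (dotC y x); lra. Qed.

Lemma cvx_minksum n (A B : set 'rV[R]_n) : cvx A -> cvx B -> cvx (minksum A B).
Proof.
move=> cA cB _ _ s t [x [y [Ax By ->]]] [x' [y' [Ax' By' ->]]] s0 t0 st.
exists (s *: x + t *: x'), (s *: y + t *: y'); split; [exact: cA|exact: cB|].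
by rewrite !scalerDr addrACA.
Qed.

Lemma cvx_mscal n a (A : set 'rV[R]_n) : cvx A -> cvx (mscal a A).
Proof.
move=> cA _ _ s t [x Ax <-] [y Ay <-] s0 t0 st.
exists (s *: x + t *: y); first exact: cA.
by rewrite scalerDr !scalerA (mulrC a s) (mulrC a t).
Qed.

Lemma cvx_seg n (x : 'rV[R]_n) : cvx (seg x).
Proof.
move=> _ _ s t [a /andP[a0 a1] <-] [b /andP[b0 b1] <-] s0 t0 st.
exists (s * a + t * b); last by rewrite !scalerA scalerDl.
have sE : s = 1 - t by lra.
by apply/andP; split; [rewrite addr_ge0// mulr_ge0|rewrite sE; nra].
Qed.

Lemma cvx_setI n (A B : set 'rV[R]_n) : cvx A -> cvx B -> cvx (A `&` B).
Proof. by move=> cA cB x y s t [? ?] [? ?] *; split; [exact: cA|exact: cB]. Qed.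

Lemma cvx_preimage n m (f : 'rV[R]_n -> 'rV[R]_m) (A : set 'rV[R]_m) :
  (forall x y s t, s + t = 1 -> f (s *: x + t *: y) = s *: f x + t *: f y) ->
  cvx A -> cvx (f @^-1` A).
Proof. by move=> fE cA x y s t Ax Ay s0 t0 st; rewrite /preimage /= fE//; exact: cA. Qed.

Lemma cvx_image n m (f : 'rV[R]_n -> 'rV[R]_m) (A : set 'rV[R]_n) :
  (forall x y s t, s + t = 1 -> f (s *: x + t *: y) = s *: f x + t *: f y) ->
  cvx A -> cvx (f @` A).
Proof.
move=> fE cA _ _ s t [x Ax <-] [y Ay <-] s0 t0 st.
by exists (s *: x + t *: y); [exact: cA|rewrite fE].
Qed.

Lemma cvx_le_dot n (u : 'rV[R]_n) p : cvx [set x | dot u x <= p].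
Proof. by move=> x y s t /= xp yp s0 t0 st; rewrite dotDr !dotZr; nra. Qed.
Lemma cvx_ge_dot n (u : 'rV[R]_n) p : cvx [set x | p <= dot u x].
Proof. by move=> x y s t /= xp yp s0 t0 st; rewrite dotDr !dotZr; nra. Qed.

Lemma body_minksum n (A B : set 'rV[R]_n) : body A -> body B -> body (minksum A B).
Proof. by move=> [? ?] [? ?]; split; [exact: compact_minksum|exact: cvx_minksum]. Qed.
Lemma body_mscal n s (A : set 'rV[R]_n) : body A -> body (mscal s A).
Proof. by move=> [? ?]; split; [exact: compact_mscal|exact: cvx_mscal]. Qed.
Lemma body_seg n (x : 'rV[R]_n) : body (seg x).
Proof. by split; [exact: compact_seg|exact: cvx_seg]. Qed.

Lemma upper_partE n (S : set 'rV[R]_n) u p : upper_part S u p = S `&` [set x | p <= dot u x].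
Proof. by []. Qed.
Lemma lower_partE n (S : set 'rV[R]_n) u p : lower_part S u p = S `&` [set x | dot u x <= p].
Proof. by []. Qed.
Lemma sliceE n (S : set 'rV[R]_n) u p :
  slice S u p = S `&` [set x | p <= dot u x] `&` [set x | dot u x <= p].
Proof.
apply/seteqP; split=> [x [Sx <-]|x [[/= Sx px] xp]].
  by split=> //=; split=> //=.
by split=> //; apply/eqP; rewrite eq_le px xp.
Qed.

Lemma body_upper_part n (S : set 'rV[R]_n) u p : body S -> body (upper_part S u p).
Proof.
move=> [cS xS]; rewrite upper_partE; split; last by apply: cvx_setI => //; exact: cvx_ge_dot.
by apply: compact_closedI => //; apply: closed_ge_continuous; exact: continuous_dot.
Qed.
Lemma body_lower_part n (S : set 'rV[R]_n) u p : body S -> body (lower_part S u p).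
Proof.
move=> [cS xS]; rewrite lower_partE; split; last by apply: cvx_setI => //; exact: cvx_le_dot.
by apply: compact_closedI => //; apply: closed_le_continuous; exact: continuous_dot.
Qed.
Lemma body_slice n (S : set 'rV[R]_n) u p : body S -> body (slice S u p).
Proof. by move=> bS; rewrite sliceE; exact/body_lower_part/body_upper_part. Qed.

Lemma body_unit_ball n : body (@unit_ball R n).
Proof.
split; last first.
  move=> x y s t; rewrite /unit_ball /= => xx yy s0 t0 st.
  rewrite dotDl !dotDr !dotZl !dotZr (dotC y x).
  have := dot_le_sqr x y => xy.
  have sE : s = 1 - t by lra.
  have h1 : s * t * (2 * dot x y) <= s * t * 2.
    by apply: ler_wpM2l; [exact: mulr_ge0|lra].
  have h2 : s * s * dot x x <= s * s by apply: ler_piMr => //; exact: mulr_ge0.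
  have h3 : t * t * dot y y <= t * t by apply: ler_piMr => //; exact: mulr_ge0.
  have h4 : s * s + s * t * 2 + t * t = 1 by rewrite sE; ring.
  lra.
apply/compact_rVP; split.
  by apply: (@closed_le_continuous n (fun x => dot x x)); exact: continuous_sqnorm.
exists 1 => x; rewrite /unit_ball /= => xx i.
rewrite -(@ler_pXn2r _ 2)// ?nnegrE// expr1n real_normK ?num_real//.
exact: le_trans (coord_sqr_le_dot x i) xx.
Qed.

Lemma body_set1 n (x : 'rV[R]_n) : body [set x].
Proof.
split; last by move=> _ _ s t /= -> -> _ _ st; rewrite -scalerDl st scale1r.
exact: compact_set1.
Qed.

Lemma body_slice_head n (K : set 'rV[R]_n.+1) x : body K -> body [set y | K (vcons (x, y))].
Proof.
move=> [cK xK]; split; last first.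
  move=> y z s t /= Ky Kz s0 t0 st; have := xK _ _ _ _ Ky Kz s0 t0 st.
  by rewrite !vconsZ vconsD -mulrDl st mul1r.
have cv : continuous (fun y : 'rV[R]_n => vcons (x, y)).
  apply: continuous_rVP => i; case: (unliftP ord0 i) => [j|] ->.
    have -> : (fun y : 'rV[R]_n => vcons (x, y) ord0 (lift ord0 j)) = fun y => y ord0 j.
      by apply/funext => y; rewrite vcons_lift.
    exact: coord_continuous.
  have -> : (fun y : 'rV[R]_n => vcons (x, y) ord0 ord0) = fun=> x.
    by apply/funext => y; exact: vcons_head.
  by move=> y; exact: cvg_cst.
apply: (compact_preimage cv cK).
have /compact_rVP[_ [M KM]] := cK.
by exists M => y Ky i; have := KM _ Ky (lift ord0 i); rewrite vcons_lift.
Qed.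

Lemma parallel_bodyE n (K : set 'rV[R]_n) e :
  parallel_body K e = minksum K (mscal e (@unit_ball R n)).
Proof.
apply/seteqP; split=> [z [x [b [Kx Bb ->]]]|z [x [_ [Kx [b Bb <-] ->]]]].
  by exists x, (e *: b); split=> //; exists b.
by exists x, b.
Qed.

End ConvexBodies.

(** * Volumes of bodies: dilations, orthogonal maps, added segments *)

Section BodyVolume.
Context {R : realType}.
Implicit Types (n : nat).

Definition vol n (A : set 'rV[R]_n) : R := fine (volume A).

Lemma volume_box n (M : R) : 0 <= M ->
  volume [set x : 'rV[R]_n | forall i, `|x ord0 i| <= M] = ((2 * M) ^+ n)%:E.
Proof.
move=> M0; elim: n => [|n IH].
  rewrite expr0 /=; case: ifPn => // /asboolPn; case; exists 0; by move=> [].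
rewrite volumeS.
transitivity (\int[lebesgue_measure]_(x in [set: R])
    (((2 * M) ^+ n)%:E * (\1_(`[- M, M]%classic) x)%:E))%E.
  apply: eq_integral => x _; rewrite indicE.
  case: (boolP (x \in _)) => [|xM].
    rewrite inE /= in_itv /= -ler_norml => xM; rewrite mule1 -IH; congr volume.
    apply/seteqP; split=> y /= h i; first by have := h (lift ord0 i); rewrite vcons_lift.
    case: (unliftP ord0 i) => [j|] ->; first by rewrite vcons_lift.
    by rewrite -/(vhead _) vcons_head.
  rewrite mule0 -(@volume_set0 R n); congr volume.
  apply/seteqP; split=> y //= h; have := h ord0; rewrite -/(vhead _) vcons_head => xM'.
  by move: xM; rewrite notin_setE /= in_itv /= -ler_norml xM'.
rewrite ge0_integralZl//; last by rewrite lee_fin exprn_ge0// mulr_ge0.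
  rewrite integral_indic//= setIT lebesgue_measure_itv /= lte_fin.
  case: ltP => h; first by rewrite -EFinB -EFinM; congr EFin; rewrite exprSr; ring.
  have M00 : M = 0 by lra.
  by rewrite M00 mulr0 mule0 expr0n.
by apply/measurable_EFinP; exact: measurable_indic.
Qed.

Lemma volume_compact_fin n (A : set 'rV[R]_n) : compact A -> volume A \is a fin_num.
Proof.
move=> cA; have /compact_rVP[_ [M AM]] := cA.
rewrite ge0_fin_numE ?volume_ge0//.
have M0 : 0 <= `|M| by [].
apply: (@le_lt_trans _ _ (volume [set x : 'rV[R]_n | forall i, `|x ord0 i| <= `|M|])).
  apply: le_volume; first exact: compact_borel.
    apply: closed_borel.
    have -> : [set x : 'rV[R]_n | forall i, `|x ord0 i| <= `|M|] =
        \bigcap_(i in [set: 'I_n]) [set x : 'rV[R]_n | `|x ord0 i| <= `|M|].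
      by apply/seteqP; split=> x /= h i; [move=> _|]; exact: h.
    apply: closed_bigI => i _.
    apply: (@closed_le_continuous _ _ (fun x : 'rV[R]_n => `|x ord0 i|)) => x.
    by apply: cvg_norm; exact: (@coord_continuous R 1 n ord0 i x).
  by move=> x Ax i; exact: le_trans (AM x Ax i) (ler_norm M).
by rewrite volume_box// ltry.
Qed.

Lemma volE n (A : set 'rV[R]_n) : compact A -> volume A = (vol A)%:E.
Proof. by move=> cA; rewrite fineK// volume_compact_fin. Qed.

Lemma vol_ge0 n (A : set 'rV[R]_n) : 0 <= vol A.
Proof. exact/fine_ge0/volume_ge0. Qed.

Lemma vol_set0 n : vol (set0 : set 'rV[R]_n) = 0.
Proof. by rewrite /vol volume_set0. Qed.

Lemma le_vol n (A B : set 'rV[R]_n) : compact A -> compact B -> A `<=` B -> vol A <= vol B.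
Proof.
move=> cA cB AB; rewrite -lee_fin -!volE//.
by apply: le_volume => //; exact: compact_borel.
Qed.

Lemma vol_setU n (A B : set 'rV[R]_n) : compact A -> compact B ->
  vol (A `|` B) + vol (A `&` B) = vol A + vol B.
Proof.
move=> cA cB; apply: EFin_inj; rewrite !EFinD -!volE//; last 2 first.
- by apply: compact_closedI => //; have /compact_rVP[] := cB.
- exact: compactU.
rewrite -!vol_measureE measureUfinr//=; last 3 first.
- exact: compact_borel.
- exact: compact_borel.
- by rewrite vol_measureE -ge0_fin_numE ?volume_ge0// volume_compact_fin.
rewrite subeK// vol_measureE volume_compact_fin//.
by apply: compact_closedI => //; have /compact_rVP[] := cB.
Qed.

Lemma minksum_set1 n (A : set 'rV[R]_n) b : minksum A [set b] = [set x | A (x - b)].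
Proof.
apply/seteqP; split=> [_ [x [_ [Ax -> ->]]]|x /= Ax]; first by rewrite /= addrK.
by exists (x - b), b; rewrite subrK.
Qed.

Lemma vol_translate n (A : set 'rV[R]_n) b : compact A -> vol (minksum A [set b]) = vol A.
Proof.
by move=> cA; rewrite /vol minksum_set1 volume_translate//; exact: compact_borel.
Qed.

Lemma preimage_mulmxE n (T : 'M[R]_n) (A : set 'rV[R]_n) : T \in unitmx ->
  [set x | A (x *m T)] = (fun x => x *m invmx T) @` A.
Proof.
move=> uT; apply/seteqP; split=> [x /= Ax|_ [x Ax <-]] /=; last by rewrite mulmxKV.
by exists (x *m T) => //; rewrite mulmxK.
Qed.

Lemma body_preimage_mulmx n (T : 'M[R]_n) (A : set 'rV[R]_n) : T \in unitmx ->
  body A -> body [set x | A (x *m T)].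
Proof.
move=> uT [cA xA]; split.
  by rewrite preimage_mulmxE//; apply: compact_image => //; exact: continuous_mulmx.
by apply: cvx_preimage => // x y s t _; rewrite mulmxDl !scalemxAl.
Qed.

Lemma vol_linear n (T : 'M[R]_n) (A : set 'rV[R]_n) : T \in unitmx -> compact A ->
  `|\det T| * vol [set x | A (x *m T)] = vol A.
Proof.
move=> uT cA; apply: EFin_inj; rewrite EFinM -!volE//; last first.
  by rewrite preimage_mulmxE//; apply: compact_image => //; exact: continuous_mulmx.
by rewrite volume_linear//; exact: compact_borel.
Qed.

Lemma orth_unitmx n (Q : 'M[R]_n) : Q *m Q^T = 1%:M -> Q \in unitmx.
Proof. by move=> /mulmx1_unit[]. Qed.

Lemma vol_orth n (Q : 'M[R]_n) (A : set 'rV[R]_n) : Q *m Q^T = 1%:M -> compact A ->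
  vol [set x | A (x *m Q)] = vol A.
Proof.
move=> QQ cA; rewrite -[RHS](vol_linear (orth_unitmx QQ))//.
have : \det Q ^+ 2 = 1 by rewrite expr2 -{2}det_tr -det_mulmx QQ det1.
move=> h; have : `|\det Q| ^+ 2 == 1 by rewrite real_normK ?num_real// h.
by rewrite sqrp_eq1// => /eqP ->; rewrite mul1r.
Qed.

Lemma mscal_gt0E n s (A : set 'rV[R]_n) : 0 < s -> mscal s A = [set x | A (s^-1 *: x)].
Proof.
move=> s0; have sn : s != 0 by rewrite gt_eqF.
apply/seteqP; split=> [_ [x Ax <-]|x /= Ax] /=.
  by rewrite scalerA mulVf// scale1r.
by exists (s^-1 *: x) => //; rewrite scalerA divff// scale1r.
Qed.

Lemma vol_mscal n s (A : set 'rV[R]_n) : 0 <= s -> compact A -> A !=set0 ->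
  vol (mscal s A) = s ^+ n * vol A.
Proof.
rewrite le_eqVlt => /predU1P[<-|s0] cA [a Aa].
  have -> : mscal 0 A = [set x : 'rV[R]_n | forall i, `|x ord0 i| <= 0].
    apply/seteqP; split=> [_ [x Ax <-] i|x /= h]; first by rewrite scale0r mxE normr0.
    exists a => //; apply/rowP => i; have := h i; rewrite normr_le0 => /eqP ->.
    by rewrite scale0r mxE.
  rewrite {1}/vol volume_box// mulr0 /=; case: n A cA a Aa => [|n] A cA a Aa.
    rewrite !expr0 mul1r /vol /=; case: ifPn => // /asboolPn; case; by exists a.
  by rewrite !expr0n mul0r.
have uT : (s^-1)%:M \in @unitmx R n.
  by rewrite unitmxE det_scalar unitfE expf_eq0 invr_eq0 (gt_eqF s0) andbF.
rewrite -(vol_linear uT cA) det_scalar mscal_gt0E// mulrA.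
have -> : [set x | A (x *m (s^-1)%:M)] = [set x | A (s^-1 *: x)].
  by apply/seteqP; split=> x /=; rewrite mul_mx_scalar.
rewrite ger0_norm ?exprn_ge0 ?invr_ge0 ?ltW// -exprMn divff ?gt_eqF// expr1n mul1r.
by [].
Qed.

Definition axis n : 'rV[R]_n.+1 := vcons (1, 0).

Lemma scale_axis n a : a *: axis n = vcons (a, 0).
Proof. by rewrite /axis vconsZ mulr1 scaler0. Qed.

Lemma exists_unitmx_axis n (y : 'rV[R]_n.+1) : y != 0 ->
  exists2 T, T \in unitmx & axis n *m T = y.
Proof.
move=> y0; have ry : \rank y = 1%N by apply/eqP; rewrite eqn_leq rank_leq_row lt0n mxrank_eq0.
pose c := col_ebase y ord0 ord0.
have cE : col_ebase y = c%:M by apply/matrixP => i j; rewrite !ord1 mxE eqxx mulr1n.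
have c0 : c \is a GRing.unit.
  by have := col_ebase_unit y; rewrite cE unitmxE det_scalar expr1.
exists (c *: row_ebase y); first by rewrite unitmxZ// row_ebase_unit.
rewrite -[RHS]mulmx_ebase cE mul_scalar_mx -scalemxAr scalemxAl ry; congr (_ *: _ *m _).
apply/rowP => i; rewrite /axis [RHS]mxE; case: (unliftP ord0 i) => [j|] ->.
  by rewrite vcons_lift mxE.
by rewrite -/(vhead _) vcons_head.
Qed.

Lemma measurable_fun_head_slice n (A : set 'rV[R]_n.+1) :
  measurable (A : set (borel_rV n.+1)) ->
  measurable_fun [set: borel_rV n] (fun y => lebesgue_measure [set x : R | A (vcons (x, y))]).
Proof.
move=> mA.
have m1 : measurable (@vcons R n @^-1` A : set (measurableTypeR R * borel_rV n)).
  by rewrite -[X in measurable X]setTI; exact: measurable_vcons.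
have := measurable_fun_ysection (@lebesgue_measure R) m1.
congr measurable_fun; apply/funext => y /=; congr lebesgue_measure.
by apply/seteqP; split=> x; rewrite /ysection /= inE.
Qed.

Lemma fiber_itv n (K : set 'rV[R]_n.+1) (y : 'rV[R]_n) : body K ->
  (exists x, K (vcons (x, y))) ->
  exists a b, a <= b /\ forall x, K (vcons (x, y)) <-> a <= x <= b.
Proof.
move=> [cK xK] [x0 Kx0].
pose L := K `&` [set z | vtail z = y].
have cL : compact L.
  apply: compact_closedI => //.
  apply: (@closed_comp _ _ (@vtail R n) [set y]); first by move=> x _; exact: continuous_vtail.
  by have /compact_rVP[] := (@body_set1 R n y).1.
have L0 : L !=set0 by exists (vcons (x0, y)); split=> //=; exact: vcons_tail.
have ch : {within L, continuous (@vhead R n)}.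
  by apply: continuous_subspaceT; exact: continuous_vhead.
have [zb zbL zbmax] := EVT_max_rV L0 cL ch.
have [za zaL zamin] := EVT_min_rV L0 cL ch.
have LE x : K (vcons (x, y)) -> vhead za <= x <= vhead zb.
  move=> Kx; have Lx : vcons (x, y) \in L by rewrite inE; split=> //=; exact: vcons_tail.
  by have := zamin _ Lx; have := zbmax _ Lx; rewrite vcons_head => -> ->.
move: zaL zbL; rewrite !inE => -[Ka ya] [Kb yb].
have Ka' : K (vcons (vhead za, y)) by rewrite -[y]ya vconsK.
have Kb' : K (vcons (vhead zb, y)) by rewrite -[y]yb vconsK.
exists (vhead za), (vhead zb); split; first by have /andP[] := LE _ Kb'.
move=> x; split; first exact: LE.
move=> /andP[ax xb]; have [ab|ab] := eqVneq (vhead za) (vhead zb).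
  by have -> : x = vhead za by apply/eqP; rewrite eq_le ax andbT ab.
have ba : 0 < vhead zb - vhead za by rewrite subr_gt0 lt_neqAle ab (le_trans ax).
pose s := (vhead zb - x) / (vhead zb - vhead za).
pose t := (x - vhead za) / (vhead zb - vhead za).
have st : s + t = 1 by rewrite /s /t; field; rewrite gt_eqF.
have := xK _ _ s t Ka' Kb' _ _ st; rewrite !vconsZ vconsD -scalerDl st scale1r.
have -> : s * vhead za + t * vhead zb = x by rewrite /s /t; field; rewrite gt_eqF.
by apply; apply: divr_ge0; rewrite ?subr_ge0//; apply: ltW; rewrite -subr_gt0.
Qed.

(** Over a point of the projection the fiber [a, b] becomes [a, b + t]; elsewhere both fibers are
    empty. Tonelli with the axis as inner variable turns this into t times the volume of the
    projection. *)
Lemma vol_add_axis n (K : set 'rV[R]_n.+1) (t : R) : body K -> 0 <= t ->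
  vol (minksum K (mscal t (seg (axis n)))) = vol K + t * vol (@vtail R n @` K).
Proof.
move=> bK t0; have [cK xK] := bK.
have cP : compact (@vtail R n @` K) by apply: compact_image => //; exact: continuous_vtail.
have bKt : body (minksum K (mscal t (seg (axis n)))).
  exact/body_minksum/body_mscal/body_seg.
apply: EFin_inj; rewrite EFinD EFinM -!volE//; last exact: bKt.1.
rewrite !volume_tonelli; last 2 first.
- exact: compact_borel.
- exact: compact_borel bKt.1.
rewrite -(vol_measureE (@vtail R n @` K)).
rewrite -[X in (_ + t%:E * vol_measure n X)%E]setIT -integral_indic//; last exact: compact_borel.
have m1 : measurable_fun [set: borel_rV n] (fun y => (\1_(@vtail R n @` K) y)%:E : \bar R).
  by apply/measurable_EFinP; apply: measurable_indic; exact: compact_borel.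
have m2 : measurable_fun [set: borel_rV n]
    (fun y => lebesgue_measure [set x | K (vcons (x, y))]).
  by apply: measurable_fun_head_slice; exact: compact_borel.
have m3 : measurable_fun [set: borel_rV n]
    (fun y => t%:E * (\1_(@vtail R n @` K) y)%:E : \bar R)%E by exact: measurable_funeM.
have i0 y : [set: borel_rV n] y -> (0 <= (\1_(@vtail R n @` K) y)%:E :> \bar R)%E.
  by rewrite lee_fin.
have i1 y : [set: borel_rV n] y -> (0 <= t%:E * (\1_(@vtail R n @` K) y)%:E)%E.
  by move=> _; rewrite mule_ge0// lee_fin.
rewrite -ge0_integralZl// -ge0_integralD//.
apply: eq_integral => y _; rewrite indicE.
have fibE x : minksum K (mscal t (seg (axis n))) (vcons (x, y)) <->
    exists s, 0 <= s <= t /\ K (vcons (x - s, y)).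
  split.
    move=> [z [_ [Kz [_ [r /andP[r0 r1] <-] <-]]]] e.
    exists (t * r); split; first by rewrite mulr_ge0// ler_piMr.
    suff -> : vcons (x - t * r, y) = z by [].
    have -> : z = vcons (x, y) - t *: (r *: axis n) by rewrite e addrK.
    apply: (addIr (t *: (r *: axis n))).
    by rewrite subrK scalerA scale_axis vconsD subrK addr0.
  move=> [s [/andP[s0 st] Kz]]; exists (vcons (x - s, y)), (s *: axis n); split=> //; last first.
    by rewrite scale_axis vconsD addr0 subrK.
  have [t1|tn] := eqVneq t 0.
    exists 0; first by exists 0; [rewrite /= lexx ler01|rewrite scale0r].
    have s00 : s = 0 by apply/eqP; rewrite eq_le s0 andbT -t1.
    by rewrite s00 scale0r scaler0.
  exists ((s / t) *: axis n); last by rewrite scalerA mulrC divfK.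
  exists (s / t) => //=; rewrite divr_ge0//= ler_pdivrMr ?mul1r//.
  by rewrite lt_neqAle eq_sym tn.
have [yP|yP] := boolP (y \in @vtail R n @` K).
  have Ky : exists x, K (vcons (x, y)).
    move: yP; rewrite inE => -[z Kz <-]; exists (vhead z); by rewrite vconsK.
  have [a [b [ab abE]]] := fiber_itv bK Ky.
  have -> : [set x | K (vcons (x, y))] = `[a, b]%classic.
    by apply/seteqP; split=> x /=; rewrite in_itv /= => /abE.
  have -> : [set x | minksum K (mscal t (seg (axis n))) (vcons (x, y))] = `[a, b + t]%classic.
    apply/seteqP; split=> x /=; rewrite in_itv /=.
      by move=> /fibE[s [/andP[s0 st] /abE/andP[xa xb]]]; apply/andP; split; lra.
    move=> /andP[ax xb]; apply/fibE; have [xb'|xb'] := leP x b.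
      by exists 0; split; [rewrite lexx|rewrite subr0; apply/abE; rewrite ax].
    exists (x - b); split; first by apply/andP; split; lra.
    by apply/abE; apply/andP; split; lra.
  rewrite mule1 !lebesgue_measure_itv /= !lte_fin.
  case: ltP => h1; case: ltP => h2; rewrite -?EFinB -?EFinD ?add0e ?adde0; try by congr EFin; lra.
rewrite mule0 adde0.
have e1 : [set x | K (vcons (x, y))] = set0.
  apply/seteqP; split=> x //= Kx; move: yP; rewrite notin_setE; apply.
  by exists (vcons (x, y)) => //; exact: vcons_tail.
rewrite e1 [X in lebesgue_measure X](_ : _ = set0) ?measure0//.
apply/seteqP; split=> x //= /fibE[s [_ Kx]].
by have : set0 (x - s) by rewrite -e1.
Qed.

Lemma minksum_mulmx n (T : 'M[R]_n) (A B : set 'rV[R]_n) : T \in unitmx ->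
  [set x | minksum A B (x *m T)] = minksum [set x | A (x *m T)] [set x | B (x *m T)].
Proof.
move=> uT; apply/seteqP; split=> [z [x [y [Ax By e]]]|_ [x [y [/= Ax By ->]]]] /=.
  exists (x *m invmx T), (y *m invmx T); rewrite /= !mulmxKV//; split=> //.
  by rewrite -mulmxDl -e mulmxK.
by exists (x *m T), (y *m T); rewrite mulmxDl.
Qed.

Lemma mscal_mulmx n (T : 'M[R]_n) s (A : set 'rV[R]_n) : T \in unitmx ->
  [set x | mscal s A (x *m T)] = mscal s [set x | A (x *m T)].
Proof.
move=> uT; apply/seteqP; split=> [z [x Ax e]|_ [x /= Ax <-]] /=.
  by exists (x *m invmx T); rewrite /= ?mulmxKV// scalemxAl e mulmxK.
by exists (x *m T) => //; rewrite scalemxAl.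
Qed.

Lemma seg_mulmx n (T : 'M[R]_n) x : T \in unitmx ->
  [set z | seg (x *m T) (z *m T)] = seg x.
Proof.
move=> uT; apply/seteqP; split=> [z [t t01 e]|_ [t t01 <-]] /=.
  by exists t => //; apply: (can_inj (mulmxK uT)); rewrite -e scalemxAl.
by exists t => //; rewrite scalemxAl.
Qed.

Lemma seg0 n : seg (0 : 'rV[R]_n) = [set 0].
Proof.
apply/seteqP; split=> [_ [t _ <-]|_ ->]; first by rewrite /= scaler0.
by exists 0; [rewrite /= lexx ler01|rewrite scaler0].
Qed.

Lemma mscal_set1 n s (x : 'rV[R]_n) : mscal s [set x] = [set s *: x].
Proof. exact: image_set1. Qed.

Lemma minksum0 n (A : set 'rV[R]_n) : minksum A [set 0] = A.
Proof. by rewrite minksum_set1; apply/seteqP; split=> x /=; rewrite subr0. Qed.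

Lemma mscal1 n (A : set 'rV[R]_n) : mscal 1 A = A.
Proof.
apply/seteqP; split=> [_ [x Ax <-]|x Ax]; first by rewrite scale1r.
by exists x => //; rewrite scale1r.
Qed.

(* Along the direction [y], adding a segment lengthens every nonempty fiber by
   the same amount. *)
Lemma vol_add_seg n (K : set 'rV[R]_n) y (t : R) : body K -> 0 <= t ->
  vol (minksum K (mscal t (seg y))) = vol K + t * (vol (minksum K (seg y)) - vol K).
Proof.
move=> bK t0; have [->|y0] := eqVneq y 0.
  by rewrite seg0 mscal_set1 scaler0 minksum0 subrr mulr0 addr0.
case: n K y bK y0 => [|n] K y bK y0; first by rewrite (thinmx0 y) eqxx in y0.
have [T uT Ty] := exists_unitmx_axis y0.
have aux s : 0 <= s -> vol (minksum K (mscal s (seg y))) =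
    vol K + s * (`|\det T| * vol (@vtail R n @` [set x | K (x *m T)])).
  move=> s0; have bK' := body_preimage_mulmx uT bK.
  rewrite -(vol_linear uT); last exact: (body_minksum bK (body_mscal s (body_seg y))).1.
  rewrite minksum_mulmx// mscal_mulmx// -Ty seg_mulmx// vol_add_axis// mulrDr.
  by rewrite (vol_linear uT bK.1) mulrCA.
by rewrite -{2}(mscal1 (seg y)) !aux//; ring.
Qed.

End BodyVolume.

(** * The Brunn-Minkowski inequality *)

Section BrunnMinkowski.
Context {R : realType}.
Local Notation leb := (@lebesgue_measure R).

Lemma lebesgue_affine (X : set R) (a c : R) : measurable X -> a != 0 ->
  (`|a|%:E * leb [set x | X (a * x + c)%R] = leb X)%E.
Proof.
move=> mX a0.
have mI : measurable_fun [set: R] (EFin \o \1_X : R -> \bar R).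
  by apply/measurable_EFinP; exact: measurable_indic.
have I0 (x : R) : (0 <= (EFin \o \1_X : R -> \bar R) x)%E by rewrite lee_fin.
have mX' : measurable ([set x | X (a * x + c)] : set R).
  have mf : measurable_fun [set: R] (fun x : R => a * x + c).
    apply: continuous_measurable_fun => x; apply: cvgD; last exact: cvg_cst.
    by apply: cvgM; [exact: cvg_cst|exact: cvg_id].
  by have := mf measurableT _ mX; rewrite setTI.
have := integral_affine c mI I0 a0.
rewrite [RHS]integral_indic//= setIT => <-; congr (_ * _)%E.
rewrite -[LHS](congr1 _ (setIT _)) -integral_indic//.
Qed.

(** The sets (X + y0) / 2 with y0 near inf Y and (Y + x0) / 2 with x0 near sup X both lie in Z and
    overlap in a short interval only, so their measures nearly add up. The slack [e] is there
    because inf and sup may not be attained. *)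
Lemma lebesgue_half_sum (X Y Z : set R) (M : R) :
  measurable X -> measurable Y -> measurable Z -> X !=set0 -> Y !=set0 ->
  (forall x, X x -> `|x| <= M) -> (forall y, Y y -> `|y| <= M) ->
  (forall x y, X x -> Y y -> Z ((x + y) / 2)) ->
  (leb X + leb Y <= 2%:E * leb Z)%E.
Proof.
move=> mX mY mZ X0 Y0 XM YM XYZ.
apply/lee_addgt0Pr => e e0.
have sX : has_sup X.
  by split=> //; exists M => x /XM; rewrite ler_norml => /andP[].
have iY : has_inf Y.
  by split=> //; exists (- M) => y /YM; rewrite ler_norml => /andP[].
have e40 : 0 < e / 4 by rewrite divr_gt0.
have [x0 Xx0 x0s] := sup_adherent e40 sX.
have [y0 Yy0 y0i] := inf_adherent e40 iY.
have tw : (2 : R) != 0 by rewrite pnatr_eq0.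
pose A1 := [set z : R | X (2 * z + - y0)]; pose A2 := [set z : R | Y (2 * z + - x0)].
have maff (W : set R) b : measurable W -> measurable ([set z | W (2 * z + b)] : set R).
  move=> mW; have mf : measurable_fun [set: R] (fun x : R => 2 * x + b).
    apply: continuous_measurable_fun => x; apply: cvgD; last exact: cvg_cst.
    by apply: cvgM; [exact: cvg_cst|exact: cvg_id].
  by have := mf measurableT _ mW; rewrite setTI.
have mA1 : measurable A1 by exact: maff.
have mA2 : measurable A2 by exact: maff.
have E1 := @lebesgue_affine X 2 (- y0) mX tw.
have E2 := @lebesgue_affine Y 2 (- x0) mY tw.
rewrite -/A1 in E1; rewrite -/A2 in E2.
rewrite ger0_norm// in E1 E2.
have YMl : (leb Y <= leb [set` `[(- M)%R, M]])%E.
  apply: le_measure; rewrite ?inE//.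
  by move=> y /YM; rewrite ler_norml /= in_itv.
have YF : (leb Y < +oo)%E.
  by apply: (le_lt_trans YMl); rewrite lebesgue_measure_itv /=; case: ifP => _; rewrite ?ltry// -EFinB ltry.
have A2F : (leb A2 < +oo)%E.
  apply: le_lt_trans YF; rewrite -E2 -[leLHS]mul1e; apply: lee_wpmul2r => //.
  by rewrite lee_fin ler1n.
have U := @measureUfinr _ _ _ leb A1 A2 mA1 mA2 A2F.
have IF : (leb (A1 `&` A2) <= (e / 2)%:E)%E.
  have sub : A1 `&` A2 `<=` `[(x0 + inf Y) / 2, (sup X + y0) / 2]%classic.
    move=> z [/= Xz Yz]; rewrite in_itv /=.
    have h1 := ub_le_sup sX.2 Xz; have h2 := ge_inf iY.2 Yz.
    by apply/andP; split; lra.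
  apply: (@le_trans _ _ (leb [set` `[((x0 + inf Y) / 2)%R, ((sup X + y0) / 2)%R]])).
    by apply: le_measure => //; rewrite inE//; exact: measurableI.
  rewrite lebesgue_measure_itv /=; case: ifP => _.
    by rewrite -EFinB lee_fin; lra.
  by rewrite lee_fin; lra.
have IFn : leb (A1 `&` A2) \is a fin_num.
  by rewrite ge0_fin_numE// (le_lt_trans IF)// ltry.
have UZ : (leb (A1 `|` A2) <= leb Z)%E.
  apply: le_measure; rewrite ?inE//; first exact: measurableU.
  move=> z [/= Az|/= Az].
    by have := XYZ _ _ Az Yy0; congr Z; field.
  by have := XYZ _ _ Xx0 Az; congr Z; field.
rewrite -E1 -E2 -ge0_muleDr//.
have -> : (leb A1 + leb A2 = leb (A1 `|` A2) + leb (A1 `&` A2))%E.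
  by rewrite U subeK.
have -> : e%:E = (2%:E * (e / 2)%:E)%E by rewrite -EFinM; congr EFin; field.
rewrite -ge0_muleDr//; last by rewrite lee_fin divr_ge0// ltW.
by apply: lee_wpmul2l => //; exact: leeD.
Qed.

Lemma layer_cake (f : R -> R) : measurable_fun [set: R] f -> (forall x, 0 <= f x) ->
  (\int[leb]_x (f x)%:E = \int[leb]_l leb [set x | (0 <= l < f x)%R])%E.
Proof.
move=> mf f0.
pose S := [set z : R * R | 0 <= z.2 < f z.1].
have mS : measurable (S : set (measurableTypeR R * measurableTypeR R)).
  have m2 : measurable_fun [set: measurableTypeR R * measurableTypeR R] (fun z : R * R => z.2).
    exact: measurable_snd.
  have m1 : measurable_fun [set: measurableTypeR R * measurableTypeR R] (fun z : R * R => f z.1 - z.2).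
    by apply: measurable_funB => //; apply: measurableT_comp => //; exact: measurable_fst.
  have -> : S = (fun z => z.2) @^-1` `[0, +oo[ `&` (fun z => f z.1 - z.2) @^-1` `]0, +oo[.
    apply/seteqP; split=> z /=; rewrite /S /= !in_itv /= !andbT subr_gt0.
      by move=> /andP[].
    by move=> [-> ->].
  apply: measurableI; rewrite -[X in measurable X]setTI.
    by apply: m2 => //; exact: measurable_itv.
  by apply: m1 => //; exact: measurable_itv.
have := @indic_fubini_tonelli _ _ (measurableTypeR R) (measurableTypeR R) R leb leb S mS.
move=> e.
transitivity (\int[leb]_x (leb \o xsection S) x)%E.
  apply: eq_integral => x _ /=.
  have -> : xsection S x = `[0, f x[%classic.
    by apply/seteqP; split=> l; rewrite /xsection /= inE /S /= in_itv.
  by rewrite lebesgue_measure_itv /= lte_fin; case: ltP => h; rewrite ?sube0//; congr EFin; apply/eqP; rewrite eq_le f0 h.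
transitivity (\int[leb]_x fubini_F leb (EFin \o \1_S) x)%E.
  apply: eq_integral => x _.
  exact: (esym (congr1 (fun g => g x) (@indic_fubini_tonelli_FE _ _ (measurableTypeR R) (measurableTypeR R) R leb S mS))).
rewrite e; apply: eq_integral => l _.
apply: etrans (congr1 (fun g => g l) (@indic_fubini_tonelli_GE _ _ (measurableTypeR R) (measurableTypeR R) R leb S mS)) _.
rewrite /=; congr (leb _).
by apply/seteqP; split=> x; rewrite /ysection /= inE.
Qed.

Lemma measurable_layer (f : R -> R) a : measurable_fun [set: R] f ->
  measurable_fun [set: R] (fun l : R => leb [set x | 0 <= a * l < f x]).
Proof.
move=> mf.
pose S := [set z : R * R | 0 <= a * z.1 < f z.2].
have mS : measurable (S : set (measurableTypeR R * measurableTypeR R)).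
  have m2 : measurable_fun [set: measurableTypeR R * measurableTypeR R] (fun z : R * R => a * z.1).
    by apply: measurable_funM => //; exact: measurable_fst.
  have m1 : measurable_fun [set: measurableTypeR R * measurableTypeR R] (fun z : R * R => f z.2 - a * z.1).
    by apply: measurable_funB => //; apply: measurableT_comp => //; exact: measurable_snd.
  have -> : S = (fun z => a * z.1) @^-1` `[0, +oo[ `&` (fun z => f z.2 - a * z.1) @^-1` `]0, +oo[.
    apply/seteqP; split=> z /=; rewrite /S /= !in_itv /= !andbT subr_gt0.
      by move=> /andP[].
    by move=> [-> ->].
  apply: measurableI; rewrite -[X in measurable X]setTI.
    by apply: m2 => //; exact: measurable_itv.
  by apply: m1 => //; exact: measurable_itv.
have := measurable_fun_xsection (leb : {sigma_finite_measure set (measurableTypeR R) -> \bar R}) mS.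
congr measurable_fun; apply/funext => l /=; congr (leb _).
by apply/seteqP; split=> x; rewrite /xsection /= inE.
Qed.

(** Dividing [f] and [g] by their suprema a and b makes the superlevel sets at every level in [0, 1[
    nonempty together, as the inequality for half sums of sets requires. The layer cake formula then
    gives F / a + G / b <= 2 H / s with s^2 = a b, and the arithmetic-geometric mean inequality
    concludes. *)
Lemma prekopa_leindler (f g h : R -> R) (F G H B M : R) :
  measurable_fun [set: R] f -> measurable_fun [set: R] g -> measurable_fun [set: R] h ->
  (forall x, 0 <= f x <= B) -> (forall x, 0 <= g x <= B) -> (forall x, 0 <= h x) ->
  (forall x, f x != 0 -> `|x| <= M) -> (forall x, g x != 0 -> `|x| <= M) ->
  (forall x y, f x * g y <= h ((x + y) / 2) ^+ 2) ->
  (\int[leb]_x (f x)%:E = F%:E)%E -> (\int[leb]_x (g x)%:E = G%:E)%E ->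
  (\int[leb]_x (h x)%:E = H%:E)%E ->
  F * G <= H ^+ 2.
Proof.
move=> mf mg mh fB gB h0 fM gM fgh iF iG iH.
have f0 x : 0 <= f x by have /andP[] := fB x.
have g0 x : 0 <= g x by have /andP[] := gB x.
have zero (k : R -> R) (K : R) : (forall x, 0 <= k x) -> ~ (exists x, 0 < k x) ->
    (\int[leb]_x (k x)%:E = K%:E)%E -> K = 0.
  move=> k0 nk; rewrite integral0_eq; first by move=> [].
  move=> x _; congr EFin; apply/eqP; rewrite eq_le k0 andbT leNgt.
  by apply/negP => kx; apply: nk; exists x.
have [[xf fx]|nf] := pselect (exists x, 0 < f x); last first.
  by rewrite (zero f F)// mul0r sqr_ge0.
have [[xg gx]|ng] := pselect (exists x, 0 < g x); last first.
  by rewrite (zero g G)// mulr0 sqr_ge0.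
have supP (k : R -> R) (kB : forall x, 0 <= k x <= B) : has_sup (range k).
  split; first by exists (k 0), 0.
  by exists B => _ [x _ <-]; have /andP[] := kB x.
pose a := sup (range f); pose b := sup (range g).
have fa x : f x <= a by apply: (ub_le_sup (supP f fB).2); exists x.
have gb x : g x <= b by apply: (ub_le_sup (supP g gB).2); exists x.
have a0 : 0 < a by exact: lt_le_trans (fa xf).
have b0 : 0 < b by exact: lt_le_trans (gb xg).
pose s := Num.sqrt (a * b).
have s2 : s ^+ 2 = a * b by rewrite sqr_sqrtr// mulr_ge0// ltW.
have s0 : 0 < s by rewrite sqrtr_gt0 mulr_gt0.
have lc (k : R -> R) (K c : R) : measurable_fun [set: R] k -> (forall x, 0 <= k x) ->
    0 < c -> (\int[leb]_x (k x)%:E = K%:E)%E ->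
    (\int[leb]_l leb [set x | (0 <= c * l < k x)%R] = (K / c)%:E)%E.
  move=> mk k0 c0 iK; rewrite layer_cake// in iK.
  have m1 : measurable_fun [set: R] (fun l : R => leb [set x | 0 <= l < k x]).
    have := measurable_layer 1 mk; congr measurable_fun; apply/funext => l.
    by rewrite mul1r.
  have := @integral_affine _ (fun l => leb [set x | 0 <= l < k x]) c 0 m1
    (fun l => measure_ge0 leb _) (lt0r_neq0 c0).
  rewrite iK gtr0_norm// => e.
  have {e} : (c%:E * \int[leb]_l leb [set x | (0 <= c * l < k x)%R] = K%:E)%E.
    by rewrite -e; congr (_ * _)%E; apply: eq_integral => l _; rewrite addr0.
  move=> e; have := congr1 (fun x => (c^-1)%:E * x)%E e.
  by rewrite muleA -!EFinM mulVf ?gt_eqF// mul1e mulrC.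
have iX := lc f F a mf f0 a0 iF.
have iY := lc g G b mg g0 b0 iG.
have iZ := lc h H s mh h0 s0 iH.
have mset (k : R -> R) c l : measurable_fun [set: R] k ->
    measurable ([set x | 0 <= c * l < k x] : set R).
  move=> mk; have [cl|cl] := leP 0 (c * l).
    have -> : [set x | true && (c * l < k x)] = k @^-1` `](c * l), +oo[.
      by apply/seteqP; split=> x /=; rewrite in_itv /= andbT.
    by rewrite -[X in measurable X]setTI; apply: mk => //; exact: measurable_itv.
  by have -> : [set x | false && (c * l < k x)] = set0 by apply/seteqP; split.
have key l : (leb [set x | (0 <= a * l < f x)%R] + leb [set x | (0 <= b * l < g x)%R]
    <= 2%:E * leb [set x | (0 <= s * l < h x)%R])%E.
  have [l01|l01] := boolP (0 <= l < 1); last first.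
    have e1 (k : R -> R) c : 0 < c -> (forall x, k x <= c) ->
        leb [set x | 0 <= c * l < k x] = 0%E.
      move=> c0 kc; rewrite (_ : [set x | _] = set0); first exact: measure0.
      apply/seteqP; split=> x //= /andP[]; rewrite pmulr_rge0// => l0 lk.
      move: l01; rewrite l0 -leNgt /= => l1.
      by have := lt_le_trans lk (kc x); rewrite ltNge ler_peMr// ltW.
    have e2 : (leb [set x | (0 <= a * l < f x)%R] + leb [set x | (0 <= b * l < g x)%R] = 0)%E.
      have -> := e1 f a a0 fa; have -> := e1 g b b0 gb; exact: adde0.
    by rewrite e2 mule_ge0.
  have /andP[l0 l1] := l01.
  apply: (@lebesgue_half_sum _ _ _ M); try exact: mset.
  - have el : 0 < (1 - l) * a by rewrite mulr_gt0// subr_gt0.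
    have [_ [x _ <-] xl] := sup_adherent el (supP f fB).
    by exists x; rewrite /= mulr_ge0 ?(ltW a0)//=; apply: le_lt_trans xl; rewrite -/a; lra.
  - have el : 0 < (1 - l) * b by rewrite mulr_gt0// subr_gt0.
    have [_ [x _ <-] xl] := sup_adherent el (supP g gB).
    by exists x; rewrite /= mulr_ge0 ?(ltW b0)//=; apply: le_lt_trans xl; rewrite -/b; lra.
  - by move=> x /= /andP[al fl]; apply: fM; rewrite gt_eqF// (le_lt_trans al).
  - by move=> x /= /andP[al fl]; apply: gM; rewrite gt_eqF// (le_lt_trans al).
  move=> x y /= /andP[al fl] /andP[bl gl]; rewrite mulr_ge0 ?(ltW s0)//=.
  rewrite -(@ltr_pXn2r _ 2)// ?nnegrE ?mulr_ge0 ?(ltW s0)//.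
  apply: lt_le_trans (fgh x y); rewrite exprMn s2.
  have -> : a * b * l ^+ 2 = (a * l) * (b * l) by ring.
  exact: ltr_pM.
have sum_le : F / a + G / b <= 2 * (H / s).
  rewrite -lee_fin EFinD -iX -iY EFinM -iZ -ge0_integralD//; last 2 first.
    exact: measurable_layer.
    exact: measurable_layer.
  rewrite -ge0_integralZl//; last by apply: measurable_layer.
  apply: ge0_le_integral => //.
  - by move=> l _; rewrite adde_ge0.
  - by apply: emeasurable_funD; exact: measurable_layer.
  - by apply: measurable_funeM; exact: measurable_layer.
have F0 : 0 <= F by rewrite -lee_fin -iF; apply: integral_ge0 => x _; rewrite lee_fin.
have G0 : 0 <= G by rewrite -lee_fin -iG; apply: integral_ge0 => x _; rewrite lee_fin.
have sq : (F / a + G / b) ^+ 2 <= (2 * (H / s)) ^+ 2.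
  by rewrite ler_pXn2r// nnegrE ?addr_ge0 ?divr_ge0 ?(ltW a0) ?(ltW b0)// (le_trans _ sum_le)// addr_ge0 ?divr_ge0 ?(ltW a0) ?(ltW b0).
have h1 : 4 * ((F / a) * (G / b)) <= (F / a + G / b) ^+ 2.
  by have := sqr_ge0 (F / a - G / b); rewrite !expr2; nra.
have h2 : (F / a) * (G / b) <= (H / s) ^+ 2.
  by have := le_trans h1 sq; rewrite exprMn; lra.
move: h2; rewrite expr_div_n s2.
have -> : F / a * (G / b) = F * G / (a * b) by field; rewrite !gt_eqF.
by rewrite ler_pM2r// invr_gt0 mulr_gt0.
Qed.

(** The multiplicative midpoint form has no exponent depending on the dimension and so passes
    through the induction: by the induction hypothesis the slice volumes of A, B and their half sum
    satisfy the assumption of [prekopa_leindler]. *)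
Theorem brunn_minkowski n (A B : set 'rV[R]_n) : body A -> body B -> A !=set0 -> B !=set0 ->
  vol A * vol B <= vol (minksum (mscal 2^-1 A) (mscal 2^-1 B)) ^+ 2.
Proof.
elim: n A B => [|n IH] A B bA bB [a Aa] [b Bb].
  have v1 (C : set 'rV[R]_0) : C !=set0 -> vol C = 1.
    by move=> C0; rewrite /vol /=; case: ifPn => // /asboolPn.
  rewrite !v1; [|by exists (2^-1 *: a + 2^-1 *: b), (2^-1 *: a), (2^-1 *: b); split=> //; [exists a|exists b]|by exists b|by exists a].
  by rewrite expr1n mulr1.
set C := minksum _ _.
have bC : body C by apply: body_minksum; apply: body_mscal.
pose sl (K : set 'rV[R]_n.+1) (x : R) := vol [set y | K (vcons (x, y))].
have slE (K : set 'rV[R]_n.+1) : body K ->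
    (\int[leb]_x (sl K x)%:E = (vol K)%:E)%E /\ measurable_fun [set: R] (sl K).
  move=> bK; split.
    rewrite -(volE bK.1) [RHS]volumeS; apply: eq_integral => x _.
    by rewrite volE//; exact: (body_slice_head x bK).1.
  apply/measurable_EFinP; have := measurable_slice_volume (compact_borel bK.1).
  congr measurable_fun; apply/funext => x /=.
  by rewrite volE//; exact: (body_slice_head x bK).1.
have bnd (K : set 'rV[R]_n.+1) : body K ->
    exists M, (forall x, 0 <= sl K x <= M) /\ (forall x, sl K x != 0 -> `|x| <= M).
  move=> bK; have [_ [M0 KM]] := (compact_rVP K).1 bK.1.
  pose r := `|M0|; exists (Num.max ((2 * r) ^+ n) r).
  have Kr y : K y -> forall i, `|y ord0 i| <= r.
    by move=> Ky i; apply: le_trans (KM y Ky i) _; exact: ler_norm.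
  have r0 : 0 <= r by exact: normr_ge0.
  split=> x.
    rewrite /sl vol_ge0 le_max /=; apply/orP; left.
    have := @volume_box R n r r0; set bx := [set _ | _] => vb.
    have -> : (2 * r) ^+ n = vol bx by rewrite /vol vb.
    apply: le_vol; first exact: (body_slice_head x bK).1.
      apply/compact_rVP; split; last by exists r.
      have -> : bx = \bigcap_(i in [set: 'I_n]) [set y : 'rV[R]_n | `|y ord0 i| <= r].
        by apply/seteqP; split=> y yr i; [move=> _; exact: yr|exact: yr].
      apply: closed_bigI => i _; apply: (closed_le_continuous (f := fun y => `|y ord0 i|)).
      by move=> y; apply: continuous_comp; [exact: (@coord_continuous R 1 n ord0 i)|exact: norm_continuous].
    move=> y Ky i; have := Kr _ Ky (lift ord0 i); rewrite vcons_lift; done.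
  move=> sx; rewrite le_max; apply/orP; right; apply: contraNT sx => xr.
  apply/eqP; rewrite /sl (_ : [set y | _] = set0) ?vol_set0//.
  apply/seteqP; split=> y //= Ky; have : `|vhead (vcons (x, y))| <= r := Kr _ Ky ord0.
  by rewrite vcons_head => h; rewrite h in xr.
have [MA [HA SA]] : exists M, (forall x, 0 <= sl A x <= M) /\ (forall x, sl A x != 0 -> `|x| <= M) by exact: bnd.
have [MB [HB SB]] : exists M, (forall x, 0 <= sl B x <= M) /\ (forall x, sl B x != 0 -> `|x| <= M) by exact: bnd.
apply: (@prekopa_leindler (sl A) (sl B) (sl C) _ _ _ (Num.max MA MB) (Num.max MA MB)).
- exact: (slE A bA).2.
- exact: (slE B bB).2.
- exact: (slE C bC).2.
- by move=> x; have /andP[-> /=] := HA x; rewrite le_max => ->.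
- by move=> x; have /andP[-> /=] := HB x; rewrite le_max => ->; rewrite orbT.
- by move=> x; exact: vol_ge0.
- by move=> x /SA h; rewrite le_max h.
- by move=> x /SB h; rewrite le_max h orbT.
- move=> x y.
  have [[y1 A1]|nA] := pselect ([set z | A (vcons (x, z))] !=set0); last first.
    rewrite {1}/sl (_ : [set z | A (vcons (x, z))] = set0) ?vol_set0 ?mul0r ?sqr_ge0//.
    by apply/seteqP; split=> z //= Az; apply: nA; exists z.
  have [[y2 B2]|nB] := pselect ([set z | B (vcons (y, z))] !=set0); last first.
    rewrite [sl B _]/sl (_ : [set z | B (vcons (y, z))] = set0) ?vol_set0 ?mulr0 ?sqr_ge0//.
    by apply/seteqP; split=> z //= Az; apply: nB; exists z.
  apply: le_trans (IH _ _ (body_slice_head x bA) (body_slice_head y bB) _ _) _.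
    by exists y1.
    by exists y2.
  rewrite ler_pXn2r// ?nnegrE ?vol_ge0//; apply: le_vol.
  + by apply: (body_minksum _ _).1; apply: body_mscal; exact: body_slice_head.
  + exact: (body_slice_head _ bC).1.
  move=> _ [_ [_ [[z1 /= Az1 <-] [z2 /= Bz2 <-] ->]]] /=.
  exists (2^-1 *: vcons (x, z1)), (2^-1 *: vcons (y, z2)); split.
  + by exists (vcons (x, z1)).
  + by exists (vcons (y, z2)).
  by rewrite !vconsZ vconsD; congr (vcons (_, _)); field.
- exact: (slE A bA).1.
- exact: (slE B bB).1.
- exact: (slE C bC).1.
Qed.

End BrunnMinkowski.

(** * Functions given by polynomials and their values at 0 *)

Section Polynomials.
Context {R : realType}.

Definition ispoly (g : R -> R) := exists p : {poly R}, forall t, g t = p.[t].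

Lemma ispoly_cst a : ispoly (fun=> a).
Proof. by exists a%:P => t; rewrite hornerC. Qed.
Lemma ispoly_id : ispoly id.
Proof. by exists 'X => t; rewrite hornerX. Qed.
Lemma ispolyD f g : ispoly f -> ispoly g -> ispoly (fun t => f t + g t).
Proof. by move=> [p fp] [q gq]; exists (p + q) => t; rewrite hornerD fp gq. Qed.
Lemma ispolyM f g : ispoly f -> ispoly g -> ispoly (fun t => f t * g t).
Proof. by move=> [p fp] [q gq]; exists (p * q) => t; rewrite hornerM fp gq. Qed.
Lemma ispolyX f n : ispoly f -> ispoly (fun t => f t ^+ n).
Proof. by move=> [p fp]; exists (p ^+ n) => t; rewrite horner_exp fp. Qed.
Lemma ispoly_sum (I : Type) (r : seq I) (P : pred I) (f : I -> R -> R) :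
  (forall i, P i -> ispoly (f i)) -> ispoly (fun t => \sum_(i <- r | P i) f i t).
Proof.
move=> fp; elim: r => [|i r IH].
  by exists 0 => t; rewrite big_nil horner0.
case: (boolP (P i)) => Pi.
  have [p hp] := ispolyD (fp i Pi) IH; exists p => t.
  by rewrite big_cons Pi hp.
by case: IH => p hp; exists p => t; rewrite big_cons (negPf Pi) hp.
Qed.

(** This removes perturbations: an inequality that is polynomial in a small positive parameter
    extends to the parameter 0. With a reversed polynomial it also compares leading coefficients at
    infinity. *)
Lemma ispoly_le0 (b : R) g : ispoly g -> 0 < b -> (forall t, 0 < t -> t < b -> g t <= 0) -> g 0 <= 0.
Proof.
move=> [p gp] b0 g0; rewrite gp.
have h : p.[t] @[t --> (0 : R)^'+] --> p.[0].
  by apply: cvg_at_right_filter; exact: continuous_horner.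
apply: (cvgr_to_le h); near=> t; rewrite -gp; apply: g0.
  by near: t; exact: nbhs_right_gt.
by near: t; exact: nbhs_right_lt.
Unshelve. all: by end_near.
Qed.

End Polynomials.

(** * Symmetric bilinear forms with at most one positive direction *)

Section LorentzianForms.
Context {R : realType} {E : lmodType R}.
Implicit Types (H : E -> E -> R).

Definition bilin H := (forall x y, H x y = H y x) /\
  (forall a x y z, H (a *: x + y) z = a * H x z + H y z).

(** The reversed Cauchy-Schwarz inequality. A form without positive vectors satisfies it
    vacuously. *)
Definition lorentzian H := forall e z, 0 < H e e -> H z z * H e e <= H z e ^+ 2.

Lemma bilinD H x y z : bilin H -> H (x + y) z = H x z + H y z.
Proof. by move=> [_ l]; rewrite -{1}(scale1r x) l mul1r. Qed.
Lemma bilin0 H z : bilin H -> H 0 z = 0.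
Proof. by move=> bH; apply: (addIr (H 0 z)); rewrite -bilinD// addr0 add0r. Qed.
Lemma bilinZ H a x z : bilin H -> H (a *: x) z = a * H x z.
Proof. by move=> bH; have := bH.2 a x 0 z; rewrite addr0 bilin0// addr0. Qed.
Lemma bilinDr H x y z : bilin H -> H z (x + y) = H z x + H z y.
Proof. by move=> bH; rewrite !(bH.1 z) bilinD. Qed.
Lemma bilinZr H a x z : bilin H -> H z (a *: x) = a * H z x.
Proof. by move=> bH; rewrite !(bH.1 z) bilinZ. Qed.

Lemma bilin_sqrD H a b x y : bilin H ->
  H (a *: x + b *: y) (a *: x + b *: y) = a ^+ 2 * H x x + 2 * (a * b * H x y) + b ^+ 2 * H y y.
Proof.
move=> bH; rewrite bilinD// !bilinDr// !bilinZ// !bilinZr// (bH.1 y x); ring.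
Qed.

(** Subtracting from z its projection onto [e] gives the inequality for [e] itself. For another
    positive vector e' it forces H e' e != 0, so that a multiple of e' brings any z into the
    complement of [e], where H is nonpositive. *)
Lemma lorentzian_orthP H e : bilin H -> 0 < H e e ->
  (forall z, H z e = 0 -> H z z <= 0) -> lorentzian H.
Proof.
move=> bH e0 neg.
have rcs z : H z z * H e e <= H z e ^+ 2.
  have ee : H e e != 0 by rewrite gt_eqF.
  have := neg (z + (- (H z e / H e e)) *: e).
  rewrite bilinD// bilinZ// mulNr divfK// subrr => /(_ erefl).
  rewrite bilinDr// !bilinD// !bilinZr// !bilinZ// (bH.1 e z) => h.
  have : H e e * (H z z + - (H z e / H e e) * H z e + - (H z e / H e e) * (H z e + - (H z e / H e e) * H e e)) <= 0.
    by rewrite pmulr_rle0//; apply: le_trans h; rewrite le_eqVlt; apply/orP; left; apply/eqP; ring.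
  have -> : H e e * (H z z + - (H z e / H e e) * H z e + - (H z e / H e e) * (H z e + - (H z e / H e e) * H e e)) = H z z * H e e - H z e ^+ 2 by field.
  by rewrite subr_le0.
move=> e' z e'0.
have ne : H e' e != 0.
  by apply/eqP => h0; have := rcs e'; rewrite h0 expr0n /= leNgt mulr_gt0.
have := neg (z + (- (H z e / H e' e)) *: e').
rewrite bilinD// bilinZ// mulNr divfK// subrr => /(_ erefl).
set l := H z e / H e' e.
rewrite bilinDr// !bilinD// !bilinZr// !bilinZ// (bH.1 e' z) => h.
have : (H z z + - l * H z e' + - l * (H z e' + - l * H e' e')) * H e' e' <= 0.
  by rewrite pmulr_lle0//; apply: le_trans h; rewrite le_eqVlt; apply/orP; left; apply/eqP; ring.
have := sqr_ge0 (H z e' - l * H e' e'); rewrite !expr2; nra.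
Qed.

(* The positive directions of [H1] and [H2] are forced to overlap by the
   relation [H2 e1 = H1 e2]; this is how one segment is added to a zonotope. *)
Lemma lorentzianD H1 H2 e1 e2 s : bilin H1 -> bilin H2 -> lorentzian H1 -> lorentzian H2 ->
  (forall z, H2 e1 z = H1 e2 z) -> (forall z, H2 e2 z = 0) ->
  0 <= H1 e1 e1 -> 0 < H1 e1 e2 -> 0 < s ->
  lorentzian (fun x y => H1 x y + s * H2 x y).
Proof.
move=> b1 b2 L1 L2 r12 r2 p0 q0 s0.
set p := H1 e1 e1 in p0; set q := H1 e1 e2 in q0.
have h22 : H1 e2 e2 = 0 by rewrite -r12 b2.1 r2.
have q21 : H1 e2 e1 = q by rewrite b1.1.
have sq0 : 0 < s * q by exact: mulr_gt0.
have bH : bilin (fun x y => H1 x y + s * H2 x y).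
  split=> [x y|a x y z]; first by rewrite b1.1 b2.1.
  by rewrite b1.2 b2.2; ring.
apply: (@lorentzian_orthP _ e1 bH); first by rewrite r12 q21 -/p; lra.
move=> z; rewrite (b2.1 z) r12 (b1.1 e2 z) => zo.
set eta := H1 z e2 in zo.
have H2z : H2 z z <= eta ^+ 2 / q.
  have H2e : H2 e1 e1 = q by rewrite r12.
  have := L2 e1 z; rewrite H2e (b2.1 z e1) r12 (b1.1 e2 z) => /(_ q0).
  by rewrite ler_pdivlMr.
have qn : q != 0 by rewrite gt_eqF.
(* These coefficients make z0 orthogonal under H1 to e1 and e2, hence to the positive vector e1 + s
   e2, so that H1 z0 z0 <= 0. What remains of the sum is at most -(p + s q) (eta / q)^2. *)
pose a := eta / q; pose b := (- s * eta - p * eta / q) / q.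
pose z0 := z + (- a) *: e1 + (- b) *: e2.
have z01 : H1 z0 e1 = 0.
  rewrite /z0 !bilinD// !bilinZ// -/p q21.
  have -> : H1 z e1 = - s * eta by lra.
  by rewrite /a /b; field.
have z02 : H1 z0 e2 = 0.
  by rewrite /z0 !bilinD// !bilinZ// h22 -/q -/eta /a; field.
have H1z0 : H1 z0 z0 <= 0.
  have ee : H1 (e1 + s *: e2) (e1 + s *: e2) = p + 2 * (s * q).
    by rewrite bilinD// !bilinDr// !bilinZ// !bilinZr// h22 q21 -/p -/q; ring.
  have ze : H1 z0 (e1 + s *: e2) = 0 by rewrite bilinDr// bilinZr// z01 z02; ring.
  have pos : 0 < p + 2 * (s * q) by lra.
  have := L1 (e1 + s *: e2) z0; rewrite ee ze expr0n /= => /(_ pos).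
  by rewrite pmulr_lle0.
have H1z : H1 z z = H1 z0 z0 + (a ^+ 2 * p + 2 * (a * b * q)).
  have -> : z = z0 + (a *: e1 + b *: e2).
    by rewrite /z0 !scaleNr -(addrA z) -opprD subrK.
  have := bilin_sqrD 1 1 z0 (a *: e1 + b *: e2) b1; rewrite !scale1r => ->.
  by rewrite (bilin_sqrD _ _ _ _ b1) (bilinDr (a *: e1) (b *: e2) z0 b1) (bilinZr a e1 z0 b1) (bilinZr b e2 z0 b1) z01 z02 h22 -/p -/q; ring.
have : a ^+ 2 * p + 2 * (a * b * q) + s * (eta ^+ 2 / q) <= 0.
  have -> : a ^+ 2 * p + 2 * (a * b * q) + s * (eta ^+ 2 / q) =
     - ((p + s * q) * (eta / q) ^+ 2) by rewrite /a /b; field.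
  by rewrite oppr_le0 mulr_ge0 ?sqr_ge0//; lra.
have : s * H2 z z <= s * (eta ^+ 2 / q) by rewrite ler_pM2l.
lra.
Qed.

End LorentzianForms.

(** Two lists are permutations of each other when every predicate has the same count on both; for
    lists built from [nseq], [cat] and [cons] this is an identity for [ring]. *)
Ltac perm_count H := apply: H; apply/permP => ?; rewrite /=;
  repeat (first [rewrite count_cat /= | rewrite count_nseq /=]);
  ring.

(** * Symmetric multilinear forms as functions on lists of vectors *)

Section MixedForm.
Context {R : realType} (M : nat).
Local Notation E := 'rV[R]_M.
Variable (F : seq E -> R).
Hypothesis Flin : forall a x y s, F ((a *: x + y) :: s) = a * F (x :: s) + F (y :: s).
Hypothesis Fperm : forall s s', perm_eq s s' -> F s = F s'.

Let e (i : 'I_M) : E := delta_mx ord0 i.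

Lemma FD x y s : F ((x + y) :: s) = F (x :: s) + F (y :: s).
Proof. by rewrite -{1}(scale1r x) Flin mul1r. Qed.
Lemma F0 s : F (0 :: s) = 0.
Proof. by apply: (addIr (F (0 :: s))); rewrite -FD addr0 add0r. Qed.
Lemma FZ a x s : F (a *: x :: s) = a * F (x :: s).
Proof. by have := Flin a x 0 s; rewrite addr0 F0 addr0. Qed.
Lemma Fsum (I : Type) (r : seq I) (f : I -> E) s :
  F (\sum_(i <- r) f i :: s) = \sum_(i <- r) F (f i :: s).
Proof.
elim: r => [|i r IH]; first by rewrite !big_nil F0.
by rewrite !big_cons FD IH.
Qed.
Lemma Fbasis x s : F (x :: s) = \sum_i x ord0 i * F (e i :: s).
Proof.
rewrite {1}(row_sum_delta x) Fsum; apply: eq_bigr => i _; exact: FZ.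
Qed.

Lemma Fmid s1 x s2 : F (s1 ++ x :: s2) = F (x :: s1 ++ s2).
Proof. by apply: Fperm; rewrite -cat1s perm_catCA. Qed.

Lemma bilinF s : bilin (fun x y => F [:: x, y & s]).
Proof.
split=> [x y|a x y z]; last exact: Flin.
by apply: Fperm; rewrite -(cat1s x (y :: s)) -(cat1s y (x :: s)) -[y :: s]cat1s -[x :: s]cat1s perm_catCA.
Qed.

Definition cone (x : E) := forall i, 0 <= x ord0 i.

Lemma Fnn d : (forall s : seq 'I_M, size s = d -> 0 <= F (map e s)) ->
  forall xs : seq E, (forall x, x \in xs -> cone x) -> forall s : seq 'I_M,
  (size xs + size s = d)%N -> 0 <= F (xs ++ map e s).
Proof.
move=> nn; elim=> [|x xs IH] cx s sz /=; first exact: nn.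
rewrite Fbasis; apply: sumr_ge0 => i _; rewrite mulr_ge0//.
  by apply: cx; rewrite mem_head.
rewrite -Fmid; apply: (IH _ (i :: s)) => [y yx|]; first by apply: cx; rewrite inE yx orbT.
by rewrite /= addnS -sz.
Qed.

(** In the basis, the value at the interior vector [k] is a sum of nonnegative terms with positive
    coefficients. If it vanishes, every term does, and these terms span all other values. *)
Lemma Fzero d (k : E) : (forall s : seq 'I_M, size s = d -> 0 <= F (map e s)) ->
  (forall i, 0 < k ord0 i) -> forall n (l : seq 'I_M), (n + size l = d)%N ->
  F (nseq n k ++ map e l) = 0 ->
  forall xs : seq E, size xs = n -> F (xs ++ map e l) = 0.
Proof.
move=> nn k0; elim=> [|n IH] l sz Fk xs szx; first by move: szx => /size0nil ->.
case: xs szx => // x xs /= [szx].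
have ck : cone k by move=> i; exact: ltW.
have : \sum_i k ord0 i * F (nseq n k ++ map e (i :: l)) = 0.
  by rewrite -[RHS]Fk /= Fbasis; apply: eq_bigr => i _; rewrite Fmid.
have t0 i : 0 <= k ord0 i * F (nseq n k ++ map e (i :: l)).
  rewrite mulr_ge0 ?ck//; apply: (Fnn nn); first by move=> y /nseqP[->].
  by rewrite size_nseq /= addnS -sz.
move/eqP; rewrite psumr_eq0// => /allP z.
rewrite Fbasis big1// => i _; rewrite -Fmid.
rewrite (IH (i :: l)) ?mulr0//; first by rewrite /= addnS -sz.
have := z i; rewrite mem_index_enum => /(_ isT) /=.
by rewrite mulf_eq0 gt_eqF//= => /eqP.
Qed.

Variables (d : nat) (k : E) (P : pred 'I_M).
Hypothesis nnF : forall s : seq 'I_M, size s = d -> 0 <= F (map e s).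
Hypothesis k0 : forall i, 0 < k ord0 i.
Hypothesis FP : forall i s, P i -> F [:: e i, e i & s] = 0.
Hypothesis base : forall n (l : seq 'I_M), all P l -> (n + size l + 2 = d)%N ->
  lorentzian (fun x y => F [:: x, y & nseq n k ++ map e l]).

(** The binomial expansion stops after the linear term, since by [FP] a list with e i occurring
    twice has value 0. *)
Lemma FnseqD i n z t s : P i ->
  F (nseq n (z + t *: e i) ++ s) =
  F (nseq n z ++ s) + n%:R * t * F (nseq n.-1 z ++ e i :: s).
Proof.
move=> Pi; elim: n s => [|n IH] s; first by rewrite !mul0r addr0.
have -> : F (nseq n.+1 (z + t *: e i) ++ s) =
    F (nseq n (z + t *: e i) ++ z :: s) + t * F (nseq n (z + t *: e i) ++ e i :: s).
  by rewrite !Fmid -FZ -FD.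
rewrite !IH.
have -> : F (nseq n.-1 z ++ e i :: e i :: s) = 0.
  by rewrite Fmid -cat_cons Fmid (FP _ Pi).
rewrite mulr0 addr0; case: n {IH} => [|n] /=; first by ring.
have -> : F (z :: nseq n z ++ z :: s) = F (z :: z :: nseq n z ++ s) by perm_count Fperm.
have -> : F (nseq n z ++ e i :: z :: s) = F (z :: nseq n z ++ e i :: s) by perm_count Fperm.
rewrite -[n.+2%:R]natr1 -[n.+1%:R]natr1; ring.
Qed.

(** Induction on the segments. By [FnseqD] the last one splits the form into H1 + s H2, where H2 has
    this segment moved to the fixed list [l]; both are Lorentzian by induction, and [lorentzianD]
    applies with e1 = Z and e2 = e i. The summand delta k keeps Z in the interior of the cone, which
    settles the degenerate case H1 Z (e i) = 0. *)
Lemma lorentzian_zonotope (delta : R) (r : seq 'I_M) (t : 'I_M -> R) :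
  0 < delta -> all P r -> (forall i, 0 <= t i) ->
  forall n m (l : seq 'I_M), all P l -> (n + m + size l + 2 = d)%N ->
  lorentzian (fun x y =>
    F [:: x, y & nseq n (delta *: k + \sum_(i <- r) t i *: e i) ++ nseq m k ++ map e l]).
Proof.
move=> d0 Pr t0; elim: r Pr => [_|i r IH /= /andP[Pi Pr]] n m l Pl sz.
  rewrite big_nil addr0.
  have FdZ n' s : F (nseq n' (delta *: k) ++ s) = delta ^+ n' * F (nseq n' k ++ s).
    elim: n' s => [|n' IH] s; first by rewrite expr0 mul1r.
    rewrite -[nseq n'.+1 _ ++ s]/(_ :: _) FZ.
    by rewrite -(Fmid (nseq n' _) k s) IH Fmid exprS mulrA.
  have eqF x y : F [:: x, y & nseq n (delta *: k) ++ nseq m k ++ map e l] =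
      delta ^+ n * F [:: x, y & nseq (n + m) k ++ map e l].
    have sw u v s1 s2 : F [:: u, v & s1 ++ s2] = F (s1 ++ [:: u, v & s2]) by perm_count Fperm.
    by rewrite sw FdZ -sw nseqD catA.
  move=> u z; rewrite !eqF => pos.
  have dn : 0 < delta ^+ n by exact: exprn_gt0.
  have := @base (n + m)%N l Pl sz u z; rewrite pmulr_rgt0// in pos => /(_ pos) h.
  rewrite exprMn mulrACA -expr2; apply: ler_wpM2l => //; exact: sqr_ge0.
set Z := delta *: k + \sum_(j <- r) t j *: e j.
have -> : delta *: k + \sum_(j <- i :: r) t j *: e j = Z + t i *: e i.
  by rewrite big_cons [t i *: _ + _]addrC addrA.
have cZ : cone Z.
  move=> j; rewrite !mxE summxE addr_ge0//; first by rewrite mulr_ge0// ltW.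
  by apply: sumr_ge0 => j' _; rewrite !mxE eqxx /= mulr_ge0.
have ck : cone k by move=> j; exact: ltW.
case: n sz => [|n] sz; first exact: (IH Pr 0%N).
pose s' := nseq m k ++ map e l.
have sw u v s1 s2 : F [:: u, v & s1 ++ s2] = F (s1 ++ [:: u, v & s2]) by perm_count Fperm.
have FE x y : F [:: x, y & nseq n.+1 (Z + t i *: e i) ++ s'] =
    F [:: x, y & nseq n.+1 Z ++ s'] + (n.+1%:R * t i) * F [:: x, y & nseq n Z ++ e i :: s'].
  rewrite sw FnseqD// -sw; congr (_ + _ * _); perm_count Fperm.
have L1 : lorentzian (fun x y => F [:: x, y & nseq n.+1 Z ++ s']) by exact: IH.
have L2 : lorentzian (fun x y => F [:: x, y & nseq n Z ++ e i :: s']).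
  have := IH Pr n m (i :: l); rewrite /= Pi Pl => /(_ isT).
  have -> : (n + m + (size l).+1 + 2 = d)%N by rewrite -sz; lia.
  move=> /(_ erefl) h x z.
  have eqs u v : F [:: u, v & nseq n Z ++ e i :: s'] = F [:: u, v & nseq n Z ++ nseq m k ++ e i :: map e l].
    by rewrite /s'; perm_count Fperm.
  by rewrite !eqs; exact: h.
have [ti|ti] := eqVneq (t i) 0.
  by move=> x z; rewrite !FE ti !mulr0 !mul0r !addr0; exact: L1.
have ti0 : 0 < t i by rewrite lt_neqAle eq_sym ti t0.
have s0 : 0 < n.+1%:R * t i by rewrite mulr_gt0.
pose q := F [:: Z, e i & nseq n.+1 Z ++ s'].
have cZs (N : nat) y : y \in nseq N Z ++ nseq m k -> cone y.
  by rewrite mem_cat => /orP[] /nseqP[->].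
have q0 : 0 <= q.
  have := @Fnn d nnF (nseq n.+2 Z ++ nseq m k) (cZs _) (i :: l).
  rewrite size_cat !size_nseq /= -catA /q /= => h.
  have -> : F [:: Z, e i, Z & nseq n Z ++ s'] = F [:: Z, Z & nseq n Z ++ nseq m k ++ e i :: map e l].
    by rewrite /s'; perm_count Fperm.
  by apply: h; lia.
move: q0; rewrite le_eqVlt => /orP[/eqP q0|q0]; last first.
  have := @lorentzianD R E _ _ Z (e i) _ (bilinF (nseq n.+1 Z ++ s')) (bilinF (nseq n Z ++ e i :: s')) L1 L2 _ _ _ q0 s0.
  move=> h x z; rewrite !FE; apply: h => //.
  - by move=> y /=; perm_count Fperm.
  - move=> y; have -> : F [:: e i, y & nseq n Z ++ e i :: s'] = F [:: e i, e i & y :: nseq n Z ++ s'] by perm_count Fperm.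
    exact: FP.
  - have := @Fnn d nnF ([:: Z, Z & nseq n.+1 Z ++ nseq m k]) _ l.
    rewrite /= size_cat !size_nseq -catA; apply; last by lia.
    exact: (cZs n.+3).
(* In the remaining case q = 0, Z dominates delta k, so F vanishes at e i and [l] with copies of the
   interior vector k in all other slots. By [Fzero] the form H2 is then identically 0. *)
have Fle a c w (s : seq E) : (forall y, y \in s -> cone y) -> cone w -> (a + size s + size c = d)%N ->
    delta ^+ a * F (nseq a k ++ s ++ map e c) <= F (nseq a (delta *: k + w) ++ s ++ map e c).
  elim: a s => [|a IHa] s cs cw sza; first by rewrite expr0 mul1r.
  have ck' : cone (delta *: k + w) by move=> j; rewrite !mxE addr_ge0// mulr_ge0// ltW.
  have -> : F (nseq a.+1 (delta *: k + w) ++ s ++ map e c) =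
      delta * F (nseq a (delta *: k + w) ++ (k :: s) ++ map e c) +
      F (nseq a (delta *: k + w) ++ (w :: s) ++ map e c).
    by rewrite /= !Fmid -FZ -FD.
  have -> : F (nseq a.+1 k ++ s ++ map e c) = F (nseq a k ++ (k :: s) ++ map e c).
    by rewrite /= Fmid.
  have h1 : delta ^+ a * F (nseq a k ++ (k :: s) ++ map e c) <= F (nseq a (delta *: k + w) ++ (k :: s) ++ map e c).
    apply: IHa; [|exact: cw|by rewrite -sza /= addnS].
    by move=> y; rewrite inE => /orP[/eqP->|/cs].
  have h2 : 0 <= F ((nseq a (delta *: k + w) ++ (w :: s)) ++ map e c).
    apply: (Fnn nnF); last by rewrite size_cat size_nseq /= -sza; lia.
    by move=> y; rewrite mem_cat inE => /or3P[/nseqP[->]|/eqP->|/cs].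
  rewrite -catA in h2; apply: ler_wpDr => //.
  by rewrite exprS -mulrA ler_pM2l.
have Fk0 : F (nseq (n.+2 + m) k ++ map e (i :: l)) = 0.
  have := @Fle n.+2 (i :: l) (\sum_(j <- r) t j *: e j) (nseq m k).
  rewrite -/Z => h.
  have dn : 0 < delta ^+ n.+2 by exact: exprn_gt0.
  apply/eqP; rewrite eq_le; apply/andP; split; last first.
    by apply: (Fnn nnF) => [y /nseqP[->]|]//; rewrite size_nseq /= -sz; lia.
  rewrite -(pmulr_rle0 _ dn) nseqD -catA.
  apply: le_trans (h _ _ _) _.
  + by move=> y /nseqP[->].
  + by move=> j; rewrite summxE; apply: sumr_ge0 => j' _; rewrite !mxE eqxx /= mulr_ge0.
  + by rewrite size_nseq /= -sz; lia.
  by rewrite q0 /q /s' le_eqVlt; apply/orP; left; apply/eqP; perm_count Fperm.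
have H20 x y : F [:: x, y & nseq n Z ++ e i :: s'] = 0.
  have -> : F [:: x, y & nseq n Z ++ e i :: s'] = F ([:: x, y & nseq n Z ++ nseq m k] ++ map e (i :: l)).
    by rewrite /s'; perm_count Fperm.
  apply: (@Fzero d k nnF k0 (n.+2 + m) (i :: l)) => //.
    by rewrite /= -sz; lia.
  by rewrite /= size_cat !size_nseq; lia.
by move=> x z; rewrite !FE !H20 !mulr0 !addr0; exact: L1.
Qed.

End MixedForm.

(** * Alexandrov-Fenchel for a cone vector and a zonotope *)

Section AlexandrovFenchel.
Context {R : realType} (M d : nat).
Local Notation E := 'rV[R]_M.
Variable (F : seq E -> R).
Hypothesis Flin : forall a x y s, F ((a *: x + y) :: s) = a * F (x :: s) + F (y :: s).
Hypothesis Fperm : forall s s', perm_eq s s' -> F s = F s'.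
Let e (i : 'I_M) : E := delta_mx ord0 i.
Variable P : pred 'I_M.
Hypothesis nnF : forall s : seq 'I_M, size s = d -> 0 <= F (map e s).
Hypothesis FP : forall i s, P i -> F [:: e i, e i & s] = 0.
Hypothesis base : forall k : E, (forall i, 0 < k ord0 i) ->
  forall n (l : seq 'I_M), all P l -> (n + size l + 2 = d)%N ->
  lorentzian (fun x y => F [:: x, y & nseq n k ++ map e l]).

Lemma ispoly_form (l : seq (R -> E)) (s : seq 'I_M) :
  (forall f, List.In f l -> forall i, ispoly (fun t => f t ord0 i)) ->
  ispoly (fun t => F ([seq f t | f <- l] ++ map e s)).
Proof.
elim: l s => [|f l IH] s lP.
  by exists (F (map e s))%:P => t; rewrite hornerC.
have [p hp] : ispoly (fun t => \sum_i f t ord0 i * F ([seq g t | g <- l] ++ map e (i :: s))).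
  apply: ispoly_sum => i _; apply: ispolyM; first by apply: lP; left.
  by apply: IH => g gl; apply: lP; right.
exists p => t; rewrite -hp /= (Fbasis Flin); apply: eq_bigr => i _.
by rewrite (Fmid Fperm).
Qed.

(** The vectors x and z may lie on the boundary of the cone. They are moved inside to k(s) = x + s
    (1, ..., 1) and Z(s) = s k(s) + z; the inequality is polynomial in s and extends to s = 0. *)
Theorem alexandrov_fenchel_zonotope (x z : E) (r : seq 'I_M) (t : 'I_M -> R) n m :
  cone x -> all P r -> (forall i, 0 <= t i) -> (n + m + 2 = d)%N ->
  z = \sum_(i <- r) t i *: e i ->
  F (nseq n.+2 z ++ nseq m x) * F (nseq n z ++ nseq m.+2 x)
    <= F (nseq n.+1 z ++ nseq m.+1 x) ^+ 2.
Proof.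
move=> cx Pr t0 nm zE.
pose k (s : R) : E := x + s *: const_mx 1; pose Z (s : R) : E := s *: k s + z.
have kP i : ispoly (fun s => k s ord0 i).
  have [p hp] := ispolyD (ispoly_cst (x ord0 i)) ispoly_id.
  by exists p => s; rewrite -hp !mxE mulr1.
have ZP i : ispoly (fun s => Z s ord0 i).
  have [p hp] := ispolyD (ispolyM ispoly_id (kP i)) (ispoly_cst (z ord0 i)).
  by exists p => s; rewrite -hp !mxE.
have WP a b : ispoly (fun s => F (nseq a (Z s) ++ nseq b (k s))).
  have lP f : List.In f (nseq a Z ++ nseq b k) -> forall i, ispoly (fun s => f s ord0 i).
    elim: a => [|a IH] /=; last by case=> [<-|/IH].
    by elim: b => [|b IH] //= [<-|/IH].
  have [p hp] := ispoly_form [::] lP.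
  exists p => s; rewrite -hp; congr F.
  by rewrite map_cat !map_nseq cats0.
have k0 : k 0 = x by rewrite /k scale0r addr0.
have Z0 : Z 0 = z by rewrite /Z scale0r add0r.
have main s : 0 < s -> F (nseq n.+2 (Z s) ++ nseq m (k s)) * F (nseq n (Z s) ++ nseq m.+2 (k s))
    <= F (nseq n.+1 (Z s) ++ nseq m.+1 (k s)) ^+ 2.
  move=> s0.
  have kp i : 0 < k s ord0 i by rewrite !mxE mulr1 ltr_wpDl// (cx i).
  have cz : cone z.
    by move=> j; rewrite zE summxE; apply: sumr_ge0 => j' _; rewrite !mxE eqxx /= mulr_ge0.
  have cZ : cone (Z s).
    move=> j; rewrite mxE addr_ge0// ?cz// mxE mulr_ge0 ?(ltW s0)//.
    exact/ltW/kp.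
  have nn a b : (a + b = d)%N -> 0 <= F (nseq a (Z s) ++ nseq b (k s)).
    move=> ab; have := @Fnn _ _ F Flin Fperm d nnF (nseq a (Z s) ++ nseq b (k s)) _ [::].
    rewrite size_cat !size_nseq addn0 cats0; apply => //.
    move=> y; rewrite mem_cat => /orP[] /nseqP[->] _ //.
    by move=> i; exact/ltW/kp.
  have := nn n.+2 m; rewrite le_eqVlt => /(_ _)/orP[|/eqP<-|w0].
  - by rewrite -nm; lia.
  - by rewrite mul0r sqr_ge0.
  have L := @lorentzian_zonotope _ _ F Flin Fperm d (k s) P nnF kp FP (base kp) s r t s0 Pr t0 n m [::] isT.
  rewrite cats0 in L.
  have {}L := L _ (Z s) (k s); rewrite -zE -/(Z s) in L.
  rewrite mulrC.
  have e1 : F [:: k s, k s & nseq n (Z s) ++ nseq m (k s)] = F (nseq n (Z s) ++ nseq m.+2 (k s)) by perm_count Fperm.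
  have e2 : F [:: k s, Z s & nseq n (Z s) ++ nseq m (k s)] = F (nseq n.+1 (Z s) ++ nseq m.+1 (k s)) by perm_count Fperm.
  have e3 : F [:: Z s, Z s & nseq n (Z s) ++ nseq m (k s)] = F (nseq n.+2 (Z s) ++ nseq m (k s)) by perm_count Fperm.
  rewrite e1 e2 e3 in L; apply: L => //; by rewrite /= addn0.
pose g s := F (nseq n.+2 (Z s) ++ nseq m (k s)) * F (nseq n (Z s) ++ nseq m.+2 (k s))
   + -1 * F (nseq n.+1 (Z s) ++ nseq m.+1 (k s)) ^+ 2.
have gP : ispoly g.
  apply: ispolyD; first exact: ispolyM.
  by apply: ispolyM; [exact: ispoly_cst|exact: ispolyX].
have := ispoly_le0 gP ltr01; rewrite /g Z0 k0 mulN1r subr_le0; apply.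
by move=> s s0 _; rewrite mulN1r subr_le0; exact: main.
Qed.

End AlexandrovFenchel.

(** * Sums over subsets *)

Section SubsetSums.
Context {R : realType} {I : finType}.
Implicit Types (S T U : {set I}) (h : {set I} -> R).

Lemma sum_setU1 U i h : i \in U ->
  \sum_(S : {set I} | (S \subset U) && (i \notin S)) h (i |: S) = \sum_(S : {set I} | (S \subset U) && (i \in S)) h S.
Proof.
move=> iU; rewrite [RHS](reindex_onto (fun S => i |: S) (fun S => S :\ i)) /=.
  apply: eq_bigl => S; rewrite finset.setU11 finset.subUset finset.sub1set iU /= andbT.
  have [iS|iS] := boolP (i \in S); rewrite ?andbF ?andbT.
    apply/esym/negbTE; rewrite negb_and; apply/orP; right; apply/eqP => e.
    by move: iS; rewrite -e finset.in_setD1 eqxx.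
  by rewrite finset.setU1K// eqxx andbT.
by move=> S /andP[_ iS]; rewrite finset.setD1K.
Qed.

Lemma sum_subset_setU1 U i h : i \notin U ->
  \sum_(S : {set I} | S \subset i |: U) h S = \sum_(S : {set I} | S \subset U) h S + \sum_(S : {set I} | S \subset U) h (i |: S).
Proof.
move=> iU; rewrite (bigID (fun S => i \in S)) /= addrC; congr (_ + _).
  apply: eq_bigl => S; apply/andP/idP => [[SU iS]|SU].
    apply/fintype.subsetP => j jS; have := fintype.subsetP SU _ jS; rewrite finset.in_setU1 => /orP[/eqP ji|//].
    by rewrite -ji jS in iS.
  split; first by apply: fintype.subset_trans SU _; exact: finset.subsetUr.
  by apply: contra iU; exact: (fintype.subsetP SU).
rewrite -sum_setU1 ?finset.setU11//; apply: eq_bigl => S; apply/andP/idP => [[SU iS]|SU].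
  apply/fintype.subsetP => j jS; have := fintype.subsetP SU _ jS; rewrite finset.in_setU1 => /orP[/eqP ji|//].
  by rewrite -ji jS in iS.
split; first by apply: fintype.subset_trans SU _; exact: finset.subsetUr.
by apply: contra iU; exact: (fintype.subsetP SU).
Qed.

(** Double counting of the pairs (i, S) with i in S. *)
Lemma sum_setU1_card U (g : I -> R) h :
  \sum_(i in U) g i * \sum_(S : {set I} | (S \subset U) && (i \notin S)) (\prod_(j in S) g j) * h (i |: S)
  = \sum_(S : {set I} | S \subset U) #|S|%:R * ((\prod_(j in S) g j) * h S).
Proof.
transitivity (\sum_(i in U) \sum_(S : {set I} | (S \subset U) && (i \in S)) (\prod_(j in S) g j) * h S).
  apply: eq_bigr => i iU; rewrite -(sum_setU1 _ iU) mulr_sumr; apply: eq_bigr => S /andP[_ iS].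
  by rewrite big_setU1//= mulrA.
rewrite (exchange_big_dep (fun S => S \subset U)) /=; last by move=> i S _ /andP[].
apply: eq_bigr => S SU; rewrite sumr_const mulr_natl; congr (_ *+ _).
apply: eq_card => i; rewrite unfold_in SU /=.
by apply: andb_idl => iS; exact: (fintype.subsetP SU).
Qed.

End SubsetSums.

(** * Functions affine in each coordinate are polynomials *)

Section MultiAffine.
Context {R : realType} {N : nat}.
Local Notation E := 'rV[R]_N.
Local Notation e := (delta_mx (ord0 : 'I_1)).

Definition nneg (t : E) := forall i, 0 <= t ord0 i.

Lemma nneg_sum (t : E) (r : seq 'I_N) : nneg t -> nneg (\sum_(i <- r) t ord0 i *: e i).
Proof. by move=> t0 j; rewrite summxE; apply: sumr_ge0 => i _; rewrite !mxE eqxx /= mulr_ge0. Qed.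

Lemma nneg_addZ (t : E) i s : nneg t -> 0 <= s -> nneg (t + s *: e i).
Proof. by move=> t0 s0 j; rewrite !mxE eqxx /= addr_ge0// mulr_ge0. Qed.

Definition multiaffine (g : E -> R) := forall t i s, nneg t -> 0 <= s ->
  g (t + s *: e i) = g t + s * (g (t + e i) - g t).

(** Coordinates are switched on one at a time: g(t + e i) - g(t) is again multiaffine and supplies
    the coefficients of the monomials that contain i. *)
Lemma multiaffine_sum (g : E -> R) : multiaffine g -> exists c : {set 'I_N} -> R,
  forall t, nneg t -> g t = \sum_(T : {set 'I_N}) (\prod_(i in T) t ord0 i) * c T.
Proof.
move=> mg.
have main (r : seq 'I_N) : uniq r -> forall g, multiaffine g -> exists c : {set 'I_N} -> R,
    forall t, nneg t -> g (\sum_(i <- r) t ord0 i *: e i) =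
      \sum_(T : {set 'I_N} | T \subset [set i in r]%SET) (\prod_(i in T) t ord0 i) * c T.
  elim: r => [_|i r IH /= /andP[ir ur]] {mg}g mg.
    exists (fun=> g 0) => t t0; rewrite big_nil (big_pred1 finset.set0) ?big_set0 ?mul1r// => T.
    by rewrite /= -finset.subset0; congr (T \subset _); apply/finset.setP => j; rewrite !inE.
  have mg1 : multiaffine (fun t => g (t + e i) - g t).
    move=> t j s t0 s0 /=; rewrite -!(addrAC _ (e i)) !mg//.
      by ring.
    by have := nneg_addZ i t0 ler01; rewrite scale1r.
  have [c0 h0] := IH ur g mg; have [c1 h1] := IH ur _ mg1.
  exists (fun T : {set 'I_N} => if i \in T then c1 (T :\ i)%SET else c0 T) => t t0.
  rewrite big_cons addrC mg//; last exact: nneg_sum.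
  rewrite h1// h0//.
  have -> : [set j in i :: r]%SET = (i |: [set j in r])%SET by apply/finset.setP => j; rewrite !inE.
  have iU : i \notin [set j in r]%SET by rewrite inE.
  rewrite sum_subset_setU1//; congr (_ + _).
    apply: eq_bigr => T TU; rewrite ifN//.
    by apply: contra iU; exact: (fintype.subsetP TU).
  rewrite mulr_sumr; apply: eq_bigr => T TU.
  have iT : i \notin T by apply: contra iU; exact: (fintype.subsetP TU).
  by rewrite finset.setU11 finset.setU1K// big_setU1//= mulrA.
have [c hc] := main (enum 'I_N) (enum_uniq _) g mg.
exists c => t t0; rewrite {1}(row_sum_delta t) -big_enum hc//.
by apply: eq_bigl => T; apply/fintype.subsetP => j _; rewrite inE mem_enum.
Qed.

End MultiAffine.

(** * The volume polynomial of a body plus a zonotope *)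

Section Zonotopes.
Context {R : realType}.

Lemma compact_box n (a b : 'rV[R]_n) :
  compact [set s : 'rV[R]_n | forall i, a ord0 i <= s ord0 i <= b ord0 i].
Proof.
apply/compact_rVP; split.
  have -> : [set s : 'rV[R]_n | forall i, a ord0 i <= s ord0 i <= b ord0 i] =
      \bigcap_(i in [set: 'I_n]) ([set s : 'rV[R]_n | a ord0 i <= s ord0 i] `&`
        [set s : 'rV[R]_n | s ord0 i <= b ord0 i]).
    apply/seteqP; split=> y /= yr i; first by move=> _; have /andP[? ?] := yr i.
    by have [/= -> ->] := yr i I.
  apply: closed_bigI => i _; have ci := @coord_continuous R 1 n ord0 i.
  by apply: closedI; [apply: closed_ge_continuous|apply: closed_le_continuous].
exists (\sum_i (`|a ord0 i| + `|b ord0 i|)) => x xab i.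
have /andP[ax xb] := xab i.
apply: (@le_trans _ _ (`|a ord0 i| + `|b ord0 i|)).
  rewrite ler_norml; apply/andP; split.
    by have := ler_norm (- a ord0 i); rewrite normrN; have := normr_ge0 (b ord0 i); lra.
  by have := ler_norm (b ord0 i); have := normr_ge0 (a ord0 i); lra.
by rewrite (bigD1 i)//= lerDl; apply: sumr_ge0 => j _; rewrite addr_ge0.
Qed.

Definition zono n N (Y : 'M[R]_(N, n)) (t : 'rV[R]_N) : set 'rV[R]_n :=
  [set s *m Y | s in [set s : 'rV[R]_N | forall i, 0 <= s ord0 i <= t ord0 i]].

Variables (n N : nat) (Y : 'M[R]_(N, n)).
Implicit Types (K : set 'rV[R]_n) (t : 'rV[R]_N).

Lemma body_zono t : body (zono Y t).
Proof.
rewrite /zono; split.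
  apply: compact_image; first exact: continuous_mulmx.
  have -> : [set s : 'rV[R]_N | forall i, 0 <= s ord0 i <= t ord0 i] =
      [set s : 'rV[R]_N | forall i, (0 : 'rV[R]_N) ord0 i <= s ord0 i <= t ord0 i].
    by apply/seteqP; split=> s /= h i; have := h i; rewrite mxE.
  exact: (@compact_box N).
apply: cvx_image => [x y a b _|]; first by rewrite mulmxDl -!scalemxAl.
move=> x y a b /= xt yt a0 b0 ab i; rewrite !mxE.
have /andP[x0 x1] := xt i; have /andP[y0 y1] := yt i.
rewrite addr_ge0 ?mulr_ge0//= -[leRHS]mul1r -ab mulrDl lerD// ler_wpM2l//.
Qed.

Lemma zono_neq0 t : nneg t -> zono Y t !=set0.
Proof. by move=> t0; exists (0 *m Y); exists 0 => //= i; rewrite mxE lexx t0. Qed.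

Lemma zono_addZ K t i s : nneg t -> 0 <= s ->
  minksum K (zono Y (t + s *: delta_mx ord0 i)) =
  minksum (minksum K (zono Y t)) (mscal s (seg (row i Y))).
Proof.
move=> t0 s0; apply/seteqP; split=> z.
  move=> [x [_ [Kx [a /= aP <-] ->]]].
  pose a1 := \row_j Order.min (a ord0 j) (t ord0 j).
  pose r := a ord0 i - Order.min (a ord0 i) (t ord0 i).
  have ri : 0 <= r <= s.
    have := aP i; rewrite !mxE !eqxx /= mulr1 => /andP[h1 h2].
    by rewrite /r; case: (leP (a ord0 i) (t ord0 i)) => h; lra.
  have aE : a = a1 + r *: delta_mx ord0 i.
    apply/rowP => j; rewrite !mxE eqxx /=; case: (eqVneq j i) => [->|ji] /=.
      by rewrite /r; ring.
    have := aP j; rewrite !mxE eqxx /= (negPf ji) mulr0 addr0 => /andP[_ h].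
    by rewrite (min_idPl h) mulr0 addr0.
  have /andP[r0 rs] := ri.
  exists (x + a1 *m Y), (r *: row i Y); split.
  - exists x, (a1 *m Y); split=> //; exists a1 => //= j; rewrite mxE.
    have := aP j => /andP[h _]; rewrite le_min h t0 /=.
    by rewrite ge_min lexx orbT.
  - have [s00|s00] := eqVneq s 0.
      have -> : r = 0 by apply/eqP; rewrite eq_le r0 andbT -s00.
      exists 0; last by rewrite scaler0 scale0r.
      by exists 0; rewrite /= ?lexx ?ler01 ?scale0r.
    exists ((r / s) *: row i Y); last by rewrite scalerA mulrC divfK.
    exists (r / s) => //; have sp : 0 < s by rewrite lt_neqAle eq_sym s00.
    by rewrite /= divr_ge0//= ler_pdivrMr// mul1r.
  - by rewrite aE mulmxDl -scalemxAl -rowE addrA.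
move=> [_ [_ [[x [_ [Kx [a aP <-] ->]]] [_ [b /andP[b0 b1] <-] <-] ->]]].
exists x, ((a + (s * b) *: delta_mx ord0 i) *m Y); split=> //.
  exists (a + (s * b) *: delta_mx ord0 i) => //= j; rewrite !mxE eqxx /=.
  have /andP[h1 h2] := aP j; rewrite addr_ge0 ?mulr_ge0//= lerD//.
  by rewrite ler_wpM2r// ler_piMr.
by rewrite mulmxDl -scalemxAl -rowE scalerA addrA.
Qed.

Lemma multiaffine_vol K : body K -> multiaffine (fun t => vol (minksum K (zono Y t))).
Proof.
move=> bK t i s t0 s0 /=; have := zono_addZ K i t0 ler01; rewrite scale1r => ->.
rewrite zono_addZ// vol_add_seg//; last by apply: body_minksum => //; exact: body_zono.
congr (_ + _ * (vol (minksum _ _) - _)).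
by apply/seteqP; split=> [x xs|_ [x xs <-]]; rewrite ?scale1r//; exists x; rewrite ?scale1r.
Qed.

(* [vol (K + sum_i t_i [0, y_i])] is a polynomial in [t], of degree one in each
   variable; [vol_coef K T] is the coefficient of the monomial [T]. *)
Definition vol_coef K : {set 'I_N} -> R :=
  get [set c | forall t, nneg t -> vol (minksum K (zono Y t)) =
     \sum_(T : {set 'I_N}) (\prod_(i in T) t ord0 i) * c T].

Lemma vol_coefE K t : body K -> nneg t -> vol (minksum K (zono Y t)) =
     \sum_(T : {set 'I_N}) (\prod_(i in T) t ord0 i) * vol_coef K T.
Proof.
move=> bK t0; have [c hc] := multiaffine_sum (multiaffine_vol bK).
exact: (@getPex _ [set c | forall t, nneg t -> vol (minksum K (zono Y t)) =
     \sum_(T : {set 'I_N}) (\prod_(i in T) t ord0 i) * c T] (ex_intro _ c hc) t t0).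
Qed.

(** Substituting the indicator of T divided by x isolates one coefficient: the right-hand side is a
    polynomial in x with value [vol_coef K T] at 0. Coefficients are thus limits of volumes, from
    which they inherit sign and monotonicity. *)
Lemma vol_coef_rev K (T : {set 'I_N}) x : body K -> 0 < x ->
  x ^+ #|T| * vol (minksum K (zono Y (x^-1 *: \row_i (i \in T)%:R))) =
  \sum_(S : {set 'I_N} | S \subset T) x ^+ (#|T| - #|S|) * vol_coef K S.
Proof.
move=> bK x0; have xn : x != 0 by rewrite gt_eqF.
rewrite (vol_coefE bK); last by move=> i; rewrite !mxE mulr_ge0// invr_ge0 ltW.
rewrite mulr_sumr (bigID (fun S : {set 'I_N} => S \subset T)) /= [X in _ + X]big1 ?addr0.
  apply: eq_bigr => S ST; rewrite mulrA; congr (_ * _).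
  rewrite (eq_bigr (fun=> x^-1)); last by move=> i iS; rewrite !mxE (fintype.subsetP ST _ iS) mulr1.
  rewrite prodr_const exprVn -expfB_cond ?(negPf xn) ?fintype.subset_leq_card//.
move=> S /fintype.subsetPn[i iS iT]; rewrite (bigD1 i)//= !mxE (negPf iT) mulr0 !mul0r mulr0 //.
Qed.

Lemma rev_at0 (c : {set 'I_N} -> R) (T : {set 'I_N}) :
  \sum_(S : {set 'I_N} | S \subset T) 0 ^+ (#|T| - #|S|) * c S = c T.
Proof.
rewrite (bigD1 T)//= subnn expr0 mul1r big1 ?addr0// => S /andP[ST nST].
rewrite expr0n (_ : (#|T| - #|S| == 0)%N = false) ?mul0r//; apply/negbTE.
by rewrite subn_eq0 -ltnNge fintype.proper_card// finset.properEneq nST.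
Qed.

Lemma ispoly_rev (c : {set 'I_N} -> R) (T : {set 'I_N}) :
  ispoly (fun x => \sum_(S : {set 'I_N} | S \subset T) x ^+ (#|T| - #|S|) * c S).
Proof.
apply: ispoly_sum => S _; apply: ispolyM; last exact: ispoly_cst.
by apply: ispolyX; exact: ispoly_id.
Qed.

Lemma le_vol_coef K K' T : body K -> body K' -> K `<=` K' -> vol_coef K T <= vol_coef K' T.
Proof.
move=> bK bK' KK'; rewrite -subr_le0 -(rev_at0 (vol_coef K)) -(rev_at0 (vol_coef K')) -mulN1r.
apply: (ispoly_le0 (ispolyD (ispoly_rev _ _) (ispolyM (ispoly_cst (-1)) (ispoly_rev (vol_coef K') T))) ltr01).
move=> x x0 _; rewrite mulN1r subr_le0 -!vol_coef_rev// ler_pM2l ?exprn_gt0//.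
apply: le_vol; [exact: (body_minksum bK (body_zono _)).1|exact: (body_minksum bK' (body_zono _)).1|].
by move=> _ [a [b [Ka Zb ->]]]; exists a, b; split=> //; exact: KK'.
Qed.

Lemma vol_coef_ge0 K T : body K -> 0 <= vol_coef K T.
Proof.
move=> bK; rewrite -oppr_le0 -(rev_at0 (vol_coef K)) -mulN1r.
apply: (ispoly_le0 (ispolyM (ispoly_cst (-1)) (ispoly_rev _ _)) ltr01).
by move=> x x0 _; rewrite mulN1r oppr_le0 -vol_coef_rev// mulr_ge0 ?vol_ge0// exprn_ge0// ltW.
Qed.

Lemma zono_mscal t s : 0 < s -> zono Y (s *: t) = mscal s (zono Y t).
Proof.
move=> s0; have sn : s != 0 by rewrite gt_eqF.
apply/seteqP; split=> [_ [a aP <-]|_ [_ [a aP <-] <-]].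
  exists ((s^-1 *: a) *m Y); last by rewrite scalemxAl scalerA mulfV// scale1r.
  exists (s^-1 *: a) => //= i; have := aP i; rewrite !mxE => /andP[h1 h2].
  by apply/andP; split; [rewrite mulr_ge0// invr_ge0 ltW|rewrite mulrC ler_pdivrMr// mulrC].
exists (s *: a); last by rewrite scalemxAl.
by move=> i; have /andP[h1 h2] := aP i; rewrite !mxE mulr_ge0 ?(ltW s0)//= ler_pM2l.
Qed.

(** With segments scaled by 1/x the volume is of order x^-n at most, so multiplication by x^#|T|
    makes it vanish as x tends to 0. The cube B serves as a bound for K that contains its own
    shrunken copies. *)
Lemma vol_coef_eq0 K (T : {set 'I_N}) : body K -> K !=set0 -> (n < #|T|)%N -> vol_coef K T = 0.
Proof.
move=> bK K0 nT; apply/eqP; rewrite eq_le vol_coef_ge0// andbT.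
have [_ [M KM]] := (compact_rVP K).1 bK.1.
pose B := [set s : 'rV[R]_n | forall i, (- const_mx `|M| : 'rV[R]_n) ord0 i <= s ord0 i <= (const_mx `|M| : 'rV[R]_n) ord0 i].
pose C := minksum B (zono Y (\row_i (i \in T)%:R)).
have tn : nneg (\row_i (i \in T)%:R : 'rV[R]_N) by move=> i; rewrite mxE.
have cC : compact C by apply: compact_minksum; [exact: (@compact_box n)|exact: (body_zono _).1].
have Mi k : K k -> forall i, - `|M| <= k ord0 i <= `|M|.
  move=> Kk i; rewrite -ler_norml; apply: le_trans (KM _ Kk i) _; exact: ler_norm.
have C0 : C !=set0.
  have [k Kk] := K0; have [z Zz] := zono_neq0 tn.
  by exists (k + z), k, z; split=> // i; rewrite !mxE; exact: Mi.
have main x : 0 < x -> x < 1 ->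
    \sum_(S : {set 'I_N} | S \subset T) x ^+ (#|T| - #|S|) * vol_coef K S <= x ^+ (#|T| - n) * vol C.
  move=> x0 x1; rewrite -vol_coef_rev//.
  have x0' : 0 < x^-1 by rewrite invr_gt0.
  have -> : x ^+ (#|T| - n) * vol C = x ^+ #|T| * vol (mscal x^-1 C).
    rewrite vol_mscal ?ltW// mulrA exprVn -expfB_cond// ?(gt_eqF x0)// ltnW//.
  rewrite ler_pM2l ?exprn_gt0//; apply: le_vol.
  - exact: (body_minksum bK (body_zono _)).1.
  - exact: compact_mscal.
  move=> _ [k [z [Kk Zz ->]]]; rewrite zono_mscal// in Zz; case: Zz => z' Zz' <-.
  exists (x *: k + z'); last by rewrite scalerDr scalerA mulVf ?scale1r// gt_eqF.
  exists (x *: k), z'; split=> // i; rewrite !mxE.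
  have /andP[h1 h2] := Mi _ Kk i; have := normr_ge0 M => M0.
  by apply/andP; split; nra.
rewrite -subr_le0 -[X in X - 0](rev_at0 (vol_coef K)) -[X in _ - X](mul0r (vol C)).
rewrite -[X in X * vol C](_ : 0 ^+ (#|T| - n) = 0); last first.
  by rewrite expr0n subn_eq0 leqNgt nT.
rewrite -mulN1r.
apply: (ispoly_le0 (ispolyD (ispoly_rev _ _) (ispolyM (ispoly_cst (-1)) (ispolyM (ispolyX _ ispoly_id) (ispoly_cst (vol C))))) ltr01).
by move=> x x0 x1; rewrite mulN1r subr_le0; exact: main.
Qed.

End Zonotopes.

Lemma subset_setC1 (I : finType) (S : {set I}) i : (S \subset (~: [set i]%SET)%SET) = (i \notin S).
Proof.
apply/fintype.subsetP/idP => [h|iS j jS].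
  by apply/negP => /h; rewrite finset.in_setC finset.in_set1 eqxx.
by rewrite finset.in_setC finset.in_set1; apply: contraNneq iS => <-.
Qed.

Lemma cone_delta (R : realType) M (i : 'I_M) : cone (delta_mx ord0 i : 'rV[R]_M).
Proof. by move=> j; rewrite mxE ler0n. Qed.

(** * Mixed volumes of a body and segments *)

Section MixedVolumeForm.
Context {R : realType} {n N : nat} (Y : 'M[R]_(N, n)).
Local Notation E := 'rV[R]_N.+1.
Implicit Types (v : E) (Phi : nat -> {set 'I_N} -> R) (T : {set 'I_N}) (K : set 'rV[R]_n).

(** A vector v stands for v_0 K + sum_i v_(i+1) [0, y_i]. The pair (a, T) records the choices made
    in the slots expanded so far: a copies of K and the segments in T. [shift v] expands one more
    slot linearly; a segment already in T contributes nothing. *)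
Definition shift v Phi : nat -> {set 'I_N} -> R := fun a T =>
  v ord0 ord0 * Phi a.+1 T + \sum_(i | i \notin T) v ord0 (lift ord0 i) * Phi a (i |: T)%SET.

Lemma shiftC u v Phi : shift u (shift v Phi) = shift v (shift u Phi).
Proof.
apply/funext => a; apply/funext => T; rewrite /shift.
have ex (w z : E) : \sum_(i | i \notin T) w ord0 (lift ord0 i) *
     (z ord0 ord0 * Phi a.+1 (i |: T)%SET +
      \sum_(j | j \notin (i |: T)%SET) z ord0 (lift ord0 j) * Phi a (j |: (i |: T))%SET) =
  \sum_(i | i \notin T) w ord0 (lift ord0 i) * (z ord0 ord0 * Phi a.+1 (i |: T)%SET) +
  \sum_(i | i \notin T) \sum_(j | j \notin (i |: T)%SET)
    w ord0 (lift ord0 i) * (z ord0 (lift ord0 j) * Phi a (j |: (i |: T))%SET).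
  rewrite -big_split; apply: eq_bigr => i _ /=; rewrite mulrDr; congr (_ + _).
  by rewrite mulr_sumr.
rewrite !ex !mulrDr !mulr_sumr.
have -> : \sum_(i | i \notin T) \sum_(j | j \notin (i |: T)%SET)
    u ord0 (lift ord0 i) * (v ord0 (lift ord0 j) * Phi a (j |: (i |: T))%SET) =
  \sum_(i | i \notin T) \sum_(j | j \notin (i |: T)%SET)
    v ord0 (lift ord0 i) * (u ord0 (lift ord0 j) * Phi a (j |: (i |: T))%SET).
  rewrite (exchange_big_dep (fun j => j \notin T)) /=; last first.
    by move=> i j _; rewrite finset.in_setU1 negb_or => /andP[].
  apply: eq_bigr => j jT; apply: eq_big => [i|i _].
    by rewrite !finset.in_setU1 !negb_or jT andbT eq_sym andbC.
  by rewrite mulrCA finset.setUCA.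
have e1 : \sum_(i | i \notin T) u ord0 (lift ord0 i) * (v ord0 ord0 * Phi a.+1 (i |: T)%SET) =
  \sum_(i | i \notin T) v ord0 ord0 * (u ord0 (lift ord0 i) * Phi a.+1 (i |: T)%SET).
  by apply: eq_bigr => i _; rewrite mulrCA.
have e2 : \sum_(i | i \notin T) v ord0 (lift ord0 i) * (u ord0 ord0 * Phi a.+1 (i |: T)%SET) =
  \sum_(i | i \notin T) u ord0 ord0 * (v ord0 (lift ord0 i) * Phi a.+1 (i |: T)%SET).
  by apply: eq_bigr => i _; rewrite mulrCA.
rewrite e1 e2; ring.
Qed.

Lemma shift_ge0 v Phi : cone v -> (forall a T, 0 <= Phi a T) -> forall a T, 0 <= shift v Phi a T.
Proof.
move=> cv P0 a T; rewrite addr_ge0 ?mulr_ge0// ?cv//.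
by apply: sumr_ge0 => i _; rewrite mulr_ge0// cv.
Qed.

Lemma le_shift v Phi Psi : cone v -> (forall a T, Phi a T <= Psi a T) ->
  forall a T, shift v Phi a T <= shift v Psi a T.
Proof.
move=> cv P0 a T; rewrite lerD ?ler_wpM2l// ?cv//.
by apply: ler_sum => i _; rewrite ler_wpM2l// cv.
Qed.

(** The falling factorial counts the injections of S into the m equal slots; the other slots
    contribute copies of K. *)
Lemma iter_shift m v Phi a T : iter m (shift v) Phi a T =
  \sum_(S : {set 'I_N} | S \subset (~: T)%SET)
    (\prod_(i in S) v ord0 (lift ord0 i)) *
    ((m ^_ #|S|)%:R * v ord0 ord0 ^+ (m - #|S|) * Phi (a + (m - #|S|))%N (T :|: S)%SET).
Proof.
elim: m a T => [|m IH] a T.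
  rewrite (bigD1 finset.set0) ?finset.sub0set//= finset.cards0 ffactn0 expr0 addn0 finset.setU0.
  rewrite finset.big_set0 !mul1r big1 ?addr0// => S /andP[_ S0].
  by rewrite ffact_small ?card_gt0 ?mul0r ?mulr0// finset.card_gt0.
rewrite iterS {1}/shift IH.
pose g := fun i => v ord0 (lift ord0 i).
pose h (S : {set 'I_N}) := (m ^_ #|S|.-1)%:R * v ord0 ord0 ^+ (m.+1 - #|S|) * Phi (a + (m.+1 - #|S|))%N (T :|: S)%SET.
have -> : \sum_(i | i \notin T) v ord0 (lift ord0 i) * iter m (shift v) Phi a (i |: T)%SET =
   \sum_(S : {set 'I_N} | S \subset (~: T)%SET) #|S|%:R * ((\prod_(j in S) g j) * h S).
  rewrite -sum_setU1_card; apply: eq_big => [i|i iT]; first by rewrite finset.in_setC.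
  rewrite IH; congr (_ * _); apply: eq_big => [S|S].
    by rewrite finset.setCU finset.subsetI andbC subset_setC1.
  rewrite finset.setCU finset.subsetI subset_setC1 => /andP[iS _].
  by rewrite /h finset.cardsU1 iS add1n /= subSS [(i |: T)%SET]finset.setUC finset.setUA.
rewrite mulr_sumr -big_split /=; apply: eq_bigr => S _.
rewrite -/g (mulrCA (v _ _)) (mulrCA #|S|%:R) -mulrDr; congr (_ * _).
rewrite /h; case: (leqP #|S| m) => Sm.
  rewrite addSnnS -subSn// subSn// exprS.
  have -> : (m.+1 ^_ #|S|)%:R = (m ^_ #|S|)%:R + #|S|%:R * (m ^_ #|S|.-1)%:R :> R.
    rewrite -natrM -natrD; congr _%:R.
    case: #|S| Sm => [|c] cm; first by rewrite !ffactn0.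
    by rewrite ffactSS ffactnSr /= (mulnC c.+1) -mulnDr mulnC; congr (_ * _)%N; lia.
  by ring.
rewrite ffact_small// !mul0r mulr0 add0r.
have [Sm1|Sm1] := leqP #|S| m.+1.
  have -> : #|S| = m.+1 by apply/eqP; rewrite eqn_leq Sm1.
  by rewrite /= ffactSS natrM !mulrA.
by rewrite ![(_ ^_ _)%N]ffact_small ?mul0r ?mulr0//; lia.
Qed.

(** The derivative of the volume polynomial of x K + sum t_i [0, y_i], taken a times in x and once
    in each variable of T. That polynomial is homogeneous of degree n, and derivatives of order n
    are constants. *)
Definition form_coef K a T : R := if (a + #|T| == n)%N then a`!%:R * vol_coef Y K T else 0.

Definition mixed_form K (vs : seq E) : R := foldr shift (form_coef K) vs 0%N finset.set0.

Lemma mixed_form_lin K a x y s :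
  mixed_form K ((a *: x + y) :: s) = a * mixed_form K (x :: s) + mixed_form K (y :: s).
Proof.
rewrite /mixed_form /=; set X := foldr _ _ _.
have e : \sum_(i | i \notin finset.set0) (a *: x + y) ord0 (lift ord0 i) * X 0%N (i |: finset.set0)%SET =
  a * (\sum_(i | i \notin finset.set0) x ord0 (lift ord0 i) * X 0%N (i |: finset.set0)%SET) +
  \sum_(i | i \notin finset.set0) y ord0 (lift ord0 i) * X 0%N (i |: finset.set0)%SET.
  rewrite mulr_sumr -big_split; apply: eq_bigr => i _ /=.
  by rewrite !mxE mulrDl mulrA.
by rewrite /shift e !mxE; ring.
Qed.

Lemma mixed_form_perm K s s' : perm_eq s s' -> mixed_form K s = mixed_form K s'.
Proof.
have comm1 Phi x (s1 : seq E) : foldr shift (shift x Phi) s1 = shift x (foldr shift Phi s1).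
  by elim: s1 => //= y s1 ->; rewrite shiftC.
have comm Phi s1 s2 : foldr shift (foldr shift Phi s1) s2 = foldr shift (foldr shift Phi s2) s1.
  by elim: s1 => //= x s1 <-; rewrite comm1.
apply: catCA_perm_subst => s1 s2 s3.
by rewrite /mixed_form !foldr_cat comm.
Qed.

(** The algebraic form of the fact that volume is affine in the length of each segment. *)
Lemma mixed_form_segment K i s :
  mixed_form K [:: delta_mx ord0 (lift ord0 i), delta_mx ord0 (lift ord0 i) & s] = 0.
Proof.
have sE Phi a T : shift (delta_mx ord0 (lift ord0 i)) Phi a T =
    if i \in T then 0 else Phi a (i |: T)%SET.
  rewrite /shift mxE /= mul0r add0r.
  case: ifPn => iT.
    rewrite big1// => j jT; rewrite mxE eqxx /= (inj_eq lift_inj).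
    by rewrite (_ : (j == i) = false) ?mul0r//; apply: contraNF jT => /eqP->.
  rewrite (bigD1 i)//= mxE !eqxx mul1r big1 ?addr0// => j /andP[_ ji].
  by rewrite mxE eqxx /= (inj_eq lift_inj) (negPf ji) mul0r.
by rewrite /mixed_form /= !sE finset.in_set0 finset.setU11.
Qed.

Section Body.
Variable K : set 'rV[R]_n.
Hypotheses (bK : body K) (K0 : K !=set0).
Local Notation F := (mixed_form K).
Let FD := FD (mixed_form_lin K).
Let Flin := mixed_form_lin K.
Let Fperm := @mixed_form_perm K.

Lemma form_coef_ge0 a T : 0 <= form_coef K a T.
Proof. by rewrite /form_coef; case: ifP => // _; rewrite mulr_ge0// vol_coef_ge0. Qed.

Lemma mixed_form_ge0 vs : (forall v, v \in vs -> cone v) -> 0 <= F vs.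
Proof.
move=> cv; suff h a T : 0 <= foldr shift (form_coef K) vs a T by exact: h.
elim: vs cv a T => [|v vs IH] cv a T /=; first exact: form_coef_ge0.
apply: shift_ge0; first by apply: cv; rewrite mem_head.
by apply: IH => w wvs; apply: cv; rewrite inE wvs orbT.
Qed.

Definition body_of (v : E) := minksum (mscal (@vhead R N v) K) (zono Y (@vtail R N v)).

Lemma vheadE (v : E) : @vhead R N v = v ord0 ord0.
Proof. by []. Qed.

Lemma body_body_of v : body (body_of v).
Proof. by apply: body_minksum; [exact: body_mscal|exact: body_zono]. Qed.

Lemma mixed_form_diag v : cone v -> 0 < v ord0 ord0 -> F (nseq n v) = n`!%:R * vol (body_of v).
Proof.
move=> cv v0; set x := v ord0 ord0 in v0.
have xn : x != 0 by rewrite gt_eqF.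
have -> : F (nseq n v) = iter n (shift v) (form_coef K) 0%N finset.set0.
  rewrite /mixed_form; suff h m : foldr shift (form_coef K) (nseq m v) = iter m (shift v) (form_coef K) by rewrite h.
  by elim: m => //= m ->.
rewrite iter_shift; pose t := x^-1 *: @vtail R N v.
have tn : nneg t by move=> i; rewrite mxE mulr_ge0 ?invr_ge0 ?(ltW v0)// vtailE; exact: cv.
have -> : body_of v = mscal x (minksum K (zono Y t)).
  have vE : @vtail R N v = x *: t by rewrite scalerA mulfV// scale1r.
  rewrite /body_of vheadE -/x vE (zono_mscal Y t v0).
  apply/seteqP; split=> [_ [_ [_ [[k Kk <-] [z Zz <-] ->]]]|_ [_ [k [z [Kk Zz ->]]] <-]].
    by exists (k + z); [exists k, z|rewrite scalerDr].
  by exists (x *: k), (x *: z); split; [exists k|exists z|rewrite scalerDr].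
rewrite vol_mscal ?ltW//; last 2 first.
- exact: (body_minksum bK (body_zono _ _)).1.
- have [k Kk] := K0; have [z Zz] := zono_neq0 Y tn; by exists (k + z), k, z.
rewrite (vol_coefE _ bK tn) !mulr_sumr; apply: eq_big => [S|S _].
  by rewrite finset.setC0 finset.subsetT.
rewrite finset.set0U add0n /form_coef; case: (leqP #|S| n) => Sn; last first.
  by rewrite ffact_small// vol_coef_eq0// !(mul0r, mulr0).
rewrite subnK// eqxx -/x.
have -> : \prod_(i in S) t ord0 i = x ^- #|S| * \prod_(i in S) v ord0 (lift ord0 i).
  rewrite (eq_bigr (fun i => x^-1 * v ord0 (lift ord0 i))); last by move=> i _; rewrite mxE vtailE.
  by rewrite big_split /= prodr_const exprVn.
have -> : x ^+ n = x ^+ (n - #|S|) * x ^+ #|S| by rewrite -exprD subnK.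
rewrite -(ffact_fact Sn) natrM.
have xs : x ^+ #|S| != 0 by rewrite expf_neq0.
by field.
Qed.

Let e (i : 'I_N.+1) : E := delta_mx ord0 i.
Let P := [pred i : 'I_N.+1 | i != ord0].

Lemma mixed_form_seg i s : P i -> F [:: e i, e i & s] = 0.
Proof.
by rewrite /P /=; case: (unliftP ord0 i) => [j ->|->]; rewrite ?eqxx// => _; exact: mixed_form_segment.
Qed.

(* Brunn-Minkowski for the mixed volumes with the segments of [l]: the top
   coefficient of the inequality for [body_of (v + r * sum_l e i)] as
   [r -> +oo]. *)
Lemma mixed_form_lead (l : seq 'I_N.+1) v m s : all P l -> exists p : {poly R},
  (forall x, x != 0 -> p.[x] = x ^+ size l * F (nseq m (v + \sum_(i <- l) x^-1 *: e i) ++ s)) /\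
  p.[0] = (m ^_ size l)%:R * F (nseq (m - size l) v ++ map e l ++ s).
Proof.
elim: l m s => [|i l IH] m s /=.
  exists (F (nseq m v ++ s))%:P; split; last by rewrite hornerC ffactn0 mul1r subn0.
  by move=> x _; rewrite hornerC big_nil addr0 mul1r.
move=> /andP[Pi Pl]; have [p0 [p0E p00]] := IH m s Pl.
have [p1 [p1E p10]] := IH m.-1 (e i :: s) Pl.
exists ('X * p0 + m%:R%:P * p1); split.
  move=> x x0; rewrite !hornerE p0E// p1E// big_cons [x^-1 *: e i + _]addrC addrA.
  rewrite (FnseqD Flin Fperm mixed_form_seg)// exprS.
  by field.
rewrite !hornerE p10 ?mul0r ?add0r mulrA -natrM; case: m {p0 p0E p00 p1 p1E p10} => [|m].
  by rewrite mul0n ffact_small// !mul0r.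
rewrite ffactSS subSS; congr (_ * _).
by apply: Fperm; apply/permP => ?; rewrite !count_cat /= !count_cat /=; ring.
Qed.

Lemma mixed_form_sqr (v z : E) m s : exists p : {poly R}, forall h,
  F (nseq m (v + h *: z) ++ s) = F (nseq m v ++ s) + h * (m%:R * F (z :: nseq m.-1 v ++ s))
    + h ^+ 2 * ('C(m, 2)%:R * F [:: z, z & nseq m.-2 v ++ s]) + h ^+ 3 * p.[h].
Proof.
elim: m s => [|m IH] s.
  by exists 0 => h; rewrite bin0n hornerC !mul0r !mulr0 !addr0.
have [p hp] := IH (v :: s); have [q hq] := IH (z :: s).
exists (p + 'X * q + ('C(m, 2)%:R * F [:: z, z & nseq m.-2 v ++ z :: s])%:P) => h.
have -> : F (nseq m.+1 (v + h *: z) ++ s) =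
    F (nseq m (v + h *: z) ++ v :: s) + h * F (nseq m (v + h *: z) ++ z :: s).
  by rewrite !(Fmid Fperm) -(FZ Flin) -FD.
rewrite hp hq !hornerE binS bin1 natrD -[m.+1%:R]natr1.
have -> : F (nseq m v ++ v :: s) = F (nseq m.+1 v ++ s) by rewrite (Fmid Fperm).
have -> : F (nseq m v ++ z :: s) = F (z :: nseq m v ++ s) by rewrite (Fmid Fperm).
case: m {IH hp hq} => [|m] /=.
  by rewrite (_ : 'C(0, 2) = 0%N)// !mul0r; ring.
have -> : F (z :: nseq m v ++ v :: s) = F (z :: v :: nseq m v ++ s) by perm_count Fperm.
have -> : F (z :: nseq m v ++ z :: s) = F [:: z, z & nseq m v ++ s] by perm_count Fperm.
case: m => [|m] /=.
  by rewrite (_ : 'C(1, 2) = 0%N)// !mul0r; ring.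
have -> : F [:: z, z & nseq m v ++ v :: s] = F [:: z, z, v & nseq m v ++ s] by perm_count Fperm.
ring.
Qed.

Lemma body_of_mid (v w : E) : cone v -> cone w ->
  minksum (mscal 2^-1 (body_of v)) (mscal 2^-1 (body_of w)) `<=` body_of (2^-1 *: (v + w)).
Proof.
move=> cv cw _ [_ [_ [[_ [_ [_ [[k Kk <-] [s sP <-] ->]]] <-] [_ [_ [_ [[k' Kk' <-] [s' sP' <-] ->]]] <-] ->]]].
exists (2^-1 *: (v ord0 ord0 *: k + w ord0 ord0 *: k')), ((2^-1 *: (s + s')) *m Y); split.
- rewrite vheadE; set a := v ord0 ord0; set b := w ord0 ord0.
  have a0 : 0 <= a := cv _; have b0 : 0 <= b := cw _.
  have [ab|ab] := eqVneq (a + b) 0.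
    have a00 : a = 0 by lra. have b00 : b = 0 by lra.
    exists k => //; rewrite !mxE -/a -/b a00 b00 !scale0r !addr0 mulr0 scale0r scaler0//.
  have abp : 0 < a + b by rewrite lt_neqAle eq_sym ab addr_ge0.
  exists ((a / (a + b)) *: k + (b / (a + b)) *: k').
    by apply: bK.2 => //; rewrite ?divr_ge0// ?ltW// -mulrDl divff.
  rewrite !mxE -/a -/b scalerDr !scalerA scalerDr !scalerA.
  by congr (_ *: _ + _ *: _); field.
- exists (2^-1 *: (s + s')) => // i; rewrite vtailE !mxE.
  have /andP[h1 h2] := sP i; have /andP[h3 h4] := sP' i; rewrite !vtailE in h2 h4.
  apply/andP; split; lra.
- by rewrite -!scalemxAl mulmxDl !vheadE !scalerDr addrACA.
Qed.

Lemma mixed_form_bm (v w : E) : cone v -> cone w -> 0 < v ord0 ord0 -> 0 < w ord0 ord0 ->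
  F (nseq n v) * F (nseq n w) <= F (nseq n (2^-1 *: (v + w))) ^+ 2.
Proof.
move=> cv cw v0 w0; have cm : cone (2^-1 *: (v + w)).
  by move=> i; rewrite !mxE mulr_ge0// addr_ge0// ?cv ?cw.
have m0 : 0 < (2^-1 *: (v + w)) ord0 ord0 by rewrite !mxE mulr_gt0// addr_gt0.
rewrite !mixed_form_diag// mulrACA exprMn -expr2 ler_wpM2l ?sqr_ge0//.
have ne u : cone u -> body_of u !=set0.
  move=> cu; have [k Kk] := K0.
  have tn : nneg (@vtail R N u) by move=> i; rewrite vtailE; exact: cu.
  have [z Zz] := zono_neq0 Y tn; exists (@vhead R N u *: k + z), (@vhead R N u *: k), z.
  by split=> //; exists k.
apply: le_trans (brunn_minkowski (body_body_of v) (body_body_of w) (ne _ cv) (ne _ cw)) _.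
rewrite ler_pXn2r// ?nnegrE ?vol_ge0//; apply: le_vol; last exact: body_of_mid.
  by apply: (body_minksum _ _).1; apply: body_mscal; exact: body_body_of.
exact: (body_body_of _).1.
Qed.

(** Brunn-Minkowski for k + h z and k - h z, with the segments of [l] made infinitely long by
    [mixed_form_lead], bounds the product of the two mixed values by the square of the value at k.
    For z orthogonal to k the linear terms vanish, and the coefficient of h^2 gives nonpositivity at
    z. *)
Lemma mixed_form_base (k : E) : (forall i, 0 < k ord0 i) ->
  forall m (l : seq 'I_N.+1), all P l -> (m + size l + 2 = n)%N ->
  lorentzian (fun x y => F [:: x, y & nseq m k ++ map e l]).
Proof.
move=> k0 m l Pl sz; have ck : cone k by move=> i; exact: ltW.
have bH := bilinF Flin Fperm (nseq m k ++ map e l).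
pose a0 := F [:: k, k & nseq m k ++ map e l].
have a00 : 0 <= a0.
  apply: mixed_form_ge0 => v; rewrite !inE mem_cat => /or4P[/eqP->|/eqP->|/nseqP[->]|/mapP[i _ ->]]//.
  exact: cone_delta.
move: a00; rewrite le_eqVlt => /orP[/eqP a00|a00]; last first.
  apply: (lorentzian_orthP bH a00) => z zk.
  have k1 : 0 < \sum_i `|z ord0 i| / k ord0 i + 1.
    by apply: ltr_wpDl => //; apply: sumr_ge0 => i _; rewrite divr_ge0// ltW.
  (* For h < h0 both k + h z and k - h z stay in the open cone. *)
  pose h0 := (\sum_i `|z ord0 i| / k ord0 i + 1)^-1.
  have h00 : 0 < h0 by rewrite invr_gt0.
  have pos h : 0 < h -> h < h0 -> forall i, 0 < (k + h *: z) ord0 i /\ 0 < (k + (- h) *: z) ord0 i.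
    move=> hp hh i; rewrite !mxE.
    have ki := k0 i.
    have zi : `|z ord0 i| / k ord0 i < h^-1.
      have : h0^-1 < h^-1 by rewrite ltf_pV2 ?posrE.
      apply: le_lt_trans; rewrite invrK (bigD1 i)//= -addrA lerDl addr_ge0//.
      by apply: sumr_ge0 => j _; rewrite divr_ge0// ltW.
    have : h * `|z ord0 i| < k ord0 i.
      by move: zi; rewrite ltr_pdivrMr// -ltr_pdivlMl ?invr_gt0// invrK.
    by have := ler_norm (z ord0 i); have := ler_norm (- z ord0 i); rewrite normrN; split; nra.
  have szl : (n - size l = m.+2)%N by lia.
  have [p hp] := mixed_form_sqr k z m.+2 (map e l).
  set a2 := F [:: z, z & nseq m k ++ map e l] in hp *.
  have a1 : F (z :: nseq m.+1 k ++ map e l) = 0 by [].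
  rewrite /= a1 mulr0 in hp.
  pose c := 'C(m.+2, 2)%:R * a2.
  have main h : 0 < h -> h < h0 ->
      F (nseq m.+2 (k + h *: z) ++ map e l) * F (nseq m.+2 (k + (- h) *: z) ++ map e l) <= a0 ^+ 2.
    move=> hp1 hh; have ph := pos h hp1 hh.
    have [pa [paE pa0]] := mixed_form_lead (k + h *: z) n [::] Pl.
    have [pb [pbE pb0]] := mixed_form_lead (k + (- h) *: z) n [::] Pl.
    have [pc [pcE pc0]] := mixed_form_lead k n [::] Pl.
    have lim : pa.[0] * pb.[0] + -1 * pc.[0] ^+ 2 <= 0.
      have ip (q : {poly R}) : ispoly (fun x => q.[x]) by exists q.
      apply: (ispoly_le0 (ispolyD (ispolyM (ip pa) (ip pb)) (ispolyM (ispoly_cst (-1)) (ispolyX 2 (ip pc)))) ltr01).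
      move=> x x0 _; have xn : x != 0 by rewrite gt_eqF.
      rewrite mulN1r subr_le0 paE// pbE// pcE// !cats0 mulrACA exprMn -expr2 ler_wpM2l ?sqr_ge0//.
      have sl j : 0 <= (\sum_(i <- l) x^-1 *: e i) ord0 j.
        rewrite summxE; apply: sumr_ge0 => i _; by rewrite !mxE mulr_ge0 ?invr_ge0 ?(ltW x0)// ler0n.
      have := @mixed_form_bm (k + h *: z + \sum_(i <- l) x^-1 *: e i) (k + (- h) *: z + \sum_(i <- l) x^-1 *: e i).
      have -> : 2^-1 *: (k + h *: z + \sum_(i <- l) x^-1 *: e i + (k + (- h) *: z + \sum_(i <- l) x^-1 *: e i)) =
          k + \sum_(i <- l) x^-1 *: e i.
        set L := \sum_(i <- l) _; by apply/rowP => j; rewrite !mxE; field.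
      apply.
      + by move=> j; rewrite mxE addr_ge0// ltW// (ph j).1.
      + by move=> j; rewrite mxE addr_ge0// ltW// (ph j).2.
      + by rewrite mxE ltr_wpDr// (ph ord0).1.
      + by rewrite mxE ltr_wpDr// (ph ord0).2.
    move: lim; rewrite pa0 pb0 pc0 !cats0 szl mulN1r subr_le0 mulrACA exprMn -expr2.
    by rewrite ler_pM2l// exprn_gt0// ltr0n ffact_gt0; lia.
  have lim : 2 * (a0 * c) + 0 <= 0.
    pose f h := 2 * (a0 * c) + (h * (a0 * p.[h]) + (h * (- a0 * p.[- h]) +
       (h ^+ 2 * (c + h * p.[h]) * (c + - h * p.[- h])))).
    have f0 : f 0 = 2 * (a0 * c) + 0 by rewrite /f expr0n /= !mul0r !addr0.
    rewrite -f0; apply: (ispoly_le0 _ h00) => [|h hp1 hh].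
      exists ((2 * (a0 * c))%:P + ('X * (a0%:P * p) + ('X * ((- a0)%:P * (p \Po (- 'X))) +
        ('X ^+ 2 * (c%:P + 'X * p) * (c%:P + - 'X * (p \Po (- 'X))))))) => h.
      by rewrite /f !hornerE ?horner_comp ?hornerE.
    have hn : h != 0 by rewrite gt_eqF.
    have := main h hp1 hh; rewrite !hp -/a0 -/c => le.
    have h2 : 0 < h ^+ 2 by exact: exprn_gt0.
    rewrite -(pmulr_rle0 _ h2) /f -subr_le0 -[X in _ <= X](subrr (a0 ^+ 2)).
    move: le; rewrite -subr_le0 => le; rewrite subrr subr0; apply: le_trans le.
    by rewrite le_eqVlt; apply/orP; left; apply/eqP; rewrite /a0 /=; ring.
  have c0 : c <= 0 by move: lim; rewrite addr0 pmulr_rle0// pmulr_rle0.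
  by move: c0; rewrite /c pmulr_rle0// ltr0n bin_gt0.
(* The case a0 = 0: by [Fzero] the form vanishes identically and has no positive vector. *)
move=> x y xx; exfalso; move: xx; rewrite ltNge => /negP; apply.
rewrite (_ : F _ = 0)//.
apply: (@Fzero _ _ F Flin Fperm n k _ k0 m.+2 l _ _ [:: x, x & nseq m k]) => //.
- by move=> s _; apply: mixed_form_ge0 => v /mapP[i _ ->]; exact: cone_delta.
- by rewrite -sz; lia.
- by rewrite /= size_nseq.
Qed.

(** n! times the mixed volume of a copies of the zonotope with lengths t and n - a copies of K. *)
Definition mixed_vol (t : 'rV[R]_N) a := F (nseq a (vcons (0, t)) ++ nseq (n - a) (vcons (1, 0))).

Let zE (t : 'rV[R]_N) : vcons (0, t) = \sum_(i <- enum P) vcons (0, t) ord0 i *: e i.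
Proof.
rewrite {1}(row_sum_delta (vcons (0, t))) big_enum /= [LHS](bigD1 ord0)//=.
have -> : vcons (0, t) ord0 ord0 = 0 by rewrite -vheadE vcons_head.
by rewrite scale0r add0r; apply: eq_bigl => i; rewrite inE.
Qed.

Lemma cone_vcons x (t : 'rV[R]_N) : 0 <= x -> nneg t -> cone (vcons (x, t)).
Proof.
move=> x0 t0 i; case: (unliftP ord0 i) => [j ->|->]; first by rewrite vcons_lift.
by rewrite -vheadE vcons_head.
Qed.

Lemma mixed_vol_logconcave t a : nneg t -> (a + 2 <= n)%N ->
  mixed_vol t a * mixed_vol t a.+2 <= mixed_vol t a.+1 ^+ 2.
Proof.
move=> t0 an; have n0 : nneg (0 : 'rV[R]_N) by move=> i; rewrite mxE.
have := @alexandrov_fenchel_zonotope R N.+1 n F Flin Fperm P _ mixed_form_seg mixed_form_base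
  (vcons (1, 0)) (vcons (0, t)) (enum P) (vcons (0, t) ord0) a (n - a.+2)
  (cone_vcons ler01 n0) _ (cone_vcons (lexx 0) t0) _ (zE t).
rewrite mulrC /mixed_vol.
have -> : (n - a = (n - a.+2).+2)%N by lia.
have -> : (n - a.+1 = (n - a.+2).+1)%N by lia.
apply.
- by move=> s _; apply: mixed_form_ge0 => v /mapP[i _ ->]; exact: cone_delta.
- by apply/allP => i; rewrite mem_enum.
- by lia.
Qed.

Lemma mixed_vol_ge0 t a : nneg t -> 0 <= mixed_vol t a.
Proof.
move=> t0; apply: mixed_form_ge0 => v; rewrite mem_cat => /orP[] /nseqP[-> _].
  exact: cone_vcons.
by apply: cone_vcons => // i; rewrite mxE.
Qed.

(** Steiner's formula with a zonotope in place of the ball: [mixed_form_diag] at (1, x t), expanded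
    binomially over its n equal slots. *)
Lemma vol_zono_steiner t x : nneg t -> 0 <= x ->
  vol (minksum K (zono Y (x *: t))) = \sum_(a < n.+1) ('C(n, a)%:R / n`!%:R * mixed_vol t a) * x ^+ a.
Proof.
move=> t0 x0; pose v := vcons (1, x *: t).
have nx : nneg (x *: t) by move=> i; rewrite mxE mulr_ge0.
have v1 : v ord0 ord0 = 1 by rewrite -vheadE vcons_head.
have := mixed_form_diag (cone_vcons ler01 nx); rewrite -/v v1 => /(_ ltr01).
have -> : body_of v = minksum K (zono Y (x *: t)).
  rewrite /body_of /v vcons_head vcons_tail; congr minksum.
  by apply/seteqP; split=> [_ [k Kk <-]|k Kk]; rewrite ?scale1r//; exists k; rewrite ?scale1r.
have -> : v = vcons (1, 0) + x *: vcons (0, t) by rewrite vconsZ vconsD mulr0 addr0 add0r.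
have expand m s : F (nseq m (vcons (1, 0) + x *: vcons (0, t)) ++ s) =
    \sum_(a < m.+1) 'C(m, a)%:R * x ^+ a * F (nseq a (vcons (0, t)) ++ nseq (m - a) (vcons (1, 0)) ++ s).
  elim: m s => [|m IH] s.
    by rewrite big_ord1 bin0 expr0 !mul1r.
  have -> : F (nseq m.+1 (vcons (1, 0) + x *: vcons (0, t)) ++ s) =
    F (nseq m (vcons (1, 0) + x *: vcons (0, t)) ++ vcons (1, 0) :: s) +
      x * F (nseq m (vcons (1, 0) + x *: vcons (0, t)) ++ vcons (0, t) :: s).
    by rewrite !(Fmid Fperm) -(FZ Flin) -FD.
  rewrite !IH mulr_sumr big_ord_recl [in RHS]big_ord_recl.
  rewrite [X in _ + X]big_ord_recr [in RHS]big_ord_recr /=.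
  rewrite !bin0 !expr0 !mul1r !subn0 !binn subnn /=.
  have -> : F (nseq m (vcons (1, 0)) ++ vcons (1, 0) :: s) = F (vcons (1, 0) :: nseq m (vcons (1, 0)) ++ s) by rewrite (Fmid Fperm).
  move: (F (vcons (1, 0) :: nseq m (vcons (1, 0)) ++ s)) => A0.
  rewrite -!(addrA A0); apply: (congr1 (+%R A0)); rewrite addrA; congr (_ + _); last first.
    have -> : bump 0 m = m.+1 by [].
    have -> : F (nseq m (vcons (0, t)) ++ vcons (0, t) :: s) = F (vcons (0, t) :: nseq m (vcons (0, t)) ++ s).
      by rewrite (Fmid Fperm).
    by rewrite add0n subnn exprS /=; ring.
  rewrite -big_split /=; apply: eq_bigr => i _; rewrite /bump /= !add1n !add0n binS natrD subSS.
  have -> : F (nseq i.+1 (vcons (0, t)) ++ nseq (m - i.+1) (vcons (1, 0)) ++ vcons (1, 0) :: s) =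
     F (nseq i.+1 (vcons (0, t)) ++ nseq (m - i) (vcons (1, 0)) ++ s).
    have -> : (m - i = (m - i.+1).+1)%N by have := ltn_ord i; lia.
    by perm_count Fperm.
  have -> : F (nseq i (vcons (0, t)) ++ nseq (m - i) (vcons (1, 0)) ++ vcons (0, t) :: s) =
     F (nseq i.+1 (vcons (0, t)) ++ nseq (m - i) (vcons (1, 0)) ++ s) by perm_count Fperm.
  by rewrite exprS; ring.
have := expand n [::]; rewrite cats0 => ->.
have fn : n`!%:R != 0 :> R by rewrite pnatr_eq0 -lt0n fact_gt0.
move=> e0; apply: (mulfI fn); rewrite -e0 mulr_sumr; apply: eq_bigr => a _.
by rewrite cats0 /mixed_vol; field.
Qed.

End Body.

Lemma le_mixed_vol K K' t a : body K -> body K' -> K `<=` K' -> nneg t ->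
  mixed_vol K t a <= mixed_vol K' t a.
Proof.
move=> bK bK' KK' t0; rewrite /mixed_vol.
have n0 : nneg (0 : 'rV[R]_N) by move=> i; rewrite mxE.
have le (vs : seq E) : (forall v, v \in vs -> cone v) -> mixed_form K vs <= mixed_form K' vs.
  move=> cv; suff h b T : foldr shift (form_coef K) vs b T <= foldr shift (form_coef K') vs b T by exact: h.
  elim: vs cv b T => [|v vs IH] cv b T /=.
    by rewrite /form_coef; case: ifP => // _; rewrite ler_wpM2l//; exact: le_vol_coef.
  apply: le_shift; first by apply: cv; rewrite mem_head.
  by apply: IH => w wvs; apply: cv; rewrite inE wvs orbT.
apply: le => v; rewrite mem_cat => /orP[] /nseqP[-> _]; exact: cone_vcons.
Qed.

End MixedVolumeForm.

(** * Reflections *)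

Section Reflections.
Context {R : realType} {n : nat}.
Implicit Types (u v w x y : 'rV[R]_n).

(** For w = 0 the quotient is 0 and the reflection is the identity, so that the lemmas hold for
    every w. *)
Definition refl w x : 'rV[R]_n := x - (2 * dot x w / dot w w) *: w.
Definition refl_mx w : 'M[R]_n := 1%:M - (2 / dot w w) *: (w^T *m w).

Lemma refl_mxE w x : x *m refl_mx w = refl w x.
Proof.
rewrite /refl_mx mulmxBr mulmx1 -scalemxAr mulmxA /refl; congr (_ - _).
have -> : x *m w^T = (dot x w)%:M.
  apply/matrixP => i j; rewrite !ord1 !mxE eqxx mulr1n; apply: eq_bigr => k _.
  by rewrite mxE.
by rewrite mul_scalar_mx scalerA; congr (_ *: _); ring.
Qed.

Lemma dot_refl w x y : dot (refl w x) (refl w y) = dot x y.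
Proof.
rewrite /refl !(dotBl, dotBr, dotZl, dotZr) (dotC w y).
have [w0|w0] := eqVneq (dot w w) 0; first by rewrite w0 invr0 !mulr0 !mul0r !subr0.
by field.
Qed.

Lemma dot_reflC w x y : dot (refl w x) y = dot x (refl w y).
Proof. by rewrite /refl !(dotBl, dotBr, dotZl, dotZr) (dotC w y); ring. Qed.

Lemma reflB w x y : refl w (x - y) = refl w x - refl w y.
Proof. by apply/rowP => i; rewrite /refl !mxE dotBl; ring. Qed.

Lemma refl_swap u v : dot u u = dot v v -> refl (u - v) u = v.
Proof.
move=> uv; rewrite /refl.
have e : dot (u - v) (u - v) = 2 * dot u (u - v) by rewrite !(dotBl, dotBr) -uv (dotC v u); ring.
rewrite e; have [z|z] := eqVneq (2 * dot u (u - v)) 0.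
  have /eqP : dot (u - v) (u - v) = 0 by rewrite e.
  by rewrite dot_eq0 => /eqP uv0; rewrite uv0 scaler0 subr0; apply/eqP; rewrite -subr_eq0 uv0.
by rewrite divff// scale1r opprB addrC subrK.
Qed.

Lemma reflK w x : refl w (refl w x) = x.
Proof.
have [w0|w0] := eqVneq (dot w w) 0.
  by rewrite /refl w0 invr0 !mulr0 !scale0r !subr0.
apply/rowP => i; rewrite /refl !(dotBl, dotZl) !mxE; field.
exact: w0.
Qed.

Lemma refl_mx_orth w : refl_mx w *m (refl_mx w)^T = 1%:M.
Proof.
have -> : (refl_mx w)^T = refl_mx w.
  by rewrite /refl_mx linearB /= linearZ /= trmx_mul trmxK trmx1.
apply/row_matrixP => i; rewrite !rowE mulmxA !refl_mxE reflK.
by rewrite mulmx1.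
Qed.

End Reflections.

(** * Zonotopes of almost constant width *)

Section SymmetrizedZonotopes.
Context {R : realType} {n : nat}.
Implicit Types (u v w x g : 'rV[R]_n) (L : seq 'rV[R]_n).

Definition enorm x : R := Num.sqrt (dot x x).

Lemma enorm_ge0 x : 0 <= enorm x. Proof. exact: sqrtr_ge0. Qed.
Lemma enorm_sqr x : enorm x ^+ 2 = dot x x. Proof. by rewrite sqr_sqrtr// dot_ge0. Qed.
Lemma enormZ a x : enorm (a *: x) = `|a| * enorm x.
Proof. by rewrite /enorm dotZl dotZr mulrA -expr2 sqrtrM ?sqr_ge0// sqrtr_sqr. Qed.
Lemma enorm_refl w x : enorm (refl w x) = enorm x. Proof. by rewrite /enorm dot_refl. Qed.
Lemma dot_le_enorm x y : `|dot x y| <= enorm x * enorm y.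
Proof.
rewrite -ler_sqr ?nnegrE ?mulr_ge0 ?enorm_ge0// exprMn !enorm_sqr real_normK ?num_real//.
exact: cauchy_schwarz.
Qed.

(** The support function at u of the zonotope sum of the segments [-g, g]; [weight] is a Lipschitz
    constant for it. *)
Definition width L u : R := \sum_(g <- L) `|dot g u|.
Definition weight L : R := \sum_(g <- L) enorm g.

Lemma width_lip L u v : width L u <= width L v + weight L * enorm (u - v).
Proof.
rewrite /width /weight mulr_suml -big_split /=; apply: ler_sum => g _.
have := dot_le_enorm g (u - v); rewrite dotBr => h.
by have := ler_normD (dot g u - dot g v) (dot g v); rewrite subrK; lra.
Qed.

Lemma width_unit L u : dot u u = 1 -> width L u <= weight L.
Proof.
move=> u1; apply: ler_sum => g _; have := dot_le_enorm g u.
by rewrite {2}/enorm u1 sqrtr1 mulr1.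
Qed.

Definition symmetrize w L := map (fun g => 2^-1 *: g) (L ++ map (refl w) L).

Lemma width_symmetrize w L u : width (symmetrize w L) u = 2^-1 * (width L u + width L (refl w u)).
Proof.
rewrite /width /symmetrize big_map big_cat big_map /= mulrDr !mulr_sumr.
by congr (_ + _); apply: eq_bigr => g _; rewrite dotZl normrM ger0_norm// dot_reflC.
Qed.

Lemma weight_symmetrize w L : weight (symmetrize w L) = weight L.
Proof.
rewrite /weight /symmetrize big_map big_cat big_map /=.
have e (h : 'rV[R]_n -> 'rV[R]_n) : (forall g, enorm (h g) = enorm g) ->
    \sum_(g <- L) enorm (2^-1 *: h g) = 2^-1 * \sum_(g <- L) enorm g.
  by move=> he; rewrite mulr_sumr; apply: eq_bigr => g _; rewrite enormZ ger0_norm// he.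
rewrite (e id)// (e (refl w)); last by move=> g; exact: enorm_refl.
by field.
Qed.

(** Both bounds hold for the standard basis and survive symmetrization. The first is a Lipschitz
    constant common to all lists, the second keeps the limiting width away from 0. *)
Definition admissible L := weight L <= n%:R /\ forall u, dot u u = 1 -> 1 <= width L u.

Lemma admissible_symmetrize w L : admissible L -> admissible (symmetrize w L).
Proof.
move=> [wL mL]; split=> [|u u1]; first by rewrite weight_symmetrize.
have := mL u u1; have := mL (refl w u); rewrite dot_refl => /(_ u1).
by rewrite width_symmetrize; lra.
Qed.

Lemma exists_admissible : exists L, admissible L.
Proof.
exists [seq delta_mx ord0 i | i <- enum 'I_n].
have dE (i : 'I_n) u : dot (delta_mx ord0 i) u = u ord0 i.
  rewrite /dot (bigD1 i)//= mxE !eqxx mul1r big1 ?addr0// => j ji.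
  by rewrite mxE eqxx (negPf ji) mul0r.
split=> [|u u1].
  rewrite /weight big_map (eq_bigr (fun=> 1)).
    by rewrite big_const_seq count_predT -cardE card_ord iter_addr addr0.
  by move=> i _; rewrite /enorm dE mxE !eqxx sqrtr1.
rewrite /width big_map big_enum /= -u1.
have ui i : `|u ord0 i| <= 1.
  rewrite -(@ler_pXn2r _ 2)// ?nnegrE// expr1n real_normK ?num_real// -u1.
  exact: coord_sqr_le_dot.
apply: ler_sum => i _; rewrite dE.
have := ui i; have := normr_ge0 (u ord0 i); have : u ord0 i * u ord0 i = `|u ord0 i| * `|u ord0 i|.
  by rewrite -expr2 -(real_normK (num_real (u ord0 i))) expr2.
by move=> ->; nra.
Qed.

Lemma compact_sphere : compact [set u : 'rV[R]_n | dot u u = 1].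
Proof.
have -> : [set u : 'rV[R]_n | dot u u = 1] = @unit_ball R n `&` [set u | 1 <= dot u u].
  apply/seteqP; split=> [u /= u1|u [/= a b]]; rewrite /unit_ball /= ?u1//.
  by apply/eqP; rewrite eq_le a b.
apply: compact_closedI; first exact: (body_unit_ball _).1.
by apply: closed_ge_continuous; exact: continuous_sqnorm.
Qed.

Lemma sphere_net r : 0 < r -> exists U : seq 'rV[R]_n,
  (forall u, u \in U -> dot u u = 1) /\
  forall u, dot u u = 1 -> exists2 v, v \in U & enorm (u - v) < r.
Proof.
move=> r0; have := compact_sphere; rewrite compact_cover => /(_ _ [set u : 'rV[R]_n | dot u u = 1]
  (fun v => [set u | dot (u - v) (u - v) < r ^+ 2])).
case=> [v _| |D Dsub Dcov].
- have cf : continuous (fun u : 'rV[R]_n => dot (u - v) (u - v)).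
    have -> : (fun u : 'rV[R]_n => dot (u - v) (u - v)) =
        (fun u => dot u u + (-2 * dot v u + dot v v)).
      by apply/funext => u; rewrite !(dotBl, dotBr) (dotC u v); ring.
    move=> u; apply: cvgD; first exact: continuous_sqnorm.
    apply: cvgD; last exact: cvg_cst.
    by apply: cvgM; [exact: cvg_cst|exact: continuous_dot].
  exact: (open_comp (fun x _ => cf x) (@open_lt R (r ^+ 2))).
- move=> u /= u1; exists u => //=; by rewrite subrr dot0l exprn_gt0.
exists (finmap.enum_fset D); split=> [u uD|u u1].
  by have := Dsub u uD; rewrite inE.
have [v vD /= uv] := Dcov u u1.
exists v => //; rewrite -ltr_sqr ?nnegrE ?enorm_ge0 ?(ltW r0)// enorm_sqr//.
Qed.

(* Repeatedly averaging [L] with its mirror images strictly lowers the maximal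
   width as long as the width is not constant on the sphere; the number of
   reflections needed only depends on the Lipschitz constant [n]. *)
Lemma symmetrize_net (U : seq 'rV[R]_n) L x r M eta :
  dot x x = 1 -> (forall u, u \in U -> dot u u = 1) -> admissible L ->
  (forall u, dot u u = 1 -> width L u <= M) ->
  (forall u, dot u u = 1 -> enorm (u - x) < r -> width L u <= M - eta) ->
  0 <= eta ->
  exists L', [/\ admissible L', forall u, dot u u = 1 -> width L' u <= M,
    forall u, dot u u = 1 -> enorm (u - x) < r -> width L' u <= M - eta / 2 ^+ size U &
    forall u v, dot u u = 1 -> v \in U -> enorm (u - v) < r -> width L' u <= M - eta / 2 ^+ size U].
Proof.
move=> x1 + aL LM Lx eta0; elim: U => [_|v U IH Uu].
  by exists L; split=> // u; rewrite expr0 divr1; exact: Lx.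
have [] := IH; first by move=> u uU; apply: Uu; rewrite inE uU orbT.
(* The reflection along v - x exchanges v and x, so averaging hands half of the gap near x on to the
   points near v; half of every gap obtained before survives. *)
move=> L' [aL' L'M L'x L'U]; exists (symmetrize (v - x) L').
have v1 : dot v v = 1 by apply: Uu; rewrite mem_head.
have p0 : 0 < 2 ^+ size U :> R by exact: exprn_gt0.
have eE : eta / 2 ^+ size (v :: U) = 2^-1 * (eta / 2 ^+ size U).
  by rewrite /= exprS invfM; ring.
have half u : dot u u = 1 -> width L' u <= M - eta / 2 ^+ size U \/
    width L' (refl (v - x) u) <= M - eta / 2 ^+ size U ->
    width (symmetrize (v - x) L') u <= M - eta / 2 ^+ size (v :: U).
  move=> u1 h; rewrite width_symmetrize eE.
  have := L'M u u1; have := L'M (refl (v - x) u); rewrite dot_refl => /(_ u1).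
  by case: h; lra.
split.
- exact: admissible_symmetrize.
- move=> u u1; rewrite width_symmetrize.
  have := L'M u u1; have := L'M (refl (v - x) u); rewrite dot_refl => /(_ u1); lra.
- by move=> u u1 ux; apply: half => //; left; exact: L'x.
- move=> u w u1; rewrite inE => /orP[/eqP->|wU] uw; apply: half => //.
    right; apply: L'x; first by rewrite dot_refl.
    have -> : refl (v - x) u - x = refl (v - x) (u - v).
      by rewrite reflB (refl_swap (etrans v1 (esym x1))).
    by rewrite enorm_refl.
  by left; exact: L'U uw.
Qed.

(** Here c is the infimum of the maximal width over admissible lists. A list that almost attains it
    is almost constant on the sphere: a low value somewhere would, by [symmetrize_net], produce an
    admissible list with maximum below the infimum. *)
Lemma admissible_near_constant : (0 < n)%N -> exists2 c : R, 1 <= c & forall delta, 0 < delta ->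
  exists2 L, admissible L & forall u, dot u u = 1 -> c - delta <= width L u <= c + delta.
Proof.
move=> n0; pose S := [set c : R | exists2 L, admissible L & forall u, dot u u = 1 -> width L u <= c].
have [x0 x01] : exists x : 'rV[R]_n, dot x x = 1.
  case: n n0 => // m _; exists (delta_mx ord0 ord0).
  rewrite /dot (bigD1 ord0)//= mxE !eqxx mul1r big1 ?addr0// => j ji.
  by rewrite mxE eqxx (negPf ji) mul0r.
have S1 c : S c -> 1 <= c by move=> [L [_ h] h']; exact: le_trans (h x0 x01) (h' x0 x01).
have iS : has_inf S.
  split; last by exists 1 => c /S1.
  have [L aL] := exists_admissible; exists (weight L), L => // u; exact: width_unit.
exists (inf S); first by apply: lb_le_inf => [|c /S1]; [exact: iS.1|].
move=> delta d0.
have r0 : 0 < delta / (4 * n%:R).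
  by rewrite divr_gt0// mulr_gt0// ltr0n.
have [U [U1 UN]] := sphere_net r0.
(* A gap delta / 2 lowers the maximum by (delta / 2) / 2 ^ (size U) = 2 eps, more than its distance
   to the infimum. The net U depends on delta and n only, so that eps can be fixed before L is
   chosen. *)
pose eps := delta / 2 ^+ (size U).+2.
have e0 : 0 < eps by rewrite divr_gt0// exprn_gt0.
have [c [L aL Lc] cS] := inf_adherent e0 iS.
have p1 : 1 <= 2 ^+ size U :> R by rewrite exprn_ege1// ler1n.
have epsE : eps = (delta / 4) / 2 ^+ size U.
  by rewrite /eps !exprS; field; rewrite expf_neq0.
have ed : eps <= delta / 4.
  by rewrite epsE ler_pdivrMr ?(lt_le_trans _ p1)// ler_peMr// divr_ge0// ltW.
exists L => // u u1; apply/andP; split; last by have := Lc u u1; lra.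
rewrite leNgt; apply/negP => ux.
have near v : dot v v = 1 -> enorm (v - u) < delta / (4 * n%:R) -> width L v <= c - delta / 2.
  move=> v1 vu; have := width_lip L v u.
  have : weight L * enorm (v - u) <= delta / 4.
    apply: (@le_trans _ _ (n%:R * (delta / (4 * n%:R)))).
      by apply: ler_pM => //; [apply: sumr_ge0 => g _; exact: enorm_ge0|exact: enorm_ge0|exact: aL.1|exact: ltW].
    by rewrite le_eqVlt; apply/orP; left; apply/eqP; field; rewrite pnatr_eq0 -lt0n.
  have := lb_le_inf iS.1 (fun z (h : S z) => S1 z h).
  have cinf : inf S <= c by apply: ge_inf; [exact: iS.2|exists L].
  lra.
have d20 : 0 <= delta / 2 by rewrite divr_ge0// ltW.
have [L' [aL' _ _ L'U]] := symmetrize_net u1 U1 aL Lc near d20.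
have : inf S <= c - (delta / 2) / 2 ^+ size U.
  apply: ge_inf; first exact: iS.2.
  exists L' => // v v1; have [w wU vw] := UN v v1; exact: L'U v1 wU vw.
have -> : (delta / 2) / 2 ^+ size U = 2 * eps by rewrite epsE; field; rewrite expf_neq0.
by lra.
Qed.

End SymmetrizedZonotopes.

(** * Separation, and identities for Minkowski sums *)

Section Support.
Context {R : realType} {n : nat}.
Implicit Types (A B K : set 'rV[R]_n) (u x y z : 'rV[R]_n).

Lemma nearest_point A y : compact A -> A !=set0 ->
  exists2 p, A p & forall z, A z -> dot (y - p) (y - p) <= dot (y - z) (y - z).
Proof.
move=> cA A0; have cf : continuous (fun z : 'rV[R]_n => dot (y - z) (y - z)).
  have -> : (fun u : 'rV[R]_n => dot (y - u) (y - u)) =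
      (fun u => dot u u + (-2 * dot y u + dot y y)).
    by apply/funext => u; rewrite !(dotBl, dotBr) (dotC u y); ring.
  move=> u; apply: cvgD; first exact: continuous_sqnorm.
  apply: cvgD; last exact: cvg_cst.
  by apply: cvgM; [exact: cvg_cst|exact: continuous_dot].
have [p pA pmin] := EVT_min_rV A0 cA (continuous_subspaceT cf).
exists p; first by rewrite inE in pA.
by move=> z Az; apply: pmin; rewrite inE.
Qed.

Lemma dot_subZ x y (t : R) :
  dot (x - t *: y) (x - t *: y) = dot x x - 2 * t * dot x y + t ^+ 2 * dot y y.
Proof. by rewrite !(dotBl, dotBr, dotZl, dotZr) (dotC y x); ring. Qed.

(** For the point p of A nearest to y, no point of A lies farther than p in the direction y - p; the
    assumption in this direction forces y = p. *)
Lemma support_separation A y : body A -> A !=set0 ->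
  (forall u, exists2 z, A z & dot u y <= dot u z) -> A y.
Proof.
move=> [cA xA] A0 sep; have [p Ap pmin] := nearest_point y cA A0.
have [z Az uz] := sep (y - p).
have nn : dot (y - p) (z - p) <= 0.
  rewrite leNgt; apply/negP => pos.
  have zp : 0 <= dot (z - p) (z - p) by exact: dot_ge0.
  set c := dot (y - p) (z - p) in pos; set b := dot (z - p) (z - p) in zp.
  pose t := Order.min 1 (c / (b + 1)).
  have t0 : 0 < t by rewrite lt_min ltr01 divr_gt0// ltr_wpDl.
  have t1 : t <= 1 by rewrite ge_min lexx.
  have tb : t * (b + 1) <= c by rewrite -ler_pdivlMr ?ltr_wpDl// ge_min lexx orbT.
  have := pmin ((1 - t) *: p + t *: z).
  have -> : y - ((1 - t) *: p + t *: z) = (y - p) - t *: (z - p).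
    by apply/rowP => i; rewrite !mxE; ring.
  have Aq : A ((1 - t) *: p + t *: z).
    by apply: xA => //; [rewrite subr_ge0|exact: ltW|rewrite subrK].
  move=> /(_ Aq); rewrite dot_subZ -/c -/b => h.
  have : t * (2 * c - t * b) <= 0 by rewrite expr2 in h; lra.
  by rewrite pmulr_rle0//; rewrite mulrDr in tb; lra.
have : dot (y - p) (y - p) <= 0.
  by move: uz nn; rewrite !dotBr; lra.
rewrite le_eqVlt ltNge dot_ge0 orbF dot_eq0 subr_eq0 => /eqP yp; rewrite -yp in Ap; exact: Ap.
Qed.

Lemma minksumA A B C : minksum (minksum A B) C = minksum A (minksum B C).
Proof.
apply/seteqP; split=> [_ [_ [c [[a [b [Aa Bb ->]]] Cc ->]]]|_ [a [_ [Aa [b [c [Bb Cc ->]]] ->]]]].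
  by exists a, (b + c); rewrite addrA; split=> //; exists b, c.
by exists (a + b), c; rewrite addrA; split=> //; exists a, b.
Qed.

Lemma minksumC A B : minksum A B = minksum B A.
Proof.
by apply/seteqP; split=> _ [a [b [Aa Bb ->]]]; exists b, a; rewrite addrC.
Qed.

Lemma minksumAC A B C : minksum (minksum A B) C = minksum (minksum A C) B.
Proof. by rewrite !minksumA (minksumC B). Qed.

Lemma sub_minksum A A' B B' : A `<=` A' -> B `<=` B' -> minksum A B `<=` minksum A' B'.
Proof. by move=> AA BB _ [a [b [Aa Bb ->]]]; exists a, b; split; [exact: AA|exact: BB|]. Qed.

Lemma minksum_neq0 A B : A !=set0 -> B !=set0 -> minksum A B !=set0.
Proof. by move=> [a Aa] [b Bb]; exists (a + b), a, b. Qed.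

Lemma unit_ballP x : @unit_ball R n x <-> enorm x <= 1.
Proof.
by rewrite /unit_ball /= -enorm_sqr -[leRHS](expr1n R 2) ler_pXn2r// ?nnegrE ?enorm_ge0.
Qed.

Lemma ball0 : @unit_ball R n 0. Proof. by rewrite /unit_ball /= dot0l. Qed.

End Support.

(** * Comparison of centered zonotopes with balls *)

Section CenteredZonotopes.
Context {R : realType} {n : nat} (L : seq 'rV[R]_n).
Implicit Types (K : set 'rV[R]_n) (u x y z : 'rV[R]_n).

(** The segments [-g, g] moved to start at 0, as [zono] requires; [czono] undoes the translation. *)
Definition gens : 'M[R]_(size L, n) := \matrix_(i, j) (2 * (L`_i) ord0 j).
Definition center : 'rV[R]_n := \sum_(i < size L) L`_i.
Definition czono s : set 'rV[R]_n :=
  minksum (zono gens (s *: const_mx 1)) [set - (s *: center)].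

Lemma mul_gens (t : 'rV[R]_(size L)) : t *m gens = \sum_i (2 * t ord0 i) *: L`_i.
Proof.
rewrite mulmx_sum_row; apply: eq_bigr => i _.
by apply/rowP => j; rewrite !mxE; ring.
Qed.

Lemma czonoP s z : czono s z <-> exists t : 'rV[R]_(size L),
  (forall i, 0 <= t ord0 i <= s) /\ z = \sum_i (2 * t ord0 i - s) *: L`_i.
Proof.
have mE (t : 'rV[R]_(size L)) : t *m gens - s *: center = \sum_i (2 * t ord0 i - s) *: L`_i.
  rewrite mul_gens /center scaler_sumr -sumrB; apply: eq_bigr => i _.
  by rewrite scalerBl.
split=> [[_ [_ [[t tP <-] -> ->]]]|[t [tP ->]]].
  by exists t; split=> // i; have := tP i; rewrite !mxE mulr1.
exists (t *m gens), (- (s *: center)); split=> //; exists t => // i.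
by rewrite !mxE mulr1; exact: tP.
Qed.

Lemma widthE u : width L u = \sum_(i < size L) `|dot L`_i u|.
Proof. by rewrite /width (big_nth 0) big_mkord. Qed.

Lemma widthZ a u : width L (a *: u) = `|a| * width L u.
Proof. by rewrite /width mulr_sumr; apply: eq_bigr => g _; rewrite dotZr normrM. Qed.

Lemma enorm_gt0 u : u != 0 -> 0 < enorm u.
Proof. by move=> u0; rewrite sqrtr_gt0 lt_neqAle dot_ge0 eq_sym dot_eq0 u0. Qed.

Lemma normalize u : u != 0 -> dot ((enorm u)^-1 *: u) ((enorm u)^-1 *: u) = 1.
Proof.
move=> u0; have := enorm_gt0 u0 => e0.
by rewrite dotZl dotZr -enorm_sqr; field; rewrite gt_eqF.
Qed.

Lemma width_normalize u : u != 0 -> width L u = enorm u * width L ((enorm u)^-1 *: u).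
Proof.
move=> u0; rewrite widthZ ger0_norm ?invr_ge0 ?enorm_ge0// mulrA divff ?mul1r//.
by rewrite gt_eqF// enorm_gt0.
Qed.

Lemma czono_sub_ball s r z : (forall u, dot u u = 1 -> s * width L u <= r) -> 0 <= r ->
  czono s z -> enorm z <= r.
Proof.
move=> wr r0 /czonoP[t [tP zE]].
have [->|z0] := eqVneq z 0; first by rewrite /enorm dot0l sqrtr0.
have zp := enorm_gt0 z0.
rewrite -(ler_pM2l zp) -expr2 enorm_sqr.
apply: (@le_trans _ _ (s * width L z)).
  rewrite {1}zE dotC widthE mulr_sumr.
  have -> : dot z (\sum_i (2 * t ord0 i - s) *: L`_i) = \sum_i (2 * t ord0 i - s) * dot L`_i z.
    rewrite (big_morph (dot z) (fun x y => dotDr x y z) (dot0r z)).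
    by apply: eq_bigr => i _; rewrite dotZr dotC.
  apply: ler_sum => i _; have /andP[t0 ts] := tP i.
  have := ler_norm (dot L`_i z); have := ler_norm (- dot L`_i z); rewrite normrN => h1 h2.
  have : 0 <= `|dot L`_i z| by []. nra.
by rewrite width_normalize// mulrCA ler_pM2l// wr// normalize.
Qed.

Lemma ball_sub_czono s r y : (forall u, dot u u = 1 -> r <= s * width L u) -> 0 <= s ->
  enorm y <= r -> czono s y.
Proof.
move=> wr s0 yr; apply: support_separation => [||u].
- apply: body_minksum; [exact: body_zono|exact: body_set1].
- apply: minksum_neq0; last by exists (- (s *: center)).
  by apply: zono_neq0 => i; rewrite !mxE mulr_ge0.
(* The vertex of the zonotope that is extreme in direction u. *)
pose t : 'rV[R]_(size L) := \row_i (if 0 <= dot L`_i u then s else 0).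
exists (\sum_i (2 * t ord0 i - s) *: L`_i).
  by apply/czonoP; exists t; split=> // i; rewrite mxE; case: ifP; rewrite ?lexx s0.
have -> : dot u (\sum_i (2 * t ord0 i - s) *: L`_i) = s * width L u.
  rewrite (big_morph (dot u) (fun x y => dotDr x y u) (dot0r u)) widthE mulr_sumr.
  apply: eq_bigr => i _; rewrite dotZr (dotC u) mxE; case: ifPn => h.
    by rewrite ger0_norm//; ring.
  by rewrite ltr0_norm ?ltNge//; ring.
have [->|u0] := eqVneq u 0.
  by rewrite dot0l mulr_ge0//; apply: sumr_ge0.
rewrite width_normalize// mulrCA.
apply: le_trans (ler_norm _) _; apply: le_trans (dot_le_enorm u y) _.
rewrite ler_wpM2l ?enorm_ge0//; apply: le_trans yr _.
by apply: wr; exact: normalize.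
Qed.

Definition ball_vol K (x : R) := vol (minksum K (mscal x (@unit_ball R n))).

Lemma mem_mscal_ball (x : R) z : 0 <= x -> enorm z <= x -> mscal x (@unit_ball R n) z.
Proof.
rewrite le_eqVlt => /predU1P[<-|x0] zx.
  have [->|/enorm_gt0] := eqVneq z 0; last by rewrite ltNge zx.
  by exists 0; rewrite ?scaler0//; exact: ball0.
exists (x^-1 *: z); last by rewrite scalerA divff ?scale1r// gt_eqF.
by apply/unit_ballP; rewrite enormZ gtr0_norm ?invr_gt0// mulrC ler_pdivrMr// mul1r.
Qed.

Lemma ball_vol_translate K b (x : R) : body K -> ball_vol (minksum K [set b]) x = ball_vol K x.
Proof.
move=> bK; rewrite /ball_vol minksumAC vol_translate//.
exact: (body_minksum bK (body_mscal _ (body_unit_ball _))).1.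
Qed.

(** After a translation K contains 0, so it contains (1 - delta) K and is contained in (1 + delta)
    K. The inclusions between the zonotope and the balls of radii 1 - delta and 1 + delta therefore
    pass to the sums with K. *)
Lemma czono_sandwich K (mu delta x : R) : body K -> K !=set0 -> 0 <= mu -> 0 <= delta <= 1 -> 0 <= x ->
  (forall u, dot u u = 1 -> 1 - delta <= mu * width L u <= 1 + delta) ->
  (1 - delta) ^+ n * ball_vol K x <= vol (minksum K (zono gens (x *: (mu *: const_mx 1))))
    <= (1 + delta) ^+ n * ball_vol K x.
Proof.
move=> bK [k0 Kk0] mu0 /andP[d0 d1] x0 wL.
have bB : body (mscal x (@unit_ball R n)) by apply: body_mscal; exact: body_unit_ball.
pose K1 := minksum K [set - k0].
have bK1 : body K1 by apply: body_minksum => //; exact: body_set1.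
have K10 : K1 0 by exists k0, (- k0); rewrite subrr.
have K1s a k : 0 <= a <= 1 -> K1 k -> K1 (a *: k).
  move=> /andP[a0 a1] Kk; have := bK1.2 k 0 a (1 - a) Kk K10 a0.
  by rewrite scaler0 addr0; apply; rewrite ?subr_ge0// addrC subrK.
rewrite scalerA -(ball_vol_translate (- k0) x bK) -/K1.
have bZ : body (zono gens ((x * mu) *: const_mx 1)) by exact: body_zono.
have -> : vol (minksum K (zono gens ((x * mu) *: const_mx 1))) = vol (minksum K1 (czono (x * mu))).
  have e : minksum K1 (czono (x * mu)) =
      minksum (minksum (minksum K (zono gens ((x * mu) *: const_mx 1))) [set - k0]) [set - ((x * mu) *: center)].
    by rewrite /czono -minksumA /K1 (minksumAC K).
  have c1 := (body_minksum (body_minksum bK bZ) (body_set1 (- k0))).1.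
  have c2 := (body_minksum bK bZ).1.
  by rewrite e (vol_translate _ c1) (vol_translate _ c2).
have bcz : body (czono (x * mu)) by apply: body_minksum => //; exact: body_set1.
have ne : minksum K1 (mscal x (@unit_ball R n)) !=set0.
  by apply: minksum_neq0; [exists 0|exists 0, 0; rewrite ?scaler0//; exact: ball0].
have cS := (body_minksum bK1 bB).1; have cZ := (body_minksum bK1 bcz).1.
rewrite /ball_vol -!vol_mscal ?subr_ge0 ?addr_ge0//; apply/andP; split.
  apply: le_vol => //; first exact: compact_mscal.
  move=> _ [_ [k [_ [Kk [b Bb <-] ->]]] <-]; exists ((1 - delta) *: k), ((1 - delta) *: (x *: b)).
  split; last by rewrite scalerDr.
    by apply: K1s => //; rewrite subr_ge0 d1 lerBlDr lerDl.
  apply: (@ball_sub_czono _ ((1 - delta) * x)) => [u u1||].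
  - by rewrite mulrC -mulrA ler_wpM2l//; have /andP[] := wL u u1.
  - exact: mulr_ge0.
  rewrite !enormZ !ger0_norm ?subr_ge0// mulrA ler_piMr ?mulr_ge0 ?subr_ge0//.
  exact/unit_ballP.
apply: le_vol => //; first exact: compact_mscal.
have dp : 0 < 1 + delta by rewrite ltr_pwDl.
move=> _ [k [z [Kk Zz ->]]].
exists ((1 + delta)^-1 *: k + (1 + delta)^-1 *: z); last first.
  by rewrite scalerDr !scalerA divff ?scale1r// gt_eqF.
exists ((1 + delta)^-1 *: k), ((1 + delta)^-1 *: z); split=> //.
  by apply: K1s => //; rewrite invr_ge0 ltW//= invf_le1// lerDl.
apply: mem_mscal_ball => //.
rewrite enormZ gtr0_norm ?invr_gt0// mulrC ler_pdivrMr//.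
apply: czono_sub_ball Zz => [u u1|]; last by rewrite mulr_ge0// ltW.
by rewrite -mulrA ler_wpM2l//; have /andP[] := wL u u1.
Qed.

End CenteredZonotopes.

(** * Steiner's formula and log-concavity of its coefficients *)

Section SteinerCoefficients.
Context {R : realType} {n : nat}.
Implicit Types (K : set 'rV[R]_n).

Lemma cvg_sum_ord k (f : 'I_k -> nat -> R) (l : 'I_k -> R) :
  (forall i, f i @ \oo --> l i) -> (fun m => \sum_i f i m) @ \oo --> \sum_i l i.
Proof.
elim: k f l => [|k IH] f l fl.
  rewrite big_ord0 (_ : (fun m => _) = fun=> 0); first exact: cvg_cst.
  by apply/funext => m; rewrite big_ord0.
rewrite big_ord_recr /= (_ : (fun m => _) =
  (fun m => \sum_(i < k) f (widen_ord (leqnSn k) i) m + f ord_max m)).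
  by apply: cvgD => //; exact: IH.
by apply/funext => m; rewrite big_ord_recr.
Qed.

Definition nodes : 'M[R]_n.+1 := Vandermonde n.+1 (\row_(i < n.+1) i%:R).

Lemma nodes_unit : nodes \in unitmx.
Proof.
rewrite unitmxE det_Vandermonde unitfE; apply/prodf_neq0 => i _; apply/prodf_neq0 => j ij.
by rewrite !mxE subr_eq0 eqr_nat gtn_eqF.
Qed.

(** The coefficient of x^a in the polynomial of degree at most n that interpolates f at 0, ..., n.
    It is linear in these n + 1 values. *)
Definition fit (f : R -> R) (a : nat) : R :=
  \sum_(i < n.+1) f i%:R * invmx nodes i (inord a).

Lemma fit_poly (f : R -> R) (c : nat -> R) a : (a <= n)%N ->
  (forall i, (i <= n)%N -> f i%:R = \sum_(b < n.+1) c b * i%:R ^+ b) -> fit f a = c a.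
Proof.
move=> an fc; have e : \row_(i < n.+1) f i%:R = \row_(b < n.+1) c b *m nodes.
  apply/rowP => i; rewrite !mxE fc ?leq_ord//; apply: eq_bigr => b _.
  by rewrite !mxE.
have := congr1 (fun M => (M *m invmx nodes) ord0 (inord a)) e.
rewrite mulmxK ?nodes_unit// [RHS]mxE inordK// => <-; rewrite mxE.
by apply: eq_bigr => i _; rewrite mxE.
Qed.

Definition sc K (a : nat) : R := fit (ball_vol K) a.

Lemma sc_set0 a : sc set0 a = 0.
Proof.
rewrite /sc /fit big1// => i _; rewrite /ball_vol (_ : minksum _ _ = set0) ?vol_set0 ?mul0r//.
by apply/seteqP; split=> z // [x [y []]].
Qed.

Lemma zonotope_sequence : (0 < n)%N -> exists (Ls : nat -> seq 'rV[R]_n) (mu : R), 0 <= mu /\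
  forall m u, dot u u = 1 -> 1 - harmonic m <= mu * width (Ls m) u <= 1 + harmonic m.
Proof.
move=> n0; have [c c1 cL] := @admissible_near_constant R n n0.
have c0 : 0 < c by exact: lt_le_trans c1.
have hm m : 0 < (harmonic m : R) by rewrite /harmonic invr_gt0.
have [Ls LsP] := choice (fun m => let: ex_intro2 L _ h := cL (harmonic m) (hm m) in
  ex_intro (fun L => forall u, dot u u = 1 -> c - harmonic m <= width L u <= c + harmonic m) L h).
exists Ls, c^-1; split=> [|m u u1]; first by rewrite invr_ge0 ltW.
have /andP[h1 h2] := LsP m u u1; have := hm m => h0.
have ch : harmonic m <= c * harmonic m by rewrite ler_peMl// ltW.
rewrite [c^-1 * _]mulrC ler_pdivrMr// ler_pdivlMr//.
by apply/andP; split; lra.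
Qed.

Section Approximation.
Variables (Ls : nat -> seq 'rV[R]_n) (mu : R).
Hypothesis mu0 : 0 <= mu.
Hypothesis LsP : forall m u, dot u u = 1 -> 1 - harmonic m <= mu * width (Ls m) u <= 1 + harmonic m.

Let t m : 'rV[R]_(size (Ls m)) := mu *: const_mx 1.
Let t0 (m : nat) : nneg (t m). Proof. by move=> i; rewrite !mxE mulr1. Qed.

Definition approx_coef K m (a : nat) := 'C(n, a)%:R / n`!%:R * mixed_vol (gens (Ls m)) K (t m) a.

Lemma approx_vol_cvg K x : body K -> K !=set0 -> 0 <= x ->
  (fun m => \sum_(a < n.+1) approx_coef K m a * x ^+ a) @ \oo --> ball_vol K x.
Proof.
move=> bK K0 x0.
have lim (s : R) : (fun m => (1 + s * harmonic m) ^+ n * ball_vol K x) @ \oo --> ball_vol K x.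
  pose p : {poly R} := (1 + s *: 'X) ^+ n * (ball_vol K x)%:P.
  have h : p.[harmonic m] @[m --> \oo] --> p.[0].
    by apply: (cvg_comp harmonic (horner p)); [exact: cvg_harmonic|exact: continuous_horner].
  have pE z : p.[z] = (1 + s * z) ^+ n * ball_vol K x by rewrite /p !hornerE.
  rewrite pE mulr0 addr0 expr1n mul1r in h; move: h.
  by under eq_fun => m do rewrite pE.
apply: (squeeze_cvgr _ (lim (-1)) (lim 1)).
apply: nearW => m; rewrite mulN1r mul1r.
rewrite -(@vol_zono_steiner _ _ _ (gens (Ls m)) K bK K0 (t m) x (@t0 m) x0).
apply: czono_sandwich => //; last exact: LsP.
by rewrite /harmonic invr_ge0 ler0n/= invf_le1// ler1n.
Qed.

(** The approximating volumes are polynomials of degree at most n, so interpolation expresses their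
    coefficients by values at 0, ..., n, and these converge. *)
Lemma approx_coef_cvg K a : body K -> K !=set0 -> (a <= n)%N -> approx_coef K ^~ a @ \oo --> sc K a.
Proof.
move=> bK K0 an.
have -> : approx_coef K ^~ a = fun m => \sum_(i < n.+1)
    (\sum_(b < n.+1) approx_coef K m b * i%:R ^+ b) * invmx nodes i (inord a).
  apply/funext => m; rewrite -(@fit_poly (fun x => \sum_(b < n.+1) approx_coef K m b * x ^+ b) (approx_coef K m) a)//.
apply: cvg_sum_ord => i; apply: cvgMr_tmp; exact: approx_vol_cvg.
Qed.

Lemma steiner_approx K x : body K -> K !=set0 -> 0 <= x ->
  ball_vol K x = \sum_(a < n.+1) sc K a * x ^+ a.
Proof.
move=> bK K0 x0; have h1 := approx_vol_cvg bK K0 x0.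
have h2 : (fun m => \sum_(a < n.+1) approx_coef K m a * x ^+ a) @ \oo --> \sum_(a < n.+1) sc K a * x ^+ a.
  by apply: cvg_sum_ord => a; apply: cvgMr_tmp; apply: approx_coef_cvg => //; exact: leq_ord.
exact: (cvg_unique _ h1 h2).
Qed.

Lemma approx_coef_ge0 K m a : body K -> 0 <= approx_coef K m a.
Proof.
by move=> bK; rewrite mulr_ge0 ?divr_ge0// mixed_vol_ge0.
Qed.

Lemma sc_ge0_approx K a : body K -> K !=set0 -> (a <= n)%N -> 0 <= sc K a.
Proof.
move=> bK K0 an; apply: (cvgr_to_ge (approx_coef_cvg bK K0 an)).
by apply: nearW => m; exact: approx_coef_ge0.
Qed.

Lemma le_sc_approx K K' a : body K -> body K' -> K !=set0 -> K `<=` K' -> (a <= n)%N ->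
  sc K a <= sc K' a.
Proof.
move=> bK bK' K0 KK' an; have K'0 : K' !=set0 by case: K0 => k /KK' Kk; exists k.
apply: (ler_cvg_to (approx_coef_cvg bK K0 an) (approx_coef_cvg bK' K'0 an)).
apply: nearW => m; rewrite ler_wpM2l ?divr_ge0//; exact: le_mixed_vol.
Qed.

Lemma sc_logconcave_approx K a : body K -> K !=set0 -> (a + 2 <= n)%N ->
  (sc K a / 'C(n, a)%:R) * (sc K a.+2 / 'C(n, a.+2)%:R) <= (sc K a.+1 / 'C(n, a.+1)%:R) ^+ 2.
Proof.
move=> bK K0 an.
have cv b : (b <= n)%N -> (fun m => approx_coef K m b / 'C(n, b)%:R) @ \oo --> sc K b / 'C(n, b)%:R.
  by move=> bn; apply: cvgMr_tmp; exact: approx_coef_cvg.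
have c0 : (a <= n)%N by lia. have c1 : (a.+1 <= n)%N by lia. have c2 : (a.+2 <= n)%N by lia.
rewrite expr2; apply: (ler_cvg_to (cvgM (cv _ c0) (cv _ c2)) (cvgM (cv _ c1) (cv _ c1))).
apply: nearW => m /=; rewrite /approx_coef.
have bn b : (b <= n)%N -> 'C(n, b)%:R != 0 :> R by move=> bn; rewrite pnatr_eq0 -lt0n bin_gt0.
have E b : (b <= n)%N -> 'C(n, b)%:R / n`!%:R * mixed_vol (gens (Ls m)) K (t m) b / 'C(n, b)%:R =
    n`!%:R^-1 * mixed_vol (gens (Ls m)) K (t m) b.
  by move=> h; field; rewrite bn//= pnatr_eq0 -lt0n fact_gt0.
rewrite !E// mulrACA [leRHS]mulrACA ler_wpM2l ?mulr_ge0 ?invr_ge0//.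
by rewrite -expr2; apply: mixed_vol_logconcave.
Qed.

End Approximation.

(** The zonotope sequence exists for n > 0; R^0, which has no unit vector, is treated by hand. *)
Lemma sum_R0 (c : nat -> R) x : n = 0%N -> \sum_(a < n.+1) c a * x ^+ a = c 0%N.
Proof. by move=> ->; rewrite big_ord1 expr0 mulr1. Qed.

Lemma ball_vol_R0 K x : n = 0%N -> ball_vol K x = vol K.
Proof.
move=> n0; rewrite /ball_vol; congr vol.
have e (a b : 'rV[R]_n) : a = b by apply/rowP => i; have := ltn_ord i; rewrite {2}n0.
apply/seteqP; split=> [_ [k [z [Kk _ ->]]]|k Kk]; first by rewrite (e (k + z) k).
by exists k, 0; split=> //; exists 0; [exact: ball0|rewrite scaler0].
Qed.

Lemma sc_R0 K : n = 0%N -> sc K 0 = vol K.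
Proof.
move=> n0; rewrite /sc (@fit_poly _ (fun=> vol K))// => i _.
by rewrite ball_vol_R0// (sum_R0 (fun=> vol K)).
Qed.

Lemma steiner K x : body K -> 0 <= x -> ball_vol K x = \sum_(a < n.+1) sc K a * x ^+ a.
Proof.
move=> bK x0; have [[k Kk]|K0] := pselect (K !=set0); last first.
  have -> : K = set0 by apply/seteqP; split=> z // Kz; apply: K0; exists z.
  rewrite /ball_vol (_ : minksum _ _ = set0); last by apply/seteqP; split=> z // [a [b []]].
  by rewrite vol_set0 big1// => i _; rewrite sc_set0 mul0r.
have [n0|n0] := posnP n; last first.
  have [Ls [mu [mu0 LsP]]] := zonotope_sequence n0.
  by apply: (steiner_approx mu0 LsP) => //; exists k.
by rewrite ball_vol_R0// -sc_R0// sum_R0.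
Qed.

Lemma sc_ge0 K a : body K -> (a <= n)%N -> 0 <= sc K a.
Proof.
move=> bK an; have [[k Kk]|K0] := pselect (K !=set0); last first.
  have -> : K = set0 by apply/seteqP; split=> z // Kz; apply: K0; exists z.
  by rewrite sc_set0.
have [n0|n0] := posnP n; last first.
  have [Ls [mu [mu0 LsP]]] := zonotope_sequence n0.
  by apply: (sc_ge0_approx mu0 LsP) => //; exists k.
have -> : a = 0%N by lia.
by rewrite sc_R0// vol_ge0.
Qed.

Lemma le_sc K K' a : body K -> body K' -> K `<=` K' -> (a <= n)%N -> sc K a <= sc K' a.
Proof.
move=> bK bK' KK' an; have [[k Kk]|K0] := pselect (K !=set0); last first.
  have -> : K = set0 by apply/seteqP; split=> z // Kz; apply: K0; exists z.
  by rewrite sc_set0 sc_ge0.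
have [n0|n0] := posnP n; last first.
  have [Ls [mu [mu0 LsP]]] := zonotope_sequence n0.
  by apply: (le_sc_approx mu0 LsP) => //; exists k.
have -> : a = 0%N by lia.
by rewrite !sc_R0//; apply: le_vol => //; [exact: bK.1|exact: bK'.1].
Qed.

Lemma sc_logconcave K a : body K -> (a + 2 <= n)%N ->
  (sc K a / 'C(n, a)%:R) * (sc K a.+2 / 'C(n, a.+2)%:R) <= (sc K a.+1 / 'C(n, a.+1)%:R) ^+ 2.
Proof.
move=> bK an; have [[k Kk]|K0] := pselect (K !=set0); last first.
  have -> : K = set0 by apply/seteqP; split=> z // Kz; apply: K0; exists z.
  by rewrite !sc_set0 !mul0r expr0n.
have n0 : (0 < n)%N by lia.
have [Ls [mu [mu0 LsP]]] := zonotope_sequence n0.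
by apply: (sc_logconcave_approx mu0 LsP) => //; exists k.
Qed.

End SteinerCoefficients.

(** * Intrinsic volumes: existence, uniqueness, valuation and homogeneity *)

Section Fit.
Context {R : realType} {n : nat}.
Implicit Types (f g : R -> R).

Lemma fit_ext f g a : (forall x, 0 <= x -> f x = g x) -> fit (n := n) f a = fit (n := n) g a.
Proof. by move=> fg; apply: eq_bigr => i _; rewrite fg. Qed.

Lemma fitD f g a : fit (n := n) (fun x => f x + g x) a = fit (n := n) f a + fit (n := n) g a.
Proof. by rewrite /fit -big_split; apply: eq_bigr => i _; rewrite mulrDl. Qed.

Lemma fitZ s f a : fit (n := n) (fun x => s * f x) a = s * fit (n := n) f a.
Proof. by rewrite /fit mulr_sumr; apply: eq_bigr => i _; rewrite mulrA. Qed.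

End Fit.

Section IntrinsicVolume.
Context {R : realType} {n : nat}.
Implicit Types (K : set 'rV[R]_n) (u y z : 'rV[R]_n).

Lemma compact_abs_box m (r : R) : compact [set x : 'rV[R]_m | forall i, `|x ord0 i| <= r].
Proof.
have -> : [set x : 'rV[R]_m | forall i, `|x ord0 i| <= r] =
    [set s : 'rV[R]_m | forall i, (const_mx (- r) : 'rV[R]_m) ord0 i <= s ord0 i <= (const_mx r : 'rV[R]_m) ord0 i].
  by apply/seteqP; split=> x /= h i; have := h i; rewrite !mxE ler_norml.
exact: (@compact_box R m).
Qed.

(** The ball contains the cube of half edge 1 / (m + 1), since m <= (m + 1)^2. *)
Lemma kappa_gt0 m : 0 < @kappa R m.
Proof.
pose r : R := m.+1%:R^-1.
have r0 : 0 < r by rewrite invr_gt0.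
apply: (@lt_le_trans _ _ ((2 * r) ^+ m)); first by rewrite exprn_gt0// mulr_gt0.
have := @volume_box R m r (ltW r0); set B := [set _ | _] => vB.
have -> : (2 * r) ^+ m = vol B by rewrite /vol vB.
apply: le_vol; [exact: compact_abs_box|exact: (body_unit_ball _).1|].
move=> x /= xB; rewrite /unit_ball /=.
apply: (@le_trans _ _ (\sum_(i < m) r ^+ 2)).
  by apply: ler_sum => i _; rewrite -expr2 -(real_normK (num_real (x ord0 i))) ler_pXn2r ?nnegrE// ?ltW.
rewrite sumr_const card_ord -mulr_natl.
apply: (@le_trans _ _ (m.+1%:R * r ^+ 2)); first by rewrite ler_wpM2r ?sqr_ge0// ler_nat.
by rewrite expr2 mulrA divff ?mul1r ?invf_le1 ?ler1n.
Qed.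

(** An explicit solution of Steiner's formula, with which all later computations are made. *)
Definition ivol K j := sc K (n - j) / @kappa R (n - j).

Let k0 m : @kappa R m != 0. Proof. by rewrite gt_eqF// kappa_gt0. Qed.

Lemma kappaE : @kappa R n = vol (@unit_ball R n). Proof. by []. Qed.

Lemma steiner_ivol K : body K -> steiner_formula K (ivol K).
Proof.
move=> bK x x0; rewrite parallel_bodyE volE; last first.
  exact: (body_minksum bK (body_mscal _ (body_unit_ball _))).1.
congr EFin; rewrite -/(ball_vol K x) steiner// (reindex_inj rev_ord_inj) /=.
apply: eq_bigr => j _; rewrite subSS /ivol; congr (_ * _).
by rewrite mulrC divfK.
Qed.

(** The volumes at the radii 0, ..., n determine the coefficients, so any solution that [get] may
    pick agrees with [ivol] up to index n. *)
Lemma intrinsic_volumeE K j : body K -> (j <= n)%N -> intrinsic_volume K j = ivol K j.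
Proof.
move=> bK jn; pose P := [set V : nat -> R | steiner_formula K V].
have h : steiner_formula K (intrinsic_volume K).
  exact: (@getPex _ P (ex_intro _ (ivol K) (steiner_ivol bK))).
have nj : (n - j <= n)%N by lia.
have e : sc K (n - j) = @kappa R (n - j) * intrinsic_volume K j.
  have := @fit_poly R n (ball_vol K) (fun a => @kappa R a * intrinsic_volume K (n - a)) _ nj.
  rewrite subKn//; apply => i _; apply: EFin_inj; have := h i%:R (ler0n _ _).
  rewrite parallel_bodyE volE; last first.
    exact: (body_minksum bK (body_mscal _ (body_unit_ball _))).1.
  rewrite -/(ball_vol K i%:R) => ->; congr EFin; rewrite (reindex_inj rev_ord_inj) /=.
  by apply: eq_bigr => b _; rewrite subSS subKn// -ltnS.
by rewrite /ivol e mulrAC divff// mul1r.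
Qed.

Lemma ivol_ge0 K j : body K -> 0 <= ivol K j.
Proof. by move=> bK; rewrite divr_ge0 ?sc_ge0// ?leq_subr// ltW// kappa_gt0. Qed.

Lemma le_ivol K K' j : body K -> body K' -> K `<=` K' -> ivol K j <= ivol K' j.
Proof.
by move=> bK bK' KK'; rewrite ler_pM2r ?invr_gt0 ?kappa_gt0// le_sc// leq_subr.
Qed.

Lemma ivol_set0 j : ivol set0 j = 0. Proof. by rewrite /ivol sc_set0 mul0r. Qed.

(** Inclusion-exclusion for the two parallel bodies. If k + m = k' + m' with k and k' on different
    sides, then some convex combination of k and k' lies on the hyperplane, and the same combination
    of m and m' stays in the ball; so the intersection is the parallel body of the slice. *)
Lemma ball_vol_split K u p x : body K -> 0 <= x ->
  ball_vol K x + ball_vol (slice K u p) x = ball_vol (upper_part K u p) x + ball_vol (lower_part K u p) x.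
Proof.
move=> bK x0; set M := mscal x (@unit_ball R n).
have bM : body M by apply: body_mscal; exact: body_unit_ball.
have b1 := body_minksum (body_upper_part u p bK) bM.
have b2 := body_minksum (body_lower_part u p bK) bM.
rewrite /ball_vol -/M -(vol_setU b1.1 b2.1); congr (_ + _); congr vol.
  apply/seteqP; split=> z; last by case=> -[k [m [[Kk _] Mm ->]]]; exists k, m.
  move=> [k [m [Kk Mm ->]]].
  by case: (leP p (dot u k)) => h; [left|right]; exists k, m; split=> //; split=> //; exact: ltW.
apply/seteqP; split=> [_ [k [m [[Kk pk] Mm ->]]]|z [[k [m [[Kk pk] Mm ->]]] [k' [m' [[Kk' pk'] Mm' e]]]]].
  by split; exists k, m; split=> //; split=> //; rewrite pk.
have [s [s0 s1 sp]] : exists s, [/\ 0 <= s, s <= 1 & dot u (s *: k + (1 - s) *: k') = p].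
  have [e0|e0] := eqVneq (dot u k) (dot u k').
    exists 1; split=> //; rewrite dotDr !dotZr e0; have : dot u k' = p by apply/eqP; rewrite eq_le pk' -e0 pk.
    by move=> ->; ring.
  have kk : 0 < dot u k - dot u k'.
    by rewrite subr_gt0 lt_neqAle eq_sym e0 (le_trans pk').
  exists ((p - dot u k') / (dot u k - dot u k')); split.
  - by apply: divr_ge0; [rewrite subr_ge0|exact: ltW].
  - by rewrite ler_pdivrMr// mul1r lerB// .
  - by rewrite dotDr !dotZr; field; rewrite gt_eqF.
exists (s *: k + (1 - s) *: k'), (s *: m + (1 - s) *: m'); split.
- by split=> //; apply: bK.2; rewrite ?subr_ge0// addrC subrK.
- by apply: bM.2; rewrite ?subr_ge0// addrC subrK.
- rewrite addrACA -!scalerDr -e -scalerDl (addrC s) subrK scale1r//.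
Qed.

Lemma ivol_split K u p j : body K ->
  ivol K j + ivol (slice K u p) j = ivol (upper_part K u p) j + ivol (lower_part K u p) j.
Proof.
move=> bK; rewrite /ivol -!mulrDl /sc -!fitD; congr (_ / _).
by apply: fit_ext => x x0; exact: ball_vol_split.
Qed.

Lemma ivol_translate K b j : body K -> ivol (minksum K [set b]) j = ivol K j.
Proof.
by move=> bK; rewrite /ivol /sc; congr (_ / _); apply: fit_ext => x _; exact: ball_vol_translate.
Qed.

Lemma ivol_orth (Q : 'M[R]_n) K j : Q *m Q^T = 1%:M -> body K -> ivol [set x | K (x *m Q)] j = ivol K j.
Proof.
move=> QQ bK; rewrite /ivol /sc; congr (_ / _); apply: fit_ext => x _.
have bM : body (mscal x (@unit_ball R n)) by apply: body_mscal; exact: body_unit_ball.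
rewrite /ball_vol -[RHS](vol_orth QQ); last exact: (body_minksum bK bM).1.
congr vol; rewrite minksum_mulmx ?orth_unitmx//; congr minksum.
rewrite mscal_mulmx ?orth_unitmx//; congr mscal.
by apply/seteqP; split=> z; rewrite /unit_ball /= dot_mulmx_orth.
Qed.

Lemma ivol_mscal s K j : body K -> 0 < s -> K !=set0 -> (j <= n)%N -> ivol (mscal s K) j = s ^+ j * ivol K j.
Proof.
move=> bK s0 [k Kk] jn; have sn : s != 0 by rewrite gt_eqF.
rewrite /ivol mulrA; congr (_ / _).
have := @fit_poly R n (ball_vol (mscal s K)) (fun a => s ^+ (n - a) * sc K a) _ (leq_subr j n).
rewrite subKn//; apply => i _; set x := i%:R : R.
have x0 : 0 <= x by exact: ler0n.
have bM (y : R) : body (mscal y (@unit_ball R n)) by apply: body_mscal; exact: body_unit_ball.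
have -> : ball_vol (mscal s K) x = s ^+ n * ball_vol K (x / s).
  rewrite /ball_vol -vol_mscal ?(ltW s0)//; last 2 first.
  - exact: (body_minksum bK (bM _)).1.
  - by apply: minksum_neq0; [exists k|exists 0, 0; rewrite ?scaler0//; exact: ball0].
  congr vol; apply/seteqP; split=> [_ [_ [_ [[a Ka <-] [b Bb <-] ->]]]|_ [_ [a [_ [Ka [b Bb <-] ->]]] <-]].
    exists (a + (x / s) *: b); last by rewrite scalerDr scalerA mulrCA divff ?mulr1.
    by exists a, ((x / s) *: b); split=> //; exists b.
  exists (s *: a), (x *: b); split; [by exists a|by exists b|].
  by rewrite scalerDr scalerA mulrCA divff ?mulr1.
rewrite steiner ?divr_ge0 ?(ltW s0)// mulr_sumr; apply: eq_bigr => a _.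
have an : (a <= n)%N by rewrite -ltnS.
have -> : s ^+ n = s ^+ (n - a) * s ^+ a by rewrite -exprD subnK.
by rewrite expr_div_n; field; rewrite expf_neq0.
Qed.

Lemma ivol_add_seg K y t j : body K -> 0 <= t ->
  ivol (minksum K (mscal t (seg y))) j = ivol K j + t * (ivol (minksum K (seg y)) j - ivol K j).
Proof.
move=> bK t0; rewrite /ivol -mulrBl mulrA -mulrDl; congr (_ / _).
rewrite /sc -[X in t * (_ - X)]mul1r mulrDr -mulNr -fitZ mulrA -!fitZ -!fitD; apply: fit_ext => x x0.
have bM : body (mscal x (@unit_ball R n)) by apply: body_mscal; exact: body_unit_ball.
rewrite /ball_vol !(minksumAC K _ (mscal x _)) vol_add_seg//; last exact: body_minksum.
by ring.
Qed.

Lemma kappa0 : @kappa R 0 = 1.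
Proof. by rewrite /kappa /=; case: ifPn => // /asboolPn; case; exists 0; exact: ball0. Qed.

Lemma sc_vol K : body K -> sc K 0 = vol K.
Proof.
move=> bK; have := steiner bK (lexx 0).
rewrite big_ord_recl expr0 mulr1 big1 ?addr0 => [<-|i _]; last by rewrite expr0n mulr0.
congr vol; apply/seteqP; split=> [_ [k [_ [Kk [b _ <-] ->]]]|k Kk]; first by rewrite scale0r addr0.
by exists k, 0; split=> //; rewrite ?addr0//; exists 0; [exact: ball0|rewrite scaler0].
Qed.

Lemma ivol_top K : body K -> ivol K n = vol K.
Proof. by move=> bK; rewrite /ivol subnn kappa0 divr1 sc_vol. Qed.

Lemma ball_vol_ball x : 0 <= x -> ball_vol (@unit_ball R n) x = (1 + x) ^+ n * @kappa R n.
Proof.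
move=> x0; have bB := @body_unit_ball R n.
rewrite kappaE -vol_mscal ?addr_ge0//; [|exact: bB.1|by exists 0; exact: ball0].
rewrite /ball_vol; congr vol; apply/seteqP; split=> [_ [b [_ [Bb [c Bc <-] ->]]]|_ [b Bb <-]].
  apply: mem_mscal_ball; first exact: addr_ge0.
  have /unit_ballP h1 := Bb; have /unit_ballP h2 := Bc.
  have := bB.2 b c ((1 + x)^-1) (x / (1 + x)) Bb Bc.
  have xn : 1 + x != 0 by rewrite gt_eqF// ltr_pwDl.
  have s1 : (1 + x)^-1 + x / (1 + x) = 1 by field.
  rewrite invr_ge0 divr_ge0 ?addr_ge0// => /(_ isT isT s1)/unit_ballP h.
  have -> : b + x *: c = (1 + x) *: ((1 + x)^-1 *: b + (x / (1 + x)) *: c).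
    by rewrite scalerDr !scalerA divff// scale1r mulrCA divff// mulr1.
  by rewrite enormZ ger0_norm ?addr_ge0// ler_piMr// addr_ge0.
by exists b, (x *: b); split=> //; [exists b|rewrite scalerDl scale1r].
Qed.

(** For 0 in K and K inside the ball of radius r, the volume lies between those of the balls of
    radii x and r + x. In y = 1/x the top coefficient is the value at y = 0. *)
Lemma sc_top K : body K -> K !=set0 -> sc K n = @kappa R n.
Proof.
move=> bK [k Kk]; pose K1 := minksum K [set - k].
have bK1 : body K1 by apply: body_minksum => //; exact: body_set1.
have K10 : K1 0 by exists k, (- k); rewrite subrr.
have e x : ball_vol K x = ball_vol K1 x by rewrite ball_vol_translate.
have [_ [M KM]] := (compact_rVP K1).1 bK1.1.
pose r : R := \sum_(i < n) `|M|.
have r0 : 0 <= r by apply: sumr_ge0.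
have Kr : K1 `<=` mscal r (@unit_ball R n).
  move=> z Kz; apply: mem_mscal_ball => //.
  rewrite -(@ler_pXn2r _ 2)// ?nnegrE ?enorm_ge0// enorm_sqr expr2 /r mulr_suml.
  apply: ler_sum => i _; rewrite -expr2 -(real_normK (num_real (z ord0 i))) expr2.
  apply: ler_pM => //; first by apply: le_trans (KM _ Kz i) _; exact: ler_norm.
  apply: le_trans (KM _ Kz i) _; apply: le_trans (ler_norm _) _.
  by rewrite (bigD1 i)//= lerDl sumr_ge0.
have bM (y : R) : body (mscal y (@unit_ball R n)) by apply: body_mscal; exact: body_unit_ball.
have B0 : @unit_ball R n !=set0 by exists 0; exact: ball0.
have lo x : 0 <= x -> x ^+ n * @kappa R n <= ball_vol K x.
  move=> x0; rewrite e kappaE -vol_mscal//; last exact: (body_unit_ball _).1.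
  apply: le_vol; [exact: (bM _).1|exact: (body_minksum bK1 (bM _)).1|].
  by move=> z Bz; exists 0, z; rewrite add0r.
have hi x : 0 <= x -> ball_vol K x <= (r + x) ^+ n * @kappa R n.
  move=> x0; rewrite e kappaE -vol_mscal ?addr_ge0//; last exact: (body_unit_ball _).1.
  apply: le_vol; [exact: (body_minksum bK1 (bM _)).1|exact: (bM _).1|].
  move=> _ [a [_ [/Kr[b Bb <-] [c Bc <-] ->]]].
  have [rx|rx] := eqVneq (r + x) 0.
    have r00 : r = 0 by lra. have x00 : x = 0 by lra.
    by exists b => //; rewrite rx r00 x00 !scale0r addr0.
  exists ((r / (r + x)) *: b + (x / (r + x)) *: c).
    apply: (body_unit_ball n).2 => //; rewrite ?divr_ge0 ?addr_ge0//.
    by rewrite -mulrDl divff.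
  by rewrite scalerDr !scalerA !(mulrC (r + x)) !divfK.
have rev (y : R) : 0 < y -> y ^+ n * ball_vol K y^-1 = \sum_(a < n.+1) sc K a * y ^+ (n - a).
  move=> y0; rewrite steiner ?invr_ge0 ?ltW// mulr_sumr; apply: eq_bigr => a _.
  have an : (a <= n)%N by rewrite -ltnS.
  by rewrite exprVn mulrCA expfB_cond// (gt_eqF y0).
pose P (y : R) := \sum_(a < n.+1) sc K a * y ^+ (n - a).
have iP : ispoly P by apply: ispoly_sum => a _; apply: ispolyM; [exact: ispoly_cst|apply: ispolyX; exact: ispoly_id].
have P0 : P 0 = sc K n.
  rewrite /P big_ord_recr /= subnn expr0 mulr1 big1 ?add0r// => a _.
  by rewrite expr0n subn_eq0 leqNgt ltn_ord /= mulr0.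
apply/eqP; rewrite eq_le -P0; apply/andP; split; rewrite -subr_le0.
  have := ispoly_le0 (ispolyD iP (ispolyM (ispoly_cst (- @kappa R n)) (ispolyX n (ispolyD (ispoly_cst 1) (ispolyM (ispoly_cst r) ispoly_id))))) ltr01.
  rewrite mulr0 addr0 expr1n mulr1; apply => y y0 _.
  rewrite mulNr subr_le0 /P -rev//.
  apply: le_trans (ler_wpM2l _ (hi _ _)) _; rewrite ?invr_ge0 ?exprn_ge0 ?(ltW y0)//.
  rewrite mulrA -exprMn mulrDr divff ?(gt_eqF y0)// mulrC addrC (mulrC y)//.
have := ispoly_le0 (ispolyD (ispoly_cst (@kappa R n)) (ispolyM (ispoly_cst (- 1)) iP)) ltr01.
rewrite mulN1r; apply => y y0 _; rewrite mulN1r subr_le0 /P -rev//.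
apply: le_trans (ler_wpM2l _ (lo _ _)); rewrite ?invr_ge0 ?exprn_ge0 ?(ltW y0)//.
by rewrite mulrA -exprMn divff ?(gt_eqF y0)// expr1n mul1r.
Qed.

Lemma ivol0 K : body K -> K !=set0 -> ivol K 0 = 1.
Proof. by move=> bK K0; rewrite /ivol subn0 sc_top// divff. Qed.

(** Read off the coefficient of x^(n-1) in (1 + x)^n kappa_n. *)
Lemma ivol_ball1 : (0 < n)%N -> ivol (@unit_ball R n) 1 = n%:R * @kappa R n / @kappa R n.-1.
Proof.
move=> n0; rewrite /ivol subn1; congr (_ / _).
have b1 : 'C(n, n.-1) = n by have := binSn n.-1; rewrite prednK.
have := @fit_poly R n (ball_vol (@unit_ball R n)) (fun a => 'C(n, a)%:R * @kappa R n) _ (leq_pred n).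
rewrite b1; apply => i _; rewrite ball_vol_ball// exprDn mulr_suml; apply: eq_bigr => a _.
by rewrite expr1n mul1r -mulr_natl mulrAC.
Qed.

End IntrinsicVolume.

(** * Added segments and bodies in a coordinate hyperplane *)

Section Axis.
Context {R : realType} {n : nat}.
Implicit Types (K : set 'rV[R]_n.+1) (A : set 'rV[R]_n) (x t : R).
Local Notation leb := (@lebesgue_measure R).
Local Notation tl := (@vtail R n).

Lemma body_vtail K : body K -> body (tl @` K).
Proof.
move=> [cK xK]; split; first exact: (compact_image (@continuous_vtail R n)).
by apply: cvx_image => // y z s t _; rewrite vtailD !vtailZ.
Qed.

Lemma vtail_parallel K x : tl @` minksum K (mscal x (@unit_ball R n.+1)) =
  minksum (tl @` K) (mscal x (@unit_ball R n)).
Proof.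
apply/seteqP; split=> [_ [_ [k [_ [Kk [b Bb <-] ->]]] <-]|_ [_ [_ [[k Kk <-] [b Bb <-] ->]]]].
  exists (tl k), (x *: tl b); rewrite vtailD vtailZ; split; [by exists k| |by []].
  exists (tl b); last by [].
  move: Bb; rewrite /unit_ball /= -{1 2}(vconsK b) dot_vcons.
  by apply: le_trans; rewrite lerDr -expr2 sqr_ge0.
exists (k + x *: vcons (0, b)); last by rewrite vtailD vtailZ vcons_tail.
exists k, (x *: vcons (0, b)); split=> //; exists (vcons (0, b)) => //.
by move: Bb; rewrite /unit_ball /= dot_vcons mul0r add0r.
Qed.

Lemma ball_vol_add_axis K t x : body K -> 0 <= t ->
  ball_vol (minksum K (mscal t (seg (@axis R n)))) x = ball_vol K x + t * ball_vol (tl @` K) x.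
Proof.
move=> bK t0; rewrite /ball_vol minksumAC vol_add_axis//; last first.
  by apply: body_minksum => //; apply: body_mscal; exact: body_unit_ball.
by rewrite vtail_parallel.
Qed.

(** Projection commutes with taking parallel bodies, so the volume formula for an added segment
    holds at every radius and hence for every coefficient. *)
Lemma ivol_add_axis K t i : body K -> 0 <= t -> (i <= n)%N ->
  ivol (minksum K (mscal t (seg (@axis R n)))) i.+1 = ivol K i.+1 + t * ivol (tl @` K) i.
Proof.
move=> bK t0 ni; rewrite /ivol subSS mulrA -mulrDl; congr (_ / _).
have ni1 : (n - i <= n.+1)%N by rewrite (leq_trans (leq_subr _ _)).
have := @fit_poly R n.+1 (ball_vol (minksum K (mscal t (seg (@axis R n)))))
  (fun a => sc K a + t * (if (a <= n)%N then sc (tl @` K) a else 0)) _ ni1.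
rewrite leq_subr; apply => j _.
rewrite ball_vol_add_axis// !steiner//; last exact: body_vtail.
under [RHS]eq_bigr => a _ do rewrite mulrDl.
rewrite big_split /=; congr (_ + _).
rewrite [RHS]big_ord_recr /= ltnn mulr0 mul0r addr0 mulr_sumr.
by apply: eq_bigr => a _; rewrite -ltnS ltn_ord mulrA.
Qed.

Definition flat A : set 'rV[R]_n.+1 := [set vcons (0, y) | y in A].

Lemma body_flat A : body A -> body (flat A).
Proof.
move=> [cA xA].
have fE : flat A = (fun y => y *m (row_mx (0 : 'M[R]_(n, 1)) 1%:M)) @` A.
  have fl (y : 'rV[R]_n) : vcons (0, y) = y *m row_mx (0 : 'M[R]_(n, 1)) 1%:M.
    rewrite mul_mx_row mulmx0 mulmx1 /vcons /=.
    by have -> : const_mx 0 = 0 :> 'rV[R]_1 by apply/rowP => i; rewrite !mxE.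
  by apply/seteqP; split=> _ [y Ay <-]; exists y => //; rewrite fl.
rewrite fE; split; first by apply: compact_image => //; exact: continuous_mulmx.
by apply: cvx_image => // y z s t _; rewrite mulmxDl -!scalemxAl.
Qed.

Lemma vtail_flat A : tl @` flat A = A.
Proof.
apply/seteqP; split=> [_ [_ [y Ay <-] <-]|y Ay]; first by rewrite vcons_tail.
by exists (vcons (0, y)); [exists y|rewrite vcons_tail].
Qed.

(** The a-th power of the radius of the slice at height s of the ball of radius x. *)
Definition cap (x : R) (a : nat) (s : R) : R := Num.sqrt (x ^+ 2 - s ^+ 2) ^+ a * \1_`[- x, x] s.

Lemma cap_ge0 x a s : 0 <= cap x a s.
Proof. by rewrite mulr_ge0 ?exprn_ge0 ?sqrtr_ge0. Qed.

Lemma measurable_cap x a : measurable_fun [set: R] (fun s => (cap x a s)%:E).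
Proof.
apply/measurable_EFinP; apply: measurable_funM; last exact: measurable_indic.
apply: continuous_measurable_fun => s.
apply: (@continuous_comp _ _ _ (fun s : R => Num.sqrt (x ^+ 2 - s ^+ 2)) (fun z : R => z ^+ a)); last exact: exprn_continuous.
apply: (@continuous_comp _ _ _ (fun s : R => x ^+ 2 - s ^+ 2) Num.sqrt); last exact: sqrt_continuous.
by apply: cvgB; [exact: cvg_cst|exact: exprn_continuous].
Qed.

Definition cap_int a : R := fine (\int[leb]_s (cap 1 a s)%:E)%E.

Lemma cap_intE a : (\int[leb]_s (cap 1 a s)%:E = (cap_int a)%:E)%E.
Proof.
rewrite /cap_int fineK// ge0_fin_numE; last by apply: integral_ge0 => s _; rewrite lee_fin cap_ge0.
apply: (@le_lt_trans _ _ (\int[leb]_s (\1_`[- 1, 1] s : R)%:E)%E).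
  apply: ge0_le_integral => //.
  - by move=> s _; rewrite lee_fin cap_ge0.
  - exact: measurable_cap.
  - by apply/measurable_EFinP; exact: measurable_indic.
  move=> s _; rewrite lee_fin /cap ler_piMl// exprn_ile1 ?sqrtr_ge0//.
  by rewrite expr1n -[leRHS]sqrtr1 ler_wsqrtr// gerBl sqr_ge0.
rewrite integral_indic// setIT.
apply: (@le_lt_trans _ _ (leb [set` `[(-1 : R)%R, 1%R]])); first exact: lexx.
rewrite lebesgue_measure_itv /=.
by case: ifP => _; rewrite ?ltry// -EFinB ltry.
Qed.

Lemma cap_scale x a : 0 < x -> (\int[leb]_s (cap x a s)%:E = (x ^+ a.+1 * cap_int a)%:E)%E.
Proof.
move=> x0; have xn : x != 0 by rewrite gt_eqF.
have c0 s : (0 <= (cap x a s)%:E)%E by rewrite lee_fin cap_ge0.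
rewrite -(integral_affine 0 (measurable_cap x a) c0 xn) gtr0_norm//.
rewrite exprS -mulrA EFinM; congr (_ * _)%E; rewrite EFinM -cap_intE.
rewrite -ge0_integralZl ?lee_fin ?exprn_ge0 ?(ltW x0)//; last 2 first.
- exact: measurable_cap.
- by move=> s _; rewrite lee_fin cap_ge0.
apply: eq_integral => s _; rewrite -EFinM addr0; congr EFin; rewrite /cap mulrA; congr (_ * _).
  rewrite -exprMn; congr (_ ^+ _).
  have xE : x = Num.sqrt (x ^+ 2) by rewrite sqrtr_sqr gtr0_norm.
  by rewrite [X in _ = X * _]xE -sqrtrM ?sqr_ge0//; congr Num.sqrt; ring.
rewrite !indicE; congr (nat_of_bool _)%:R; apply/idP/idP; rewrite !inE /= !in_itv /= => /andP[h1 h2].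
  by apply/andP; split; nra.
by apply/andP; split; nra.
Qed.

Lemma ball_vol_flat A x : body A -> 0 < x ->
  ball_vol (flat A) x = \sum_(a < n.+1) sc A a * cap_int a * x ^+ a.+1.
Proof.
move=> bA x0; apply: EFin_inj; rewrite /ball_vol.
have bF := body_minksum (body_flat bA) (body_mscal x (@body_unit_ball R n.+1)).
rewrite -(volE bF.1) [LHS]volumeS.
transitivity (\int[leb]_s \sum_(a < n.+1) (sc A a * cap x a s)%:E)%E.
  apply: eq_integral => s _; rewrite sumEFin.
  have [sx|sx] := boolP (s \in `[- x, x]%classic); last first.
    rewrite (_ : [set y | _] = set0); last first.
      apply/seteqP; split=> y // [_ [_ [[y' Ay' <-] [b Bb <-] e]]].
      have := congr1 (@vhead R n) e; rewrite vheadD !vcons_head vheadZ add0r => sE.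
      case/negP: sx; rewrite inE /= in_itv /= sE -ler_norml normrM gtr0_norm//.
      rewrite ler_piMr ?(ltW x0)// -(@ler_pXn2r _ 2)// ?nnegrE// expr1n real_normK ?num_real//.
      apply: le_trans (coord_sqr_le_dot b ord0) _; exact: Bb.
    rewrite volE; last exact: compact0.
    rewrite vol_set0 big1// => a _; by rewrite /cap indicE (negPf sx) !mulr0.
  have sx2 : 0 <= x ^+ 2 - s ^+ 2.
    move: sx; rewrite inE /= in_itv /= -ler_norml => sx.
    by rewrite subr_ge0 -(real_normK (num_real s)) ler_pXn2r ?nnegrE ?(ltW x0).
  set r := Num.sqrt (x ^+ 2 - s ^+ 2).
  have r0 : 0 <= r by exact: sqrtr_ge0.
  have -> : [set y | minksum (flat A) (mscal x (@unit_ball R n.+1)) (vcons (s, y))] =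
      minksum A (mscal r (@unit_ball R n)).
    apply/seteqP; split=> [y [_ [_ [[y' Ay' <-] [b Bb <-] e]]]|_ [y [_ [Ay [b Bb <-] ->]]]] /=.
      have := congr1 (@vhead R n) e; rewrite vheadD !vcons_head vheadZ add0r => sE.
      have := congr1 tl e; rewrite vtailD !vcons_tail vtailZ => yE.
      exists y', (x *: tl b); split=> //; apply: mem_mscal_ball => //.
      rewrite -(@ler_pXn2r _ 2)// ?nnegrE ?enorm_ge0// enorm_sqr sqr_sqrtr// sE.
      move: Bb; rewrite /unit_ball /= -{1 2}(vconsK b) dot_vcons dotZl dotZr => Bb.
      have : x ^+ 2 * (vhead b * vhead b + dot (tl b) (tl b)) <= x ^+ 2 by rewrite ler_piMr ?sqr_ge0.
      by rewrite mulrDr exprMn !expr2; lra.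
    exists (vcons (0, y)), (vcons (s, r *: b)); split; first by exists y.
    - apply: mem_mscal_ball; first exact: ltW.
      rewrite -(@ler_pXn2r _ 2)// ?nnegrE ?enorm_ge0 ?(ltW x0)// enorm_sqr dot_vcons dotZl dotZr mulrA -expr2.
      rewrite -expr2 sqr_sqrtr//; move: Bb; rewrite /unit_ball /= => Bb.
      have : (x ^+ 2 - s ^+ 2) * dot b b <= x ^+ 2 - s ^+ 2 by rewrite ler_piMr.
      by rewrite !expr2; lra.
    - by rewrite vconsD add0r.
  rewrite volE; last first.
    exact: (body_minksum bA (body_mscal _ (body_unit_ball _))).1.
  congr EFin; rewrite -/(ball_vol A r) steiner//; apply: eq_bigr => a _.
  by rewrite /cap indicE sx mulr1.
have sc0 (a : 'I_n.+1) : 0 <= sc A a by apply: sc_ge0 => //; exact: leq_ord.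
rewrite ge0_integral_sum//; last 2 first.
- move=> a; under eq_fun do rewrite EFinM; apply: measurable_funeM; exact: measurable_cap.
- by move=> a s _; rewrite lee_fin mulr_ge0 ?cap_ge0.
rewrite -sumEFin; apply: eq_bigr => a _.
under eq_integral do rewrite EFinM.
rewrite ge0_integralZl//; last 3 first.
- exact: measurable_cap.
- by move=> s _; rewrite lee_fin cap_ge0.
- by rewrite lee_fin.
by rewrite cap_scale// -EFinM; congr EFin; ring.
Qed.

Lemma sc_flat A a : body A -> (a <= n)%N -> sc (flat A) a.+1 = sc A a * cap_int a.
Proof.
move=> bA an.
pose q := \sum_(b < n.+1) (sc A b * cap_int b) *: 'X^(b.+1) : {poly R}.
have qE x : q.[x] = \sum_(b < n.+1) sc A b * cap_int b * x ^+ b.+1.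
  by rewrite /q horner_sum; apply: eq_bigr => b _; rewrite hornerZ hornerXn.
pose p := \sum_(b < n.+2) sc (flat A) b *: 'X^b : {poly R}.
have pE x : p.[x] = \sum_(b < n.+2) sc (flat A) b * x ^+ b.
  by rewrite /p horner_sum; apply: eq_bigr => b _; rewrite hornerZ hornerXn.
(* The slice formula is available for x > 0; both polynomials agree there, and the value at 0
   follows by continuity. *)
have flat0 : sc (flat A) 0 = 0.
  have h g : ispoly g -> (forall x, 0 < x -> x < 1 -> g x <= 0) -> g 0 <= 0.
    by move=> gp g0; exact: (ispoly_le0 gp ltr01).
  have ip : ispoly (fun x => p.[x]) by exists p.
  have iq : ispoly (fun x => q.[x]) by exists q.
  have pq x : 0 < x -> p.[x] = q.[x].
    by move=> x0; rewrite pE qE -steiner ?(ltW x0)//; [exact: ball_vol_flat|exact: body_flat].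
  have p0 : p.[0] = sc (flat A) 0.
    by rewrite pE big_ord_recl expr0 mulr1 big1 ?addr0// => i _; rewrite expr0n mulr0.
  have q0 : q.[0] = 0 by rewrite qE big1// => i _; rewrite expr0n mulr0.
  apply/eqP; rewrite eq_le -p0 -[X in _ <= X]q0 -subr_le0 -[X in _ - X <= 0]mul1r -mulNr.
  rewrite (ispoly_le0 (ispolyD ip (ispolyM (ispoly_cst (-1)) iq)) ltr01)/=; last first.
    by move=> x x0 _; rewrite pq// mulN1r subrr.
  rewrite -[X in X <= _]q0 -subr_le0 -[X in _ - X <= 0]mul1r -mulNr.
  apply: (ispoly_le0 (ispolyD iq (ispolyM (ispoly_cst (-1)) ip)) ltr01).
  by move=> x x0 _; rewrite pq// mulN1r subrr.
have := @fit_poly R n.+1 (ball_vol (flat A))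
  (fun b => if b is b'.+1 then sc A b' * cap_int b' else sc (flat A) 0) a.+1 an.
apply => i _; have [i0|i0] := posnP i.
  have h0 : (0 : R) <= i%:R by exact: ler0n.
  rewrite (steiner (body_flat bA) h0) i0 [LHS]big_ord_recl [RHS]big_ord_recl; congr (_ + _).
  by rewrite !big1// => j _; rewrite /= exprS mulr0n mul0r mulr0.
rewrite ball_vol_flat ?ltr0n// [RHS]big_ord_recl flat0 mul0r add0r.
by apply: eq_bigr => j _.
Qed.

End Axis.

(** The integral is not evaluated: [sc_flat] is read for a point, whose top coefficients are kappa_a
    in R^a and kappa_(a+1) in R^(a+1). *)
Lemma cap_int_kappa (R : realType) a : @cap_int R a = @kappa R a.+1 / @kappa R a.
Proof.
have b1 := @body_set1 R a 0.
have ne : [set (0 : 'rV[R]_a)] !=set0 by exists 0.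
have ne' : flat [set (0 : 'rV[R]_a)] !=set0 by exists (vcons (0, 0)), 0.
have := sc_flat b1 (leqnn a); rewrite (sc_top (body_flat b1) ne') (sc_top b1 ne).
by move=> ->; rewrite mulrAC divff ?mul1r// gt_eqF// kappa_gt0.
Qed.

Lemma ivol_flat (R : realType) n (A : set 'rV[R]_n) i : body A -> (i <= n)%N -> ivol (flat A) i = ivol A i.
Proof.
move=> bA ni; rewrite /ivol subSn// sc_flat ?leq_subr// cap_int_kappa.
by field; rewrite !gt_eqF ?kappa_gt0.
Qed.

Lemma vol_flat (R : realType) n (A : set 'rV[R]_n) : body A -> vol (flat A) = 0.
Proof.
move=> bA; have bF := body_flat bA.
pose p := \sum_(b < n.+1) (sc A b * @cap_int R b) *: 'X^(b.+1) : {poly R}.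
have pE x : p.[x] = \sum_(b < n.+1) sc A b * @cap_int R b * x ^+ b.+1.
  by rewrite /p horner_sum; apply: eq_bigr => b _; rewrite hornerZ hornerXn.
have p0 : p.[0] = 0 by rewrite pE big1// => i _; rewrite expr0n mulr0.
apply/eqP; rewrite eq_le vol_ge0 andbT -sc_vol// -[X in X <= _]addr0.
have ip : ispoly (fun x => p.[x]) by exists p.
have := ispoly_le0 (ispolyD (ispoly_cst (sc (flat A) 0)) (ispolyM (ispoly_cst (-1)) ip)) ltr01.
rewrite p0 mulr0; apply => x x0 _; rewrite mulN1r subr_le0 pE -ball_vol_flat// sc_vol//.
apply: le_vol; [exact: bF.1|exact: (body_minksum bF (body_mscal _ (body_unit_ball _))).1|].
by move=> z Fz; exists z, 0; rewrite addr0; split=> //; exists 0; [exact: ball0|rewrite scaler0].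
Qed.

(** * Bodies in an arbitrary hyperplane *)

Section Hyperplane.
Context {R : realType} {n : nat}.
Implicit Types (K : set 'rV[R]_n.+1) (u : 'rV[R]_n.+1).

Lemma axis_dot (z : 'rV[R]_n.+1) : dot (@axis R n) z = vhead z.
Proof. by rewrite /axis -{1}(vconsK z) dot_vcons mul1r dot0l addr0. Qed.

(** The reflection exchanging [axis] and u turns the hyperplane into a horizontal one. *)
Lemma hyperplane_flat K u p : body K -> dot u u = 1 -> (forall x, K x -> dot u x = p) ->
  exists (Q : 'M[R]_n.+1) (A : set 'rV[R]_n),
  [/\ Q *m Q^T = 1%:M, @axis R n *m Q = u, body A &
      [set x | K (x *m Q)] = minksum (flat A) [set p *: (@axis R n)]].
Proof.
move=> bK u1 Kp; pose Q := refl_mx (@axis R n - u).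
have a1 : dot (@axis R n) (@axis R n) = 1 by rewrite axis_dot vcons_head.
have QQ : Q *m Q^T = 1%:M by exact: refl_mx_orth.
have aQ : @axis R n *m Q = u by rewrite refl_mxE refl_swap// a1.
pose K1 := [set x | K (x *m Q)].
have bK1 : body K1 by apply: body_preimage_mulmx => //; exact: orth_unitmx.
exists Q, (@vtail R n @` K1); split=> //; first exact: body_vtail.
have hK x : K1 x -> vhead x = p.
  by move=> Kx; rewrite -axis_dot -(dot_mulmx_orth _ _ QQ) aQ; exact: Kp.
rewrite -/K1; apply/seteqP; split=> [x Kx|_ [_ [_ [[_ [x Kx <-] <-] -> ->]]]].
  exists (vcons (0, vtail x)), (p *: @axis R n); split=> //; first by exists (vtail x) => //; exists x.
  by rewrite scale_axis vconsD add0r addr0 -(hK x Kx) vconsK.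
by rewrite scale_axis vconsD add0r addr0 -(hK x Kx) vconsK.
Qed.

Lemma ivol_hyperplane_top K u p : body K -> dot u u = 1 -> (forall x, K x -> dot u x = p) ->
  ivol K n.+1 = 0.
Proof.
move=> bK u1 Kp; have [Q [A [QQ aQ bA e]]] := hyperplane_flat bK u1 Kp.
have bF := body_flat bA.
by rewrite -(ivol_orth _ QQ bK) e (ivol_translate _ _ bF) (ivol_top bF) vol_flat.
Qed.

Lemma ivol_hyperplane_add K u p t i : body K -> dot u u = 1 -> (forall x, K x -> dot u x = p) ->
  0 <= t -> (i <= n)%N ->
  ivol (minksum K (mscal t (seg u))) i.+1 = ivol K i.+1 + t * ivol K i.
Proof.
move=> bK u1 Kp t0 ni; have [Q [A [QQ aQ bA e]]] := hyperplane_flat bK u1 Kp.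
have uQ := orth_unitmx QQ; have bF := body_flat bA.
have bs y : body (mscal t (seg y)) by apply: body_mscal; exact: body_seg.
have E : [set x | minksum K (mscal t (seg u)) (x *m Q)] =
    minksum (minksum (flat A) (mscal t (seg (@axis R n)))) [set p *: (@axis R n)].
  by rewrite (minksum_mulmx _ _ uQ) e (mscal_mulmx _ _ uQ) -{1}aQ (seg_mulmx _ uQ) minksumAC.
have bK1 := body_minksum bF (bs _ (@axis R n)).
rewrite -(ivol_orth _ QQ (body_minksum bK (bs _ u))) E (ivol_translate _ _ bK1).
rewrite (ivol_add_axis bF t0 ni) -!(ivol_orth _ QQ bK) e !(ivol_translate _ _ bF).
by rewrite vtail_flat (ivol_flat bA ni).
Qed.

Lemma ivol1_add_unit K u t : body K -> K !=set0 -> dot u u = 1 -> 0 <= t ->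
  ivol (minksum K (mscal t (seg u))) 1 = ivol K 1 + t.
Proof.
move=> bK [k Kk] u1 t0.
have bp := @body_set1 R n.+1 (0 : 'rV[R]_n.+1).
have pp (x : 'rV[R]_n.+1) : [set (0 : 'rV[R]_n.+1)] x -> dot u x = 0 by move=> ->; rewrite dot0r.
have [Q [A [QQ aQ bA e]]] := hyperplane_flat bp u1 pp.
have uQ := orth_unitmx QQ.
have bs y : body (mscal t (seg y)) by apply: body_mscal; exact: body_seg.
have bK1 : body [set x | K (x *m Q)] by exact: body_preimage_mulmx.
have E : [set x | minksum K (mscal t (seg u)) (x *m Q)] =
    minksum [set x | K (x *m Q)] (mscal t (seg (@axis R n))).
  by rewrite (minksum_mulmx _ _ uQ) (mscal_mulmx _ _ uQ) -{1}aQ (seg_mulmx _ uQ).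
rewrite -(ivol_orth _ QQ (body_minksum bK (bs _ u))) E (ivol_add_axis bK1 t0 (leq0n n)).
rewrite (ivol_orth _ QQ bK) ivol0 ?mulr1//; first exact: body_vtail.
by exists (vtail (k *m invmx Q)), (k *m invmx Q) => //=; rewrite mulmxKV.
Qed.

End Hyperplane.

(** * Log-concavity of j! V_j *)

Section LogConcavity.
Context {R : realType}.

(** Up to a constant, j! V_j is a mixed volume divided by (d - j)! kappa_(d-j), so this divisor must
    be log-convex. The reason is that V_1 grows from the (m+1)-ball to the (m+2)-ball containing it,
    where V_1 of the n-ball is n kappa_n / kappa_(n-1). *)
Lemma kappa_logconvex m : (m.+1`!%:R * @kappa R m.+1) ^+ 2 <=
  (m`!%:R * @kappa R m) * (m.+2`!%:R * @kappa R m.+2).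
Proof.
have bB := @body_unit_ball R m.+1.
have h : ivol (@unit_ball R m.+1) 1 <= ivol (@unit_ball R m.+2) 1.
  rewrite -ivol_flat//; apply: le_ivol; [exact: body_flat|exact: body_unit_ball|].
  by move=> _ [y yB <-]; move: yB; rewrite /unit_ball /= dot_vcons mul0r add0r.
rewrite !ivol_ball1//= in h.
have k0 := @kappa_gt0 R m; have k1 := @kappa_gt0 R m.+1; have k2 := @kappa_gt0 R m.+2.
have : m.+1%:R * @kappa R m.+1 ^+ 2 <= m.+2%:R * @kappa R m.+2 * @kappa R m.
  move: h; rewrite ler_pdivrMr// mulrAC ler_pdivlMr// expr2 mulrA.
  by [].
move=> {}h; have f0 : 0 <= m`!%:R * m.+1`!%:R :> R by rewrite mulr_ge0.
have -> : (m.+1`!%:R * @kappa R m.+1) ^+ 2 = m`!%:R * m.+1`!%:R * (m.+1%:R * @kappa R m.+1 ^+ 2).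
  by rewrite !factS !natrM; ring.
have -> : (m`!%:R * @kappa R m) * (m.+2`!%:R * @kappa R m.+2) =
    m`!%:R * m.+1`!%:R * (m.+2%:R * @kappa R m.+2 * @kappa R m).
  by rewrite !factS !natrM; ring.
exact: ler_wpM2l.
Qed.

Lemma ivol_logconcave d (K : set 'rV[R]_d) j : body K -> (j + 2 <= d)%N ->
  (j`!%:R * ivol K j) * (j.+2`!%:R * ivol K j.+2) <= (j.+1`!%:R * ivol K j.+1) ^+ 2.
Proof.
move=> bK jd; pose b := (d - j.+2)%N.
have e0 : (d - j = b.+2)%N by rewrite /b; lia.
have e1 : (d - j.+1 = b.+1)%N by rewrite /b; lia.
have e2 : (d - j.+2 = b)%N by [].
have h : (b + 2 <= d)%N by rewrite /b; lia.
have w := sc_logconcave bK h.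
have kl := kappa_logconvex b.
have kp m : 0 < m`!%:R * @kappa R m by rewrite mulr_gt0 ?kappa_gt0// ltr0n fact_gt0.
have E i c : (i + c = d)%N -> i`!%:R * ivol K i = d`!%:R * (sc K c / 'C(d, c)%:R) / (c`!%:R * @kappa R c).
  move=> ic; have cd : (c <= d)%N by lia.
  rewrite /ivol (_ : (d - i = c)%N); last by lia.
  rewrite -(bin_fact cd) (_ : (d - c = i)%N); last by lia.
  rewrite !natrM; field; rewrite !pnatr_eq0 -!lt0n !fact_gt0 bin_gt0 cd gt_eqF ?kappa_gt0//.
rewrite (E j b.+2) ?(E j.+1 b.+1) ?(E j.+2 b); try by rewrite /b; lia.
set w0 := sc K b / _ in w *; set w1 := sc K b.+1 / _ in w *; set w2 := sc K b.+2 / _ in w *.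
have k0 := kp b; have k1 := kp b.+1; have k2 := kp b.+2.
set x0 := _ * @kappa R b in kl k0 *; set x1 := _ * @kappa R b.+1 in kl k1 *; set x2 := _ * @kappa R b.+2 in kl k2 *.
have -> : d`!%:R * w2 / x2 * (d`!%:R * w0 / x0) = d`!%:R ^+ 2 * (w0 * w2) / (x0 * x2).
  by field; rewrite !gt_eqF.
have -> : (d`!%:R * w1 / x1) ^+ 2 = d`!%:R ^+ 2 * w1 ^+ 2 / x1 ^+ 2 by field; rewrite gt_eqF.
have w00 : 0 <= w2 * w0 by rewrite /w0 /w2 mulr_ge0// divr_ge0// sc_ge0//; lia.
apply: ler_pM.
- by rewrite mulr_ge0 ?sqr_ge0// mulrC.
- by rewrite invr_ge0 mulr_ge0// ltW.
- by apply: ler_wpM2l => //; exact: sqr_ge0.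
- have p1 : 0 < x1 ^+ 2 by exact: exprn_gt0.
  have p2 : 0 < x0 * x2 by exact: mulr_gt0.
  by rewrite lef_pV2 ?posrE.
Qed.

End LogConcavity.

(** * Cones over slices and the mean width of triangles *)

Section ConeInequality.
Context {R : realType} {n : nat}.
Implicit Types (K S : set 'rV[R]_n.+1) (u x y a b : 'rV[R]_n.+1).

(** By affinity in the segment length, also the derivative of V_j in the direction of the segment: a
    mixed volume up to a constant. *)
Definition growth K x j : R := ivol (minksum K (seg x)) j - ivol K j.

Lemma ivol_growth K x t j : body K -> 0 <= t ->
  ivol (minksum K (mscal t (seg x))) j = ivol K j + t * growth K x j.
Proof. by move=> bK t0; rewrite ivol_add_seg. Qed.

Lemma body_add_seg K x t : body K -> body (minksum K (mscal t (seg x))).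
Proof. by move=> bK; apply: body_minksum => //; apply: body_mscal; exact: body_seg. Qed.

(** V_j of the sums is affine in the segment length t and monotone in the body, so the slopes
    compare as t tends to infinity. *)
Lemma le_growth K S x j : body K -> body S -> K `<=` S -> growth K x j <= growth S x j.
Proof.
move=> bK bS KS; rewrite -subr_le0.
have := ispoly_le0 (ispolyD (ispoly_cst (growth K x j - growth S x j)) (ispolyM (ispoly_cst (- ivol S j)) ispoly_id)) ltr01.
rewrite mulr0 addr0; apply => s s0 _.
have t0 : 0 <= s^-1 by rewrite invr_ge0 ltW.
have : ivol (minksum K (mscal s^-1 (seg x))) j <= ivol (minksum S (mscal s^-1 (seg x))) j.
  by apply: le_ivol; [exact: body_add_seg|exact: body_add_seg|exact: sub_minksum].
rewrite !ivol_growth// => h; have v0 := ivol_ge0 j bK.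
have : s^-1 * (growth K x j - growth S x j) <= ivol S j by lra.
by rewrite ler_pdivrMl//; lra.
Qed.

Lemma bernoulli_poly (j : nat) : exists p : {poly R}, forall e,
  (1 + e) ^+ j = 1 + j%:R * e + e ^+ 2 * p.[e].
Proof.
elim: j => [|j [p hp]]; first by exists 0 => e; rewrite horner0 expr0; ring.
exists (p + 'X * p + j%:R%:P) => e; rewrite exprS hp !hornerE -[j.+1%:R]natr1; ring.
Qed.

(** The body (1 + e) S contains S + e [0, a - b] + e b, as e [b, a] lies in e S. The terms of first
    order in e give the bound. *)
Lemma growth_diff S a b j : body S -> S a -> S b -> (j <= n.+1)%N ->
  growth S (a - b) j <= j%:R * ivol S j.
Proof.
move=> bS Sa Sb jn; have [p hp] := bernoulli_poly j.
rewrite -subr_le0; set x := a - b; set V := ivol S j.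
have := @ispoly_le0 _ 1 (fun e => growth S x j - j%:R * V + e * (- (V * p.[e]))).
rewrite mul0r addr0; apply => //.
  exists ((growth S x j - j%:R * V)%:P + 'X * (- (V%:P * p))) => e.
  by rewrite !hornerE.
move=> e e0 _; have S0 : S !=set0 by exists a.
have e1 : 0 < 1 + e by rewrite addr_gt0.
have : ivol (minksum (minksum S (mscal e (seg x))) [set e *: b]) j <= ivol (mscal (1 + e) S) j.
  apply: le_ivol.
  - by apply: body_minksum; [exact: body_add_seg|exact: body_set1].
  - exact: body_mscal.
  move=> _ [_ [_ [[s [_ [Ss [_ [t /andP[t0 t1] <-] <-] ->]]] -> ->]]].
  exists ((1 + e)^-1 *: s + (e / (1 + e)) *: (t *: a + (1 - t) *: b)); last first.
    by apply/rowP => i; rewrite !mxE; field; rewrite gt_eqF.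
  apply: bS.2 => //; rewrite ?invr_ge0 ?divr_ge0 ?(ltW e0) ?(ltW e1)//.
    by apply: bS.2 => //; [rewrite subr_ge0|rewrite addrC subrK].
  by field; rewrite gt_eqF.
rewrite ivol_translate ?ivol_growth ?(ltW e0)//; last exact: body_add_seg.
rewrite ivol_mscal// hp -/V => h.
have : e * (growth S x j - j%:R * V + e * (- (V * p.[e]))) <= 0.
  by rewrite expr2 in h; lra.
by rewrite pmulr_rle0.
Qed.

Lemma seg_opp x : seg (- x) = minksum (seg x) [set - x].
Proof.
apply/seteqP; split=> [_ [t /andP[t0 t1] <-]|_ [_ [_ [[t /andP[t0 t1] <-] -> ->]]]].
  exists ((1 - t) *: x), (- x); split=> //; last by apply/rowP => i; rewrite !mxE; ring.
  by exists (1 - t) => //=; apply/andP; split; lra.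
exists (1 - t); last by apply/rowP => i; rewrite !mxE; ring.
by rewrite /=; apply/andP; split; lra.
Qed.

(** The new vector is the mirror image of -x. The mirror image of K is a translate of K, and [0, -x]
    is a translate of [0, x]. *)
Lemma growth_refl K u p x j : body K -> dot u u = 1 -> (forall z, K z -> dot u z = p) ->
  growth K (2 * dot u x *: u - x) j = growth K x j.
Proof.
move=> bK u1 Kp; rewrite /growth; congr (_ - _).
have QQ := refl_mx_orth u; have uQ := orth_unitmx QQ.
have bs y : body (minksum K (seg y)) by apply: body_minksum => //; exact: body_seg.
rewrite -(ivol_orth j QQ (bs _)) (minksum_mulmx _ _ uQ).
have xE : 2 * dot u x *: u - x = (- x) *m refl_mx u.
  rewrite refl_mxE /refl u1 divr1 dotNl (dotC x u).
  by apply/rowP => i; rewrite !mxE; ring.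
rewrite xE (seg_mulmx _ uQ).
have KE : [set z | K (z *m refl_mx u)] = minksum K [set - (2 * p) *: u].
  have rE z : dot u z = p -> refl u z = z - (2 * p) *: u.
    by move=> zp; rewrite /refl u1 divr1 dotC zp.
  rewrite minksum_set1; apply/seteqP; split=> z /=; rewrite refl_mxE => Kz.
    have zp := Kp _ Kz; have : dot u z = - p.
      by rewrite -(reflK u z) {1}/refl dotBr dotZr u1 divr1 mulr1 (dotC _ u) zp; ring.
    move=> {}zp; move: Kz; rewrite /refl u1 divr1 dotC zp; congr K.
    by apply/rowP => i; rewrite !mxE; ring.
  have zp := Kp _ Kz; rewrite dotBr dotZr u1 mulr1 in zp.
  move: Kz; congr K; rewrite /refl u1 divr1 dotC; have -> : dot u z = - p by lra.
  by apply/rowP => i; rewrite !mxE; ring.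
rewrite KE seg_opp -minksumA (minksumAC K).
by rewrite !ivol_translate//; apply: body_minksum => //; exact: body_set1.
Qed.

(** The vector x' = 2 h u - x has the same growth as x, and x + x' = 2 h u. Hence K + s [0, x] + s
    [0, x'] contains K + 2 h s [0, u], whose intrinsic volume is known exactly; compare the terms
    linear in s. *)
Lemma growth_hyperplane K u p x i : body K -> dot u u = 1 -> (forall z, K z -> dot u z = p) ->
  (i <= n)%N -> 0 <= dot u x -> dot u x * ivol K i <= growth K x i.+1.
Proof.
move=> bK u1 Kp ni h0; set h := dot u x in h0 *; pose x' := 2 * h *: u - x.
have gx' : growth K x' i.+1 = growth K x i.+1 by exact: growth_refl Kp.
pose c := growth (minksum K (seg x)) x' i.+1 - growth K x' i.+1.
rewrite -subr_le0.
have := ispoly_le0 (ispolyD (ispoly_cst (2 * (h * ivol K i - growth K x i.+1))) (ispolyM (ispoly_cst (- c)) ispoly_id)) ltr01.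
rewrite mulr0 addr0 pmulr_rle0//; apply => s s0 _.
have s1 := ltW s0.
have hs : 0 <= s * (2 * h) by rewrite mulr_ge0// mulr_ge0.
have bsx : body (minksum K (seg x)) by apply: body_minksum => //; exact: body_seg.
have bsx' : body (minksum K (seg x')) by apply: body_minksum => //; exact: body_seg.
have lo : ivol K i.+1 + s * (2 * h) * ivol K i <=
    ivol (minksum (minksum K (mscal s (seg x))) (mscal s (seg x'))) i.+1.
  rewrite -(ivol_hyperplane_add bK u1 Kp hs ni); apply: le_ivol.
  - exact: body_add_seg.
  - by apply: body_add_seg; exact: body_add_seg.
  move=> _ [k [_ [Kk [_ [t t01 <-] <-] ->]]].
  exists (k + s *: (t *: x)), (s *: (t *: x')); split.
  - by exists k, (s *: (t *: x)); split=> //; exists (t *: x) => //; exists t.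
  - by exists (t *: x') => //; exists t.
  - by apply/rowP => l; rewrite !mxE; ring.
have up : ivol (minksum (minksum K (mscal s (seg x))) (mscal s (seg x'))) i.+1 =
    ivol K i.+1 + s * growth K x i.+1 + s * (growth K x' i.+1 + s * c).
  rewrite ivol_growth//; last exact: body_add_seg.
  rewrite ivol_growth//; congr (_ + _ * _).
  rewrite /growth (minksumAC K (mscal s (seg x))) !ivol_growth// /c /growth.
  by rewrite (minksumAC K (seg x')); ring.
rewrite up gx' in lo.
have : s * (2 * (h * ivol K i - growth K x i.+1) + - c * s) <= 0 by lra.
by rewrite pmulr_rle0.
Qed.

(* [S] contains, up to scaling, the cone over [K] with an apex at height
   [dot u (a - b)]. *)
Lemma cone_inequality K S u p a b i : body K -> body S -> K `<=` S -> dot u u = 1 ->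
  (forall z, K z -> dot u z = p) -> S a -> S b -> (i <= n)%N ->
  dot u (a - b) * ivol K i <= i.+1%:R * ivol S i.+1.
Proof.
move=> bK bS KS u1 Kp Sa Sb ni; have [h0|h0] := leP 0 (dot u (a - b)); last first.
  apply: (@le_trans _ _ 0); last by rewrite mulr_ge0// ivol_ge0.
  by rewrite mulr_le0_ge0 ?ivol_ge0// ltW.
apply: le_trans (growth_hyperplane bK u1 Kp ni h0) _.
apply: le_trans (le_growth _ _ bK bS KS) _.
exact: growth_diff.
Qed.

Lemma ivol1_add_seg K y : body K -> K !=set0 -> ivol (minksum K (seg y)) 1 = ivol K 1 + enorm y.
Proof.
move=> bK K0; have [->|y0] := eqVneq y 0.
  by rewrite seg0 minksum0 /enorm dot0l sqrtr0 addr0.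
have e0 := enorm_gt0 y0; rewrite -(ivol1_add_unit bK K0 (normalize y0) (ltW e0)); congr (ivol (minksum _ _) _).
apply/seteqP; split=> [_ [t t01 <-]|_ [_ [t t01 <-] <-]].
  exists (t *: ((enorm y)^-1 *: y)); first by exists t.
  by rewrite !scalerA; congr (_ *: _); field; rewrite gt_eqF.
by exists t => //; rewrite !scalerA; congr (_ *: _); field; rewrite gt_eqF.
Qed.

Lemma ivol1_point : ivol [set (0 : 'rV[R]_n.+1)] 1 = 0.
Proof.
have b0 := @body_set1 R n.+1 0; have ne : [set (0 : 'rV[R]_n.+1)] !=set0 by exists 0.
have := ivol_mscal b0 (ltr0n R 2) ne (isT : (1 <= n.+1)%N).
have -> : mscal 2 [set (0 : 'rV[R]_n.+1)] = [set 0].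
  by apply/seteqP; split=> [_ [_ -> <-]|_ ->] /=; [rewrite scaler0|exists 0; rewrite ?scaler0].
by rewrite expr1; lra.
Qed.

Lemma ivol1_seg y : ivol (seg y) 1 = enorm y.
Proof.
have -> : seg y = minksum [set 0] (seg y) by rewrite minksumC minksum0.
rewrite ivol1_add_seg ?ivol1_point ?add0r//; [exact: body_set1|by exists 0].
Qed.

Lemma enorm_le_ivol1 S a b : body S -> S a -> S b -> enorm (a - b) <= ivol S 1.
Proof.
move=> bS Sa Sb; rewrite -ivol1_seg -(ivol_translate b); last exact: body_seg.
apply: le_ivol => //; first by apply: body_minksum; [exact: body_seg|exact: body_set1].
move=> _ [_ [_ [[t /andP[t0 t1] <-] -> ->]]].
have -> : t *: (a - b) + b = t *: a + (1 - t) *: b by apply/rowP => i; rewrite !mxE; ring.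
by apply: bS.2; rewrite ?subr_ge0// addrC subrK.
Qed.

(** V_1 of a triangle is half its perimeter: the parallelogram spanned by x and y, with V_1 equal to
    |x| + |y|, is cut along the diagonal D into two halves exchanged by a point reflection, and V_1
    is additive under the cut. *)
Lemma triangle_perimeter S a b c : body S -> S a -> S b -> S c ->
  enorm (c - b) + enorm (a - c) + enorm (a - b) <= 2 * ivol S 1.
Proof.
move=> bS Sa Sb Sc; pose x := c - b; pose y := a - c; pose D := a - b.
have xyD : x + y = D by rewrite /x /y /D addrC addrA subrK.
(* The part of x orthogonal to the diagonal, used as normal of the cut. If it is 0, the points are
   collinear and a single pair of them suffices. *)
pose nu := x - (dot x D / dot D D) *: D.
have nuD : dot nu D = 0.
  rewrite /nu dotBl dotZl; have [D0|D0] := eqVneq (dot D D) 0; last by rewrite divfK// subrr.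
  by have /eqP : dot D D == 0 by [rewrite D0]; move=> /eqP; rewrite dot_eq0 => /eqP->; rewrite !dot0r mulr0 subr0.
rewrite -/x -/y -/D.
have [nu0|nu0] := eqVneq nu 0.
  have h1 := enorm_le_ivol1 bS Sc Sb; have h2 := enorm_le_ivol1 bS Sa Sc; have h3 := enorm_le_ivol1 bS Sa Sb.
  rewrite -/x -/y -/D in h1 h2 h3.
  set s := dot x D / dot D D in nu0.
  have xE : x = s *: D by apply/eqP; rewrite -subr_eq0 -/nu nu0.
  have yE : y = (1 - s) *: D by rewrite scalerBl scale1r -xE -xyD addrAC subrr add0r.
  rewrite xE enormZ in h1 *; rewrite yE enormZ in h2 *.
  have e0 := enorm_ge0 D; set e := enorm D in e0 h1 h2 h3 *.
  have [s0|s0] := leP 0 s; have [s1|s1] := leP s 1.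
  - by rewrite ger0_norm// ger0_norm ?subr_ge0//; rewrite ger0_norm// in h1; nra.
  - by rewrite ger0_norm// ltr0_norm ?subr_lt0//; rewrite ger0_norm// in h1; nra.
  - by rewrite ltr0_norm// ger0_norm ?subr_ge0//; rewrite ger0_norm ?subr_ge0// in h2; nra.
  - by lra.
have nux : dot nu x = dot nu nu.
  have -> : dot nu nu = dot nu x - (dot x D / dot D D) * dot nu D by rewrite -dotZr -dotBr.
  by rewrite nuD mulr0 subr0.
have nuy : dot nu y = - dot nu nu.
  by rewrite -nux; have := nuD; rewrite -xyD dotDr; lra.
have np : 0 < dot nu nu by rewrite lt_neqAle dot_ge0 eq_sym dot_eq0 nu0.
pose P := minksum (seg x) (seg y).
have bP : body P by apply: body_minksum; exact: body_seg.
have P1 : ivol P 1 = enorm x + enorm y.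
  by rewrite ivol1_add_seg ?ivol1_seg//; [exact: body_seg|exists 0, 0; rewrite /= ?lexx ?ler01 ?scale0r].
have split := ivol_split nu 0 1 bP.
have slD : enorm D <= ivol (slice P nu 0) 1.
  rewrite -ivol1_seg; apply: le_ivol; [exact: body_seg|exact: body_slice|].
  move=> _ [t t01 <-]; split; last by rewrite dotZr nuD mulr0.
  by exists (t *: x), (t *: y); rewrite -scalerDr xyD; split=> //; exists t.
have PP s t : 0 <= s <= 1 -> 0 <= t <= 1 -> P (s *: x + t *: y).
  by move=> s01 t01; exists (s *: x), (t *: y); split=> //; [exists s|exists t].
have nst s t : dot nu (s *: x + t *: y) = (s - t) * dot nu nu.
  by rewrite dotDr !dotZr nux nuy; ring.
have low : ivol (lower_part P nu 0) 1 = ivol (upper_part P nu 0) 1.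
  have QQ : (- 1%:M : 'M[R]_n.+1) *m (- 1%:M)^T = 1%:M.
    by rewrite linearN /= trmx1 mulmxN mulNmx mulmx1 opprK.
  rewrite -(ivol_orth 1 QQ (body_lower_part nu 0 bP)) -(ivol_translate D); last first.
    by apply: body_preimage_mulmx; [exact: orth_unitmx|exact: body_lower_part].
  congr (ivol _ 1); rewrite minksum_set1; apply/seteqP; split=> z /=;
    rewrite mulmxN mulmx1 opprB => -[].
    move=> [_ [_ [[s s01 <-] [t t01 <-] e]]] h.
    have zE : z = (1 - s) *: x + (1 - t) *: y.
      have -> : z = D - (s *: x + t *: y) by rewrite -e; apply/rowP => i; rewrite !mxE; ring.
      by rewrite -xyD; apply/rowP => i; rewrite !mxE; ring.
    move: h; rewrite e nst pmulr_lle0// => h; have /andP[? ?] := s01; have /andP[? ?] := t01.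
    split; first by rewrite zE; apply: PP; apply/andP; split; lra.
    by rewrite zE nst mulr_ge0 ?(ltW np)//; lra.
  move=> [_ [_ [[s s01 <-] [t t01 <-] zE]]] h; have /andP[? ?] := s01; have /andP[? ?] := t01.
  move: h; rewrite zE nst pmulr_lge0// => h.
  have -> : D - (s *: x + t *: y) = (1 - s) *: x + (1 - t) *: y.
    by rewrite -xyD; apply/rowP => i; rewrite !mxE; ring.
  split; first by apply: PP; apply/andP; split; lra.
  by rewrite nst mulr_le0_ge0 ?(ltW np)//; lra.
have upS : ivol (upper_part P nu 0) 1 <= ivol S 1.
  have bU := body_upper_part nu 0 bP; rewrite -(ivol_translate b 1 bU).
  apply: le_ivol => //; first by apply: body_minksum => //; exact: body_set1.
  move=> _ [_ [_ [[[_ [_ [[s /andP[s0 s1] <-] [t /andP[t0 t1] <-] ->]]] h] -> ->]]].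
  move: h; rewrite nst pmulr_lge0// subr_ge0 => st.
  have -> : s *: x + t *: y + b = (1 - s) *: b + s *: ((1 - t / s) *: c + (t / s) *: a).
    have [s00|s00] := eqVneq s 0.
      have t00 : t = 0 by lra.
      by rewrite s00 t00 !scale0r subr0 scale1r !add0r addr0.
    by apply/rowP => i; rewrite !mxE; field.
  apply: bS.2 => //; rewrite ?subr_ge0 ?subrK//.
  have [s00|s00] := eqVneq s 0.
    by rewrite s00 invr0 mulr0 subr0 scale1r scale0r addr0.
  have sp : 0 < s by rewrite lt_neqAle eq_sym s00.
  by apply: bS.2 => //; rewrite ?subrK// ?subr_ge0 ?divr_ge0// ler_pdivrMr// mul1r.
rewrite P1 low in split; lra.
Qed.

Lemma ivol1_cube : ivol (@unit_cube R n.+1) 1 <= n.+1%:R.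
Proof.
pose C (r : seq 'I_n.+1) := foldr (fun i A => minksum A (seg (delta_mx ord0 i : 'rV[R]_n.+1))) [set 0] r.
have C0 r : C r 0.
  by elim: r => //= i r IH; exists 0, 0; rewrite addr0; split=> //; exists 0; rewrite /= ?lexx ?ler01 ?scale0r.
have bC r : body (C r).
  by elim: r => [|i r IH] /=; [exact: body_set1|apply: body_minksum => //; exact: body_seg].
have C1 r : ivol (C r) 1 = (size r)%:R.
  elim: r => [|i r IH] /=; first exact: ivol1_point.
  rewrite ivol1_add_seg// ?IH; last by exists 0.
  rewrite -natr1; congr (_ + _).
  rewrite /enorm /dot (bigD1 i)//= mxE !eqxx mul1r big1 ?addr0 ?sqrtr1// => j ji.
  by rewrite mxE eqxx (negPf ji) mul0r.
have -> : n.+1%:R = ivol (C (enum 'I_n.+1)) 1 by rewrite C1 size_enum_ord.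
have sub : @unit_cube R n.+1 `<=` C (enum 'I_n.+1).
  move=> x xc; rewrite (row_sum_delta x) -big_enum.
  elim: (enum _) => [|i r IH]; first by rewrite big_nil; exact: C0.
  by rewrite big_cons /= addrC; exists (\sum_(j <- r) x ord0 j *: delta_mx ord0 j), (x ord0 i *: delta_mx ord0 i);
    split=> //; exists (x ord0 i) => //; exact: xc.
apply: le_ivol => //; split; last first.
  move=> x y s t xc yc s0 t0 st i; rewrite !mxE; have /andP[? ?] := xc i; have /andP[? ?] := yc i.
  by apply/andP; split; nra.
have -> : @unit_cube R n.+1 = [set x | forall i, (const_mx 0 : 'rV[R]_n.+1) ord0 i <= x ord0 i <= (const_mx 1 : 'rV[R]_n.+1) ord0 i].
  by apply/seteqP; split=> x xc i; have := xc i; rewrite !mxE.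
exact: (@compact_box R n.+1).
Qed.

Lemma body_unit_cube : body (@unit_cube R n.+1).
Proof.
split; last first.
  move=> x y s t xc yc s0 t0 st i; rewrite !mxE; have /andP[? ?] := xc i; have /andP[? ?] := yc i.
  by apply/andP; split; nra.
have -> : @unit_cube R n.+1 = [set x | forall i, (const_mx 0 : 'rV[R]_n.+1) ord0 i <= x ord0 i <= (const_mx 1 : 'rV[R]_n.+1) ord0 i].
  by apply/seteqP; split=> x xc i; have := xc i; rewrite !mxE.
exact: (@compact_box R n.+1).
Qed.

(** Otherwise K lies in a cube of edge 2 r, a sum of n + 1 segments of this length, which bounds
    V_1. *)
Lemma exists_far_point K c r : body K -> K c -> 0 < r -> 2 * r * n.+1%:R < ivol K 1 ->
  exists2 z, K z & r < enorm (z - c).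
Proof.
move=> bK Kc r0 Kr; apply: contrapT => nz.
have close z : K z -> enorm (z - c) <= r by move=> Kz; rewrite leNgt; apply/negP => h; apply: nz; exists z.
have bcube := body_unit_cube.
have sub : K `<=` minksum (mscal (2 * r) (@unit_cube R n.+1)) [set c - r *: const_mx 1].
  move=> z Kz; rewrite minksum_set1 /= mscal_gt0E ?mulr_gt0// /unit_cube /= => i.
  have : `|(z - c) ord0 i| <= r.
    apply: le_trans (close z Kz); rewrite -(@ler_pXn2r _ 2)// ?nnegrE ?enorm_ge0// enorm_sqr.
    by rewrite real_normK ?num_real// coord_sqr_le_dot.
  rewrite !mxE ler_norml => /andP[h1 h2].
  by rewrite mulr1 mulrC ler_pdivlMr ?mulr_gt0// ler_pdivrMr ?mulr_gt0//; apply/andP; split; lra.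
have : ivol K 1 <= 2 * r * n.+1%:R.
  apply: le_trans (le_ivol 1 bK _ sub) _.
    by apply: body_minksum; [exact: body_mscal|exact: body_set1].
  rewrite ivol_translate; last exact: body_mscal.
  rewrite ivol_mscal ?mulr_gt0//; last by exists 0 => i; rewrite mxE lexx ler01.
  by rewrite expr1 ler_wpM2l ?mulr_ge0 ?(ltW r0)// ivol1_cube.
by rewrite leNgt Kr.
Qed.

(* A wide slice forces the mean width of [S] above its height [2 * w]. *)
Lemma ivol1_slice_gap K S u p a b w : body K -> body S -> K `<=` S -> dot u u = 1 ->
  (forall z, K z -> dot u z = p) -> S a -> S b ->
  (forall z, S z -> dot u b <= dot u z <= dot u a) -> dot u (a - b) = 2 * w -> 0 < w ->
  K !=set0 -> ivol K 1 <= w -> w <= 2 * ivol K 1 ->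
  2 * w + w / (10240 * n.+1%:R ^+ 2) <= ivol S 1.
Proof.
move=> bK bS KS u1 Kp Sa Sb Sab abw w0 [z0 Kz0] Kw wK.
have N0 : 0 < n.+1%:R :> R by rewrite ltr0n.
set N := n.+1%:R in N0 *.
(* A cube of edge 3 rho has V_1 at most 3/16 w, less than the w / 2 available in K; so K has two
   points at distance above 3/2 rho. *)
pose rho := w / (16 * N).
have rho0 : 0 < rho by rewrite divr_gt0// mulr_gt0.
have rhoN : rho * (16 * N) = w by rewrite divfK// gt_eqF// mulr_gt0.
have [z1 Kz1 far] : exists2 z, K z & (3/2 * rho) < enorm (z - z0).
  have h : 2 * (3 / 2 * rho) * N = 3 / 16 * w by rewrite -rhoN; field.
  by apply: exists_far_point => //; [exact: mulr_gt0|rewrite -/N h; lra].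
pose perp (z : 'rV[R]_n.+1) := z - dot u z *: u.
have perpP z : dot z z = dot u z ^+ 2 + dot (perp z) (perp z).
  by rewrite /perp !(dotBl, dotBr, dotZl, dotZr) u1 (dotC z u); ring.
(* Some point of the slice is off the line through b in direction u: two points of K so far apart
   cannot both be within rho / 2 of it. *)
have [c Kc cp] : exists2 c, K c & rho / 2 <= enorm (perp (c - b)).
  have [h|h] := leP (rho / 2) (enorm (perp (z0 - b))); first by exists z0.
  exists z1 => //.
  have e : z1 - z0 = perp (z1 - b) - perp (z0 - b).
    rewrite /perp !dotBr (Kp _ Kz1) (Kp _ Kz0); apply/rowP => i; rewrite !mxE; ring.
  have t : enorm (z1 - z0) <= enorm (perp (z1 - b)) + enorm (perp (z0 - b)).
    rewrite e -(@ler_pXn2r _ 2)// ?nnegrE ?addr_ge0 ?enorm_ge0// sqrrD !enorm_sqr.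
    have := dot_le_enorm (perp (z1 - b)) (perp (z0 - b)); rewrite ler_norml => /andP[h1 _].
    by have := dot_subZ (perp (z1 - b)) (perp (z0 - b)) 1; rewrite scale1r => ->; rewrite expr1n; lra.
  by lra.
have peri := triangle_perimeter bS Sa Sb (KS _ Kc).
set al := dot u (c - b).
have al0 : 0 <= al by rewrite /al dotBr subr_ge0; have /andP[] := Sab _ (KS _ Kc).
have al1 : al <= 2 * w.
  by rewrite -abw /al !dotBr lerB//; have /andP[] := Sab _ (KS _ Kc).
have le_e z : dot u z <= enorm z.
  by have := dot_le_enorm u z; have := ler_norm (dot u z); rewrite {1}/enorm u1 sqrtr1 mul1r; apply: le_trans.
have e1 : 2 * w <= enorm (a - b) by rewrite -abw.
have e2 : 2 * w - al <= enorm (a - c).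
  apply: le_trans (le_e _); have := abw; rewrite /al !dotBr; lra.
(* The excess of the side from b to c over its height al, by Pythagoras: 2 al del + del^2 <= 5 w del
   = (rho / 2)^2, because al <= 2 w and del <= w. Half of it is w / (10240 N^2). *)
pose del := (rho / 2) ^+ 2 / (5 * w).
have del0 : 0 <= del by rewrite divr_ge0 ?sqr_ge0// mulr_ge0// ltW.
have delE : del * (5 * w) = (rho / 2) ^+ 2 by rewrite divfK// gt_eqF// mulr_gt0.
have rw : rho <= w.
  have N1 : 1 <= N by rewrite ler1n.
  by rewrite -rhoN; nra.
have delw : del <= w.
  by have : del * (5 * w) <= w * (5 * w); [rewrite delE; nra|rewrite ler_pM2r// mulr_gt0].
have e3 : al + del <= enorm (c - b).
  rewrite -(@ler_pXn2r _ 2)// ?nnegrE ?addr_ge0 ?enorm_ge0// enorm_sqr perpP -/al.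
  have : (rho / 2) ^+ 2 <= dot (perp (c - b)) (perp (c - b)).
    by rewrite -enorm_sqr ler_pXn2r ?nnegrE ?enorm_ge0// divr_ge0// ltW.
  by rewrite -delE sqrrD; nra.
have : w / (10240 * N ^+ 2) = del / 2.
  rewrite /del /rho; field; rewrite !gt_eqF//.
have := e2; have := e3; have := e1; have := peri.
move: (enorm (a - b)) (enorm (a - c)) (enorm (c - b)) (ivol S 1) (w / _) => x1 x2 x3 x4 x5 /=; lra.
Qed.

End ConeInequality.

(** * The effect of a cut on the knowledge set *)

Section PriceRange.
Context {R : realType} {n : nat}.
Implicit Types (S K : set 'rV[R]_n.+1) (u v : 'rV[R]_n.+1).

Lemma price_range S u : body S -> S !=set0 -> exists a b, [/\ S a, S b,
  forall z, S z -> dot u b <= dot u z <= dot u a, price_max S u = dot u a & price_min S u = dot u b].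
Proof.
move=> [cS xS] S0.
have cf : {within S, continuous (fun z : 'rV[R]_n.+1 => dot u z)}.
  by apply: continuous_subspaceT; exact: continuous_dot.
have [a Sa amax] := EVT_max_rV S0 cS cf; have [b Sb bmin] := EVT_min_rV S0 cS cf.
rewrite inE in Sa; rewrite inE in Sb.
have am z : S z -> dot u z <= dot u a by move=> Sz; apply: amax; rewrite inE.
have bm z : S z -> dot u b <= dot u z by move=> Sz; apply: bmin; rewrite inE.
exists a, b; split=> //.
- by move=> z Sz; rewrite am// bm.
- apply/eqP; rewrite eq_le; apply/andP; split.
    by apply: ge_sup => [|_ [z Sz <-]]; [exists (dot u a), a|exact: am].
  by apply: ub_le_sup; [exists (dot u a) => _ [z Sz <-]; exact: am|exists a].
- apply/eqP; rewrite eq_le; apply/andP; split.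
    by apply: ge_inf; [exists (dot u b) => _ [z Sz <-]; exact: bm|exists b].
  by apply: lb_le_inf => [|_ [z Sz <-]]; [exists (dot u a), a|exact: bm].
Qed.

(** In this normalization the cone inequality carries no factor i + 1. *)
Definition nvol S j : R := j`!%:R * ivol S j.

Lemma nvol_ge0 S j : body S -> 0 <= nvol S j.
Proof. by move=> bS; rewrite mulr_ge0// ivol_ge0. Qed.

Lemma le_nvol S S' j : body S -> body S' -> S `<=` S' -> nvol S j <= nvol S' j.
Proof. by move=> bS bS' SS'; rewrite ler_wpM2l// le_ivol. Qed.

Lemma nvol_cone S u q a b i : body S -> dot u u = 1 -> S a -> S b -> (i <= n)%N ->
  dot u (a - b) * nvol (slice S u q) i <= nvol S i.+1.
Proof.
move=> bS u1 Sa Sb ni; have bK := body_slice u q bS.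
have sub : slice S u q `<=` S by move=> z [].
have Kp z : slice S u q z -> dot u z = q by case.
have h := cone_inequality bK bS sub u1 Kp Sa Sb ni.
rewrite /nvol factS natrM mulrCA (mulrC i.+1%:R) -mulrA; exact: ler_wpM2l.
Qed.

Lemma removed_eq0 S u q : (forall z, S z -> q <= dot u z) -> upper_part S u q = S.
Proof. by move=> h; apply/seteqP; split=> [z []//|z Sz]; split=> //; exact: h. Qed.

Lemma slice_max S u a : (forall z, S z -> dot u z <= dot u a) -> upper_part S u (dot u a) = slice S u (dot u a).
Proof.
by move=> h; apply/seteqP; split=> z [Sz uz]; split=> //; [apply/eqP; rewrite eq_le uz h|rewrite uz].
Qed.

(* Here [e] is the normalized cut of a round with index [J] and scale [l]. *)
Lemma cut_exact S u a b q J (l w : R) : let d := n.+1 in let K := slice S u q in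
  let e := l ^+ J / 2 in
  let removed r := ivol S J - ivol (upper_part S u r) J in
  body S -> dot u u = 1 -> S a -> S b -> (forall z, S z -> dot u b <= dot u z <= dot u a) ->
  dot u (a - b) = 2 * w -> 0 < w -> (1 <= J <= d)%N -> 0 < l ->
  (l ^+ J < nvol S J) \/ (J = d /\ l ^+ J <= nvol S J) ->
  ((J < d)%N -> nvol S J.+1 <= l ^+ J.+1) ->
  nvol K J <= 2 * (w / 2) ^+ J ->
  (if l ^+ J / (2 * J`!%:R) < removed (dot u a) then removed q = l ^+ J / (2 * J`!%:R) else q = dot u a) ->
  [/\ nvol (upper_part S u q) J = nvol S J - e,
      nvol (lower_part S u q) J = e + nvol K J,
      dot u b <= q,
      (1 < J)%N || (J == d) -> nvol K J <= e &
      J = 1%N -> nvol K 1 <= w /\ ((J < d)%N -> w * nvol K 1 <= 2 * e ^+ 2)].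
Proof.
move=> d K e removed bS u1 Sa Sb Sab abw w0 /andP[J1 Jd] l0 lJ lJ1 KJ cand.
have bK : body K := body_slice u q bS.
have lp : 0 < l ^+ J by exact: exprn_gt0.
have Jf : J`!%:R != 0 :> R by rewrite pnatr_eq0 -lt0n fact_gt0.
have e0 : 0 < e by rewrite divr_gt0.
have eE : J`!%:R * (l ^+ J / (2 * J`!%:R)) = e by rewrite /e; field.
have cone1 : (J < d)%N -> 2 * w * nvol K J <= l ^+ J.+1.
  by move=> Jd'; apply: le_trans (lJ1 Jd'); rewrite -abw; exact: nvol_cone.
have top : J = d -> nvol K J = 0.
  move=> ->; rewrite /nvol (@ivol_hyperplane_top R n K u q) ?mulr0// => z; by case.
have K1 : J = 1%N -> nvol K 1 <= w by move=> J1'; move: KJ; rewrite J1' expr1; lra.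
have K0 := nvol_ge0 J bK.
(* For w <= l this is the slice bound, where J >= 2 absorbs the factor 2; for w > l the cone
   inequality divides l^(J+1) by 2 w. For J = d the slice has no volume. *)
have small : (1 < J)%N || (J == d) -> nvol K J <= e.
  move=> /orP[J2|/eqP Jd']; last by rewrite top// ltW.
  have [Jd'|Jd'] := ltnP J d; last by rewrite top ?(ltW e0)//; apply/eqP; rewrite eqn_leq Jd Jd'.
  have [wl|wl] := leP w l.
    apply: le_trans KJ _; apply: (@le_trans _ _ (2 * (l / 2) ^+ J)).
      by rewrite ler_pM2l// ler_pXn2r ?nnegrE ?divr_ge0 ?(ltW w0) ?(ltW l0)// ler_pM2r.
    rewrite expr_div_n /e mulrCA ler_wpM2l ?(ltW lp)//.
    rewrite ler_pdivrMr ?exprn_gt0//; case: (J) J2 => // -[//|m] _; rewrite !exprS.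
    have : 1 <= 2 ^+ m :> R by rewrite exprn_ege1// ler1n.
    by move=> ?; lra.
  have h := cone1 Jd'; rewrite exprS in h.
  have : 2 * w * nvol K J <= 2 * w * e by apply: le_trans h _; rewrite /e; nra.
  by rewrite ler_pM2l// mulr_gt0.
have J1d : J = 1%N -> (J < d)%N -> w * nvol K 1 <= 2 * e ^+ 2.
  move=> J1' Jd'; have := cone1 Jd'; rewrite /e J1' !expr1 !exprS expr0; lra.
have remE r : J`!%:R * removed r = nvol S J - nvol (upper_part S u r) J.
  by rewrite /removed mulrBr.
(* The default guess at the maximal price does not occur: K would be the top face and the normalized
   volume of S at most e plus that of K, against the lower bound on it. For J = 1 this uses that 2 w
   is at most V_1 of S. *)
have eq1 : removed q = l ^+ J / (2 * J`!%:R).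
  move: cand; case: ltP => // cut qa; exfalso.
  have UK : upper_part S u (dot u a) = K.
    by rewrite /K qa; apply: slice_max => z Sz; have /andP[] := Sab z Sz.
  have : nvol S J <= e + nvol K J.
    have := ler_wpM2l (ler0n R J`!) cut; rewrite remE eE UK; lra.
  have lE : l ^+ J = 2 * e by rewrite /e; field.
  move=> h; have [/orP J2|J2] := boolP ((1 < J)%N || (J == d)).
    have := small (introT orP J2); case: lJ => [|[Jd' lJ']]; first lra.
    by move=> _; move: h lJ'; rewrite top// lE; lra.
  have J1' : J = 1%N by move: J2; rewrite negb_or -leqNgt => /andP[h1 _]; apply/eqP; rewrite eqn_leq h1.
  have Jd' : (0 <= n)%N by [].
  have := nvol_cone q bS u1 Sa Sb Jd'; rewrite abw -/K => h1.
  have Kne : K !=set0 by exists a; split=> //; rewrite qa.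
  have n0 : nvol K 0 = 1 by rewrite /nvol ivol0// mulr1.
  have K1J : nvol K J <= w by rewrite J1'; exact: K1.
  have h1J : 2 * w <= nvol S J by rewrite J1'; rewrite n0 mulr1 in h1.
  move: J2; rewrite negb_or => /andP[_ /eqP Jn]; case: lJ => [|[/Jn//]]; lra.
have uE : nvol (upper_part S u q) J = nvol S J - e.
  by have := remE q; rewrite eq1 eE; lra.
split=> //.
- have := ivol_split u q J bS => /(congr1 (fun x => J`!%:R * x)); rewrite !mulrDr.
  rewrite -/(nvol S J) -/(nvol (slice S u q) J) -/(nvol (upper_part S u q) J) -/(nvol (lower_part S u q) J) -/K uE; lra.
- rewrite leNgt; apply/negP => qb; move: uE; rewrite removed_eq0; first lra.
  by move=> z Sz; have /andP[bz _] := Sab z Sz; exact: le_trans (ltW qb) bz.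
- by move=> J1'; split; [exact: K1|exact: J1d].
Qed.

End PriceRange.

(** * Roots and log-concave sequences *)

Section Powers.
Context {R : realType}.

Lemma root_pow (x : R) i : 0 <= x -> (0 < i)%N -> (x `^ (i%:R^-1)) ^+ i = x.
Proof.
move=> x0 i0; rewrite -powR_mulrn ?powR_ge0// -powRrM mulVf ?powRr1//.
by rewrite pnatr_eq0 -lt0n.
Qed.

Lemma root_le (x w : R) i : 0 <= x -> 0 <= w -> (0 < i)%N -> (x `^ (i%:R^-1) <= w) = (x <= w ^+ i).
Proof.
by move=> x0 w0 i0; rewrite -[in RHS](root_pow x0 i0) ler_pXn2r// ?nnegrE ?powR_ge0.
Qed.

Lemma root_ge (x w : R) i : 0 <= x -> 0 <= w -> (0 < i)%N -> (w <= x `^ (i%:R^-1)) = (w ^+ i <= x).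
Proof.
by move=> x0 w0 i0; rewrite -[in RHS](root_pow x0 i0) ler_pXn2r// ?nnegrE ?powR_ge0.
Qed.

(** The passage from Newton's to Maclaurin's inequalities, with roots cleared: the power i + 1 of
    log-concavity, divided by the previous instance. *)
Lemma logconcave_roots (a : nat -> R) m : a 0%N = 1 -> (forall i, (i <= m)%N -> 0 < a i) ->
  (forall i, (i + 2 <= m)%N -> a i * a i.+2 <= a i.+1 ^+ 2) ->
  forall i, (i < m)%N -> a i.+1 ^+ i <= a i ^+ i.+1.
Proof.
move=> a0 ap lc; elim=> [|i IH] im; first by rewrite a0 expr0 expr1.
have {}IH := IH (ltnW im).
have h : a i * a i.+2 <= a i.+1 ^+ 2 by apply: lc; lia.
have p0 : 0 < a i by apply: ap; lia.
have p1 : 0 < a i.+1 by apply: ap; lia.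
have p2 : 0 < a i.+2 by apply: ap; lia.
have q : 0 < a i ^+ i.+1 by exact: exprn_gt0.
rewrite -(ler_pM2l q) -exprMn.
apply: (@le_trans _ _ ((a i.+1 ^+ 2) ^+ i.+1)).
  by rewrite ler_pXn2r// ?nnegrE ?sqr_ge0// mulr_ge0// ltW.
have -> : (a i.+1 ^+ 2) ^+ i.+1 = a i.+1 ^+ i * a i.+1 ^+ i.+2 by rewrite -exprM -exprD; congr (_ ^+ _); lia.
by rewrite ler_pM2r// exprn_gt0.
Qed.

End Powers.

(** * Monotonicity of the roots phi_i *)

Section RootMonotone.
Context {R : realType} {n : nat}.
Implicit Types (S : set 'rV[R]_n).

Lemma ivol_ball_gt0 i : (i <= n)%N -> 0 < ivol (@unit_ball R n) i.
Proof.
move=> ni; rewrite /ivol divr_gt0 ?kappa_gt0// /sc.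
have := @fit_poly R n (ball_vol (@unit_ball R n)) (fun a => 'C(n, a)%:R * @kappa R n) _ (leq_subr i n).
move=> ->; first by rewrite mulr_gt0 ?kappa_gt0// ltr0n bin_gt0 leq_subr.
move=> b _; rewrite ball_vol_ball// exprDn mulr_suml; apply: eq_bigr => a _.
by rewrite expr1n mul1r -mulr_natl mulrAC.
Qed.

Lemma minksum_balls (x y : R) : 0 <= x -> 0 <= y ->
  minksum (mscal x (@unit_ball R n)) (mscal y (@unit_ball R n)) = mscal (x + y) (@unit_ball R n).
Proof.
move=> x0 y0; apply/seteqP; split=> [_ [_ [_ [[b Bb <-] [c Bc <-] ->]]]|_ [b Bb <-]]; last first.
  by exists (x *: b), (y *: b); rewrite scalerDl; split=> //; exists b.
have [xy|xy] := eqVneq (x + y) 0.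
  have x00 : x = 0 by lra. have y00 : y = 0 by lra.
  by exists b; rewrite // x00 y00 addr0 !scale0r addr0.
exists ((x / (x + y)) *: b + (y / (x + y)) *: c).
  by apply: (body_unit_ball n).2; rewrite ?divr_ge0 ?addr_ge0// -mulrDl divff.
by rewrite scalerDr !scalerA !(mulrCA (x + y)) divff// !mulr1.
Qed.

(** [logconcave_roots] asks for positive terms, while intrinsic volumes of a flat set may vanish.
    For S + e B they are positive and polynomial in e, and e tends to 0. *)
Lemma nvol_root_step S i : body S -> S !=set0 -> (i < n)%N ->
  (i.+1`!%:R * ivol S i.+1) ^+ i <= (i`!%:R * ivol S i) ^+ i.+1.
Proof.
move=> bS [s0 Ss0] ni; pose Se e := minksum S (mscal e (@unit_ball R n)).
have bSe e : body (Se e) by apply: body_minksum => //; apply: body_mscal; exact: body_unit_ball.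
have iv j : exists p : {poly R}, forall e, 0 <= e -> j`!%:R * ivol (Se e) j = p.[e].
  have [p hp] : ispoly (fun e => j`!%:R * (fit (n := n) (fun x => \sum_(a < n.+1) sc S a * (e + x) ^+ a) (n - j) * (@kappa R (n - j))^-1)).
    apply: ispolyM; first exact: ispoly_cst.
    apply: ispolyM; last exact: ispoly_cst.
    rewrite /fit; apply: ispoly_sum => b _; apply: ispolyM; last exact: ispoly_cst.
    apply: ispoly_sum => a _; apply: ispolyM; first exact: ispoly_cst.
    by apply: ispolyX; apply: ispolyD; [exact: ispoly_id|exact: ispoly_cst].
  exists p => e e0; rewrite -hp /ivol /sc; congr (_ * (_ * _)); apply: fit_ext => x x0.
  by rewrite -steiner ?addr_ge0// /ball_vol /Se minksumA minksum_balls.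
have Se0 : Se 0 = S.
  apply/seteqP; split=> [_ [k [_ [Kk [b _ <-] ->]]]|k Kk]; first by rewrite scale0r addr0.
  by exists k, 0; rewrite addr0; split=> //; exists 0; [exact: ball0|rewrite scaler0].
have [p hp] := iv i; have [q hq] := iv i.+1.
have := hp 0 (lexx 0); have := hq 0 (lexx 0); rewrite Se0 => -> ->.
have ip (r : {poly R}) : ispoly (fun x => r.[x]) by exists r.
rewrite -subr_le0 -mulN1r.
apply: (ispoly_le0 (ispolyD (ispolyX i (ip q)) (ispolyM (ispoly_cst (-1)) (ispolyX i.+1 (ip p)))) ltr01).
move=> e e0 _; rewrite mulN1r subr_le0 -hp ?(ltW e0)// -hq ?(ltW e0)//.
have ne : Se e !=set0 by exists (s0 + 0), s0, 0; split=> //; exists 0; [exact: ball0|rewrite scaler0].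
apply: (@logconcave_roots _ (fun j => j`!%:R * ivol (Se e) j) n) => //.
- by rewrite ivol0// mulr1.
- move=> j jn; rewrite mulr_gt0 ?ltr0n ?fact_gt0//.
  have B0 : @unit_ball R n !=set0 by exists 0; exact: ball0.
  have bB := @body_unit_ball R n.
  apply: (@lt_le_trans _ _ (ivol (minksum (mscal e (@unit_ball R n)) [set s0]) j)).
    rewrite ivol_translate ?ivol_mscal//; last exact: body_mscal.
    by rewrite mulr_gt0 ?exprn_gt0 ?ivol_ball_gt0.
  apply: le_ivol => //; first by apply: body_minksum; [exact: body_mscal|exact: body_set1].
  by rewrite minksumC; apply: sub_minksum => // _ ->.
- by move=> j jn; apply: ivol_logconcave.
Qed.

End RootMonotone.

(** * The scales l_k *)

Section Scales.
Context {R : realType} (n : nat).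
Local Notation d := n.+1.
Local Notation D := (n.+1%:R : R).

Definition scale (z : int) : R := D ^+ 2 * expR (- (@alpha R d ^ z)).

Let D0 : 0 < D. Proof. by rewrite ltr0n. Qed.
Let D1 : 1 <= D. Proof. by rewrite ler1n. Qed.

Lemma alpha_gt1 : 1 < @alpha R d. Proof. by rewrite /alpha ltrDl invr_gt0. Qed.

Let al0 : 0 < @alpha R d. Proof. exact: lt_trans ltr01 alpha_gt1. Qed.

Lemma scale_gt0 z : 0 < scale z.
Proof. by rewrite mulr_gt0 ?expR_gt0// exprn_gt0. Qed.

Lemma le_scale z z' : z <= z' -> scale z' <= scale z.
Proof.
move=> zz; rewrite ler_pM2l ?exprn_gt0// ler_expR lerN2.
exact: (ler_weXz2l (ltW alpha_gt1)).
Qed.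

(** In the exponents this says J alpha <= J + 1, the origin of alpha = 1 + 1/d; one factor d^2 is
    left over. *)
Lemma scale_ratio z J : (J <= d)%N -> scale z ^+ J.+1 <= D ^+ 2 * scale (z + 1) ^+ J.
Proof.
move=> Jd; rewrite /scale; set A := @alpha R d ^ z.
have A0 : 0 < A by exact: exprz_gt0.
have -> : @alpha R d ^ (z + 1) = A * @alpha R d by rewrite expfzDr ?gt_eqF// expr1z.
have X0 : 0 < D ^+ 2 by exact: exprn_gt0.
move: (D ^+ 2) X0 => X X0.
rewrite !exprMn (exprS X J) -mulrA ler_pM2l// ler_pM2l ?exprn_gt0//.
rewrite -!expRM_natl ler_expR /alpha.
have JD : J%:R / D <= 1 by rewrite ler_pdivrMr// mul1r ler_nat.
rewrite -natr1; have -> : J%:R * - (A * (1 + D^-1)) = - (J%:R * A) - (J%:R / D) * A by field; rewrite gt_eqF.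
have : J%:R / D * A <= A by rewrite ler_piMl// ltW.
clearbody A; move: (J%:R / D) => r h; move: (J%:R : R) => x; nra.
Qed.

Lemma scale_indexP (S : set 'rV[R]_d) i (z : int) : scale_index d (phi S i) z%:E ->
  scale (z + 1) < phi S i <= scale z.
Proof. by []. Qed.

Lemma phi_pow (S : set 'rV[R]_d) i : body S -> (1 <= i <= d)%N -> 0 <= phi S i /\ phi S i ^+ i = nvol S i.
Proof.
move=> bS /andP[i1 id]; rewrite /phi powR_ge0; split=> //.
by rewrite root_pow// intrinsic_volumeE// nvol_ge0.
Qed.

Lemma last_sameP (k : nat -> \bar int) i : (1 <= i <= d)%N -> let J := last_same d k i in
  [/\ (i <= J <= d)%N, k J = k i & forall j, (J < j <= d)%N -> k j != k i].
Proof.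
move=> /andP[i1 id] J.
have ub j : (1 <= j <= d)%N -> k j == k i -> (j <= J)%N.
  move=> jd kj; rewrite /J /last_same; apply: (@leq_bigmax_seq _ (index_iota 1 d.+1) (fun j => k j == k i) (fun j => j)) => //.
  by rewrite mem_index_iota ltnS.
have att : J = 0%N \/ ((1 <= J <= d)%N /\ k J == k i).
  rewrite /J /last_same big_seq_cond; elim/big_ind: _ => [|x y hx hy|x]; first by left.
    by case: (leqP x y) => _.
  by rewrite mem_index_iota ltnS => /andP[h1 h2]; right.
have iJ : (i <= J)%N by apply: ub; rewrite ?i1.
case: att => [J0|[/andP[J1 Jd] /eqP kJ]]; first by rewrite J0 in iJ; case: i i1 iJ {id ub} @J J0.
split=> //; first by rewrite iJ.
move=> j /andP[Jj jd]; apply/negP => kj.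
by have := ub j _ kj; rewrite jd andbT => /(_ (leq_ltn_trans (leq0n J) Jj)); rewrite leqNgt Jj.
Qed.

Lemma slice_widthE (S : set 'rV[R]_d) u q i : body S -> (1 <= i <= d)%N ->
  slice_width S u q i = ((ivol (slice S u (q i)) i * (2 ^+ i.-1 * i`!%:R)) `^ (i%:R^-1))%:E.
Proof.
move=> bS /andP[i1 id]; rewrite /slice_width; case: i i1 id => // i _ id.
by rewrite intrinsic_volumeE//; [rewrite /coef_c invrK|exact: body_slice].
Qed.

Lemma nvol_le_pow (S : set 'rV[R]_d) i : body S -> S !=set0 -> nvol S 1 <= D -> (1 <= i <= d)%N ->
  nvol S i <= D ^+ i.
Proof.
move=> bS S0 S1; elim: i => // -[|i] IH /andP[_ id]; first by rewrite expr1.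
have h := nvol_root_step bS S0 id.
have {}IH := IH (ltnW id).
rewrite -(@ler_pXn2r _ i.+1)// ?nnegrE ?nvol_ge0 ?exprn_ge0//.
apply: le_trans h _; rewrite -exprM mulnC exprM.
by rewrite ler_pXn2r// ?nnegrE ?nvol_ge0 ?exprn_ge0.
Qed.

(** Bernoulli gives alpha^d >= 2. As phi_i is at most d, this leaves essentially no scales below
    -d. *)
Lemma scale_half z : (z <= - d%:Z)%R -> D ^+ 2 / 2 <= scale z.
Proof.
move=> zd; apply: le_trans (le_scale zd); rewrite ler_pM2l ?exprn_gt0//.
apply: le_trans (expR_ge1Dx _).
have h : 2 <= @alpha R d ^ (d%:Z).
  rewrite -exprnP /alpha.
  have B m (x : R) : 0 <= x -> 1 + m%:R * x <= (1 + x) ^+ m.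
    move=> x0; elim: m => [|m IH]; first by rewrite expr0; lra.
    have : (0 : R) <= m%:R by []. rewrite exprS -natr1; nra.
  have := B d D^-1; rewrite invr_ge0 ler0n mulfV ?gt_eqF// => /(_ isT); lra.
have -> : @alpha R d ^ (- d%:Z) = (@alpha R d ^ d%:Z)^-1 by rewrite invr_expz.
have : (@alpha R d ^ d%:Z)^-1 <= 2^-1 by rewrite lef_pV2 ?posrE// exprz_gt0.
lra.
Qed.

Lemma scale0_ge : D ^+ 2 / 4 <= scale 0.
Proof.
rewrite /scale expr0z ler_pM2l ?exprn_gt0//.
have h : 2^-1 <= expR (- 2^-1 : R) by have := expR_ge1Dx (- 2^-1 : R); lra.
have -> : (-1 : R) = 2%:R * - 2^-1 by field.
rewrite expRM_natl expr2; nra.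
Qed.

Lemma dot_cube_le (u v : 'rV[R]_d) : dot u u = 1 -> unit_cube v -> dot u v <= D.
Proof.
move=> u1 vc; have := dot_le_enorm u v; have := ler_norm (dot u v).
rewrite {1}/enorm u1 sqrtr1 mul1r => h1 h2; apply: le_trans h1 _; apply: le_trans h2 _.
rewrite -(@ler_pXn2r _ 2)// ?nnegrE ?enorm_ge0// enorm_sqr.
apply: (@le_trans _ _ (\sum_(i < d) 1)).
  by apply: ler_sum => i _; have /andP[? ?] := vc i; nra.
by rewrite sumr_const card_ord expr2 ler_peMl.
Qed.

End Scales.

(** * A single round of PricingSearch *)

Section Round.
Context {R : realType} {n : nat}.
Local Notation d := n.+1.
Local Notation D := (n.+1%:R : R).
Local Notation L := (@scale R n).
Implicit Types (S : set 'rV[R]_d) (u v : 'rV[R]_d).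

(** The cone over the slice K_(j-1), where w <= L_(j-1); c_(j-1) turns 2 w times the slice volume
    into a multiple of (w / 2)^j. For j = 1 the assumption is void, as L_0 is infinite, and the
    slice at the maximal price serves with a_0 = 1. *)
Lemma width_bounds S u a b q j (w : R) : body S -> dot u u = 1 -> S a -> S b ->
  dot u (a - b) = 2 * w -> 0 < w -> (1 <= j <= d)%N ->
  ((w%:E <= slice_width S u q j.-1)%E) ->
  (if (1 < j)%N then 8 * (w / 2) ^+ j else 2 * w) <= nvol S j.
Proof.
move=> bS u1 Sa Sb abw w0 /andP[j1 jd].
case: j j1 jd => // -[|j] _ jd /=.
  move=> _; have := nvol_cone (dot u a) bS u1 Sa Sb (leq0n n); rewrite abw.
  by rewrite {1}/nvol ivol0 ?mulr1//; [exact: body_slice|exists a].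
have j1d : (1 <= j.+1 <= d)%N by rewrite /= (ltnW jd).
rewrite -[X in (_ <= X)%E]/(slice_width S u q j.+1) slice_widthE// lee_fin root_ge ?(ltW w0)//; last first.
  by rewrite mulr_ge0 ?ivol_ge0//; exact: body_slice.
move=> h; have := nvol_cone (q j.+1) bS u1 Sa Sb (_ : (j.+1 <= n)%N); rewrite abw => /(_ jd).
apply: le_trans; rewrite /nvol.
set V := ivol _ _ in h *.
have p0 : 0 < 2 ^+ j :> R by exact: exprn_gt0.
have : w ^+ j.+1 / 2 ^+ j <= j.+1`!%:R * V.
  rewrite ler_pdivrMr//; apply: le_trans h _; rewrite /= le_eqVlt; apply/orP; left; apply/eqP; ring.
move=> h'; apply: (@le_trans _ _ (2 * w * (w ^+ j.+1 / 2 ^+ j))); last by rewrite ler_pM2l// mulr_gt0.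
by rewrite le_eqVlt; apply/orP; left; apply/eqP; rewrite expr_div_n !exprS; field; rewrite gt_eqF.
Qed.

Lemma slice_bound S u q J (w : R) : body S -> 0 < w -> (1 <= J <= d)%N ->
  (slice_width S u q J <= w%:E)%E -> nvol (slice S u (q J)) J <= 2 * (w / 2) ^+ J.
Proof.
move=> bS w0 /andP[J1 Jd]; rewrite slice_widthE ?J1// lee_fin root_le ?(ltW w0)//; last first.
  by rewrite mulr_ge0 ?ivol_ge0//; exact: body_slice.
case: J J1 Jd => // J _ _ /=; rewrite /nvol; set V := ivol _ _ => h.
have p0 : 0 < 2 ^+ J :> R by exact: exprn_gt0.
have -> : 2 * (w / 2) ^+ J.+1 = w ^+ J.+1 / 2 ^+ J by rewrite expr_div_n !exprS; field; rewrite gt_eqF.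
by rewrite ler_pdivlMr//; apply: le_trans h; rewrite le_eqVlt; apply/orP; left; apply/eqP; ring.
Qed.

(** The second outcome serves dimension one, where the set may be too long for the counted scales.
    The last one is the stalled overpricing with J = 1: V_1 lands between 2 e and 3 e, with e =
    l_(z+1) / 2, instead of below the next scale. *)
Definition progress (G : R) S S' (T : nat) (loss : R) : Prop :=
  [\/ loss <= 2 / T%:R, loss <= 1 /\ nvol S' 1 <= nvol S 1 - 8^-1 |
   exists J z, [/\ (1 <= J <= d)%N, - d%:Z <= z, @alpha R d ^ z <= ln (2 * D ^+ 2 * T%:R),
     L (z + 1) ^+ J < nvol S J <= L z ^+ J &
     [\/ loss <= 4 * L z /\ nvol S' J <= nvol S J - L (z + 1) ^+ J / 2,
         loss <= D /\ nvol S' J <= L (z + 1) ^+ J |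
         [/\ J = 1%N, loss <= D, 2 * (L (z + 1) / 2) < nvol S' 1, nvol S' 1 <= 3 * (L (z + 1) / 2) &
             nvol S' 1 <= nvol S 1 - L (z + 1) / 2 / G]]]].

(** Here c is V_1 of the slice and e the cut. A slice exceeding the cut must be comparable to the
    half-width, as [slice_gap] requires. *)
Lemma stalled_width (w c e : R) : 0 < e -> e < c -> c <= w -> w * c <= 2 * e ^+ 2 ->
  c <= 2 * e /\ w <= 2 * c.
Proof.
move=> e0 ec cw h; have cc : c * c <= w * c by rewrite ler_pM2r//; lra.
by split; rewrite leNgt; apply/negP => g; nra.
Qed.

Lemma pricing_loss_under (th p : R) : p <= th -> pricing_loss th p = th - p.
Proof. by move=> h; rewrite /pricing_loss h mulr1. Qed.
Lemma pricing_loss_over (th p : R) : ~~ (p <= th) -> pricing_loss th p = th.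
Proof. by move=> /negPf h; rewrite /pricing_loss h mulr0 subr0. Qed.

(** The statement of [ivol1_slice_gap] with its constant 10240 d^2 replaced by a parameter. *)
Definition slice_gap (G : R) : Prop := forall K S u p a b w,
  body K -> body S -> K `<=` S -> dot u u = 1 ->
  (forall z, K z -> dot u z = p) -> S a -> S b ->
  (forall z, S z -> dot u b <= dot u z <= dot u a) -> dot u (a - b) = 2 * w -> 0 < w ->
  K !=set0 -> ivol K 1 <= w -> w <= 2 * ivol K 1 -> 2 * w + w / G <= ivol S 1.

Lemma round_progress G S u v T p : 0 <= G -> slice_gap G -> body S -> S v -> dot u u = 1 -> unit_cube v -> nvol S 1 <= D ->
  (0 < T)%N -> pricing_search T S u p ->
  progress G S (if p <= dot u v then upper_part S u p else lower_part S u p) T (pricing_loss (dot u v) p).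
Proof.
move=> G0 gapG bS Sv u1 vc S1 T0; have S0 : S !=set0 by exists v.
have [a [b [Sa Sb Sab amax bmin]]] := price_range u bS S0.
rewrite /pricing_search amax bmin; set w := (dot u a - dot u b) / 2.
have abw : dot u (a - b) = 2 * w by rewrite dotBr /w; field.
have /andP[bv va] := Sab v Sv.
have Tr0 : 0 < T%:R :> R by rewrite ltr0n.
case=> k [q [hk hq hp]]; move: hp; case: ltP => [wT|wT].
  move=> ->; apply: Or31; rewrite pricing_loss_under//.
  have -> : 2 / T%:R = 2 * T%:R^-1 :> R by [].
  move: wT; rewrite /w; lra.
have w0 : 0 < w by apply: lt_le_trans wT; rewrite invr_gt0.
have wE : dot u a - dot u b = 2 * w by rewrite -dotBr.
clearbody w; case=> j [jd /andP[wJ wj] ->].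
have := last_sameP k jd; cbv zeta; set J := last_same d k j => -[/andP[jJ Jd'] kJ kout].
have Jd : (1 <= J <= d)%N by rewrite Jd' andbT (leq_trans _ jJ)//; case/andP: jd.
have KJ := slice_bound bS w0 Jd wJ.
have Sj := width_bounds bS u1 Sa Sb abw w0 jd wj.
set K := slice S u (q J) in KJ.
have bK : body K by exact: body_slice.
have DD0 : 0 < D by rewrite ltr0n.
have [phj0 phj] := phi_pow bS jd; have [phJ0 phJ] := phi_pow bS Jd.
have jpos : 0 < nvol S j.
  by apply: lt_le_trans Sj; case: ifP => _; rewrite mulr_gt0// exprn_gt0// divr_gt0.
have gen l : 0 < l -> ell d (k J + 1%:E)%E = l ->
    (l ^+ J < nvol S J) \/ (J = d /\ l ^+ J <= nvol S J) ->
    ((J < d)%N -> nvol S J.+1 <= l ^+ J.+1) ->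
    [/\ nvol (upper_part S u (q J)) J = nvol S J - l ^+ J / 2,
      nvol (lower_part S u (q J)) J = l ^+ J / 2 + nvol K J,
      dot u b <= q J,
      (1 < J)%N || (J == d) -> nvol K J <= l ^+ J / 2 &
      J = 1%N -> nvol K 1 <= w /\ ((J < d)%N -> w * nvol K 1 <= 2 * (l ^+ J / 2) ^+ 2)].
  move=> l0 lE lJ lJ1; apply: (cut_exact bS u1 Sa Sb Sab abw w0 Jd l0 lJ lJ1 KJ).
  have := hq J Jd; rewrite /candidate_price /cut_amount lE amax.
  have bU r := body_upper_part u r bS.
  by rewrite !(intrinsic_volumeE bS Jd') !(intrinsic_volumeE (bU _) Jd').
set th := dot u v in bv va *.
(* Dimension one at the index -oo or below scale 0, where the next scale is at least 1/4. Slices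
   have length 0, so either answer removes at least 1/8, and the loss is at most 1. *)
have low1 l : n = 0%N -> 4^-1 <= l -> ell d (k J + 1%:E)%E = l -> l ^+ J <= nvol S J ->
    progress G S (if q J <= th then upper_part S u (q J) else lower_part S u (q J)) T (pricing_loss th (q J)).
  move=> n0 l4 lE lJ; have J1 : J = 1%N by move: Jd; rewrite n0; case: (J) => [|[]].
  have l0 : 0 < l by apply: lt_le_trans l4; rewrite invr_gt0.
  have Jd1 : J = d by rewrite J1 n0.
  have [] := gen l l0 lE (or_intror (conj Jd1 lJ)); first by rewrite -Jd1 ltnn.
  have lp : l ^+ J = l by rewrite J1 expr1.
  have N1 (X : set 'rV[R]_d) : nvol X 1 = nvol X J by rewrite J1.
  move=> hU hL hb hK _; rewrite lp in hU hL hK lJ.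
  have KK : nvol K J = 0.
    rewrite /nvol; have -> : ivol K J = ivol K d by congr (ivol _ _).
    by rewrite (@ivol_hyperplane_top R n K u (q J)) ?mulr0// => z; case.
  have D1 : D = 1 by rewrite n0.
  apply: Or32; rewrite D1 in S1.
  have ww : 2 * w <= 1.
    have := nvol_cone (dot u a) bS u1 Sa Sb (leq0n n); rewrite abw {1}/nvol ivol0 ?mulr1//.
    - by move=> h; exact: le_trans h S1.
    - exact: body_slice.
    - by exists a.
  have cu := dot_cube_le u1 vc; rewrite D1 -/th in cu.
  rewrite !N1; case: ifPn => h.
    rewrite pricing_loss_under//; split; first by move: ww hb va wE; lra.
    by rewrite hU; lra.
  rewrite pricing_loss_over//; split=> //.
  by rewrite hL KK; move: S1; rewrite N1; lra.
have phid i : (1 <= i <= d)%N -> nvol S i <= D ^+ i by exact: nvol_le_pow.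
have phile (x y : R) i : (1 <= i)%N -> 0 <= x -> 0 <= y -> x ^+ i <= y ^+ i -> x <= y.
  by move=> i1 x0 y0; rewrite ler_pXn2r// ?nnegrE.
have phJD : phi S J <= D.
  by apply: (phile _ _ J) => //; [case/andP: Jd|rewrite phJ; exact: phid].
have hkJ := hk J Jd; have hkj := hk j jd; rewrite -kJ in hkj.
case EkJ : (k J) hkJ hkj => [z||] hkJ hkj.
- have /andP[zJ1 zJ2] := scale_indexP hkJ; have /andP[zj1 zj2] := scale_indexP hkj.
  have l0 : 0 < L (z + 1) by exact: scale_gt0.
  have lz0 : 0 < L z by exact: scale_gt0.
  have lJ : L (z + 1) ^+ J < nvol S J by rewrite -phJ ltr_pXn2r ?nnegrE ?(ltW l0)//; case/andP: Jd.
  have lJz : nvol S J <= L z ^+ J by rewrite -phJ ler_pXn2r ?nnegrE ?(ltW lz0)//; case/andP: Jd.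
  have ljz : nvol S j <= L z ^+ j by rewrite -phj ler_pXn2r ?nnegrE ?(ltW lz0)//; case/andP: jd.
  (* The lower bound on a_j in terms of w meets a_j <= l^j, because j has the same index as J. *)
  have wL : 2 * w <= 4 * L z.
    move: Sj; case: ifPn => j2 Sj.
      have : (w / 2) ^+ j <= L z ^+ j.
        apply: le_trans ljz; apply: le_trans Sj; apply: ler_peMl; last by rewrite ler1n.
        by rewrite exprn_ge0// divr_ge0// ltW.
      rewrite ler_pXn2r ?nnegrE ?divr_ge0 ?(ltW w0) ?(ltW lz0)//; last by case/andP: jd.
      lra.
    have j1 : j = 1%N by move: jd j2; case: (j) => [|[]].
    by rewrite j1 expr1 in ljz; rewrite j1 in Sj; lra.
  have lE : ell d (k J + 1%:E)%E = L (z + 1) by rewrite EkJ.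
  have [/andP[/eqP n0 z0]|nz] := boolP ((n == 0%N) && (z < 0)).
    apply: (low1 (L (z + 1))) => //; last exact: ltW.
    apply: (@le_trans _ _ (L 0)); last by apply: le_scale; rewrite lezD1.
    have := @scale0_ge R n; rewrite n0 expr1n; lra.
  (* The roots phi_i are nonincreasing and J is the last position with index z, so phi_(J+1) belongs
     to a strictly smaller scale. *)
  have lJ1 : (J < d)%N -> nvol S J.+1 <= L (z + 1) ^+ J.+1.
    move=> JJ; have J1d : (1 <= J.+1 <= d)%N by [].
    have [ph10 ph1] := phi_pow bS J1d; have := kout J.+1; rewrite ltnSn JJ -kJ EkJ => /(_ isT) kn.
    have J0 : (0 < J)%N by case/andP: Jd.
    have mono : phi S J.+1 <= phi S J.
      apply: (phile _ _ (J.+1 * J)%N) => //; first by rewrite muln_gt0.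
      rewrite exprM ph1 (mulnC J.+1) exprM phJ; exact: nvol_root_step.
    rewrite -ph1 ler_pXn2r ?nnegrE ?(ltW l0)//.
    have := hk J.+1 J1d; case Ek1 : (k J.+1) => [y||] h1; rewrite Ek1 in kn.
    + have /andP[y1 y2] := scale_indexP h1; have yz : y != z by apply: contra kn => /eqP->.
      have [zy|zy] := ltP z y.
        by apply: le_trans y2 _; apply: le_scale; rewrite lezD1.
      have : L z <= L (y + 1) by apply: le_scale; rewrite lezD1 lt_neqAle yz.
      by move=> h; have := lt_le_trans y1 (le_trans mono zJ2); rewrite ltNge h.
    + by move: h1 => /= ->; exact: ltW.
    + move: h1 => /= h1; exfalso; have := le_trans h1 (le_trans mono zJ2).
      rewrite leNgt /scale gtr_pMr ?exprn_gt0//.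
      have := ltr_expR (- (@alpha R d ^ z)) 0; rewrite expR0 => ->.
      by rewrite oppr_lt0 exprz_gt0// (lt_trans ltr01)// alpha_gt1.
  have [hU hL hb hK hK1] := gen _ l0 lE (or_introl lJ) lJ1.
  apply: Or33; exists J, z; split=> //.
  (* For z < -d the next scale is at least d^2 / 2, yet below phi_J <= d; this leaves d = 1, whose
     negative scales are already treated. *)
  + rewrite leNgt; apply/negP => zd.
    have h1 : D ^+ 2 / 2 <= L (z + 1) by apply: scale_half; rewrite lezD1.
    have h2 : D ^+ 2 / 2 < D by apply: le_lt_trans h1 _; exact: lt_le_trans zJ1 phJD.
    have D2 : D < 2.
      by move: h2; rewrite ltr_pdivrMr// expr2 mulrC ltr_pM2l.
    move: D2; rewrite ltr_nat => n1; have n0 : n = 0%N by move: n1; case: (n) => [|[]].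
    move: nz; by rewrite n0 eqxx /= -leNgt => z0; have := le_lt_trans z0 zd; rewrite n0.
  (* From 1/T <= w <= 2 l_z: rounds of half-width below 1/T have been dealt with, which bounds the
     scales from above. *)
  + have X0 : 0 < 2 * D ^+ 2 * T%:R by rewrite !mulr_gt0// exprn_gt0.
    rewrite -ler_expR lnK ?posrE//.
    have : T%:R^-1 <= 2 * L z by move: wT wL; lra.
    rewrite /scale expRN -[T%:R^-1]mul1r ler_pdivrMr// => h.
    have e0 := expR_gt0 (@alpha R d ^ z).
    have : expR (@alpha R d ^ z) * 1 <= expR (@alpha R d ^ z) * (2 * (D ^+ 2 * (expR (@alpha R d ^ z))^-1) * T%:R).
      by rewrite ler_pM2l.
    rewrite mulr1 => h'; apply: (le_trans h'); rewrite le_eqVlt; apply/orP; left; apply/eqP.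
    by field; rewrite gt_eqF.
  + by rewrite lJ.
  case: ifPn => h.
    apply: Or31; rewrite pricing_loss_under//; split; last by rewrite hU.
    by apply: le_trans wL; move: hb va wE; lra.
  rewrite pricing_loss_over//; have thD : th <= D by exact: dot_cube_le.
  have [JJ|JJ] := boolP ((1 < J)%N || (J == d)).
    by apply: Or32; split=> //; rewrite hL; have := hK JJ; lra.
  have J1 : J = 1%N by move: JJ Jd; case: (J) => [|[]].
  have Jlt : (J < d)%N by move: JJ; rewrite negb_or => /andP[_ Jn]; rewrite ltn_neqAle Jn.
  have [c1 c2] := hK1 J1; have {}c2 := c2 Jlt.
  rewrite J1 in hU hL lJ lJz *; rewrite J1 !expr1 in c2; rewrite !expr1 in hL lJ lJz *.
  set e := L (z + 1) / 2 in hL c2 *; set c := nvol K 1 in c1 c2 hL *.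
  have le : L (z + 1) = 2 * e by rewrite /e; field.
  (* Overpricing with J = 1 < d leaves V_1 = e + c, which may exceed the next scale 2 e when c >
     e. *)
  have [over|over] := leP (nvol (lower_part S u (q 1)) 1) (L (z + 1)).
    by apply: Or32.
  apply: Or33.
  have e0 : 0 < e by rewrite divr_gt0.
  have ce : e < c by move: over; rewrite hL le; lra.
  have [c2e w2c] := stalled_width e0 ce c1 c2.
  have cE : c = ivol K 1 by rewrite /c /nvol mul1r.
  have Kne : K !=set0.
    apply: contrapT => Ke; have : K = set0 by apply/seteqP; split=> y // Ky; apply: Ke; exists y.
    by move=> KE; move: ce; rewrite cE KE ivol_set0; lra.
  have subK : K `<=` S by move=> y [].
  have Kp y : K y -> dot u y = q J by case.
  have gap := gapG K S u (q J) a b w bK bS subK u1 Kp Sa Sb Sab abw w0 Kne.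
  rewrite -cE in gap; have {}gap := gap c1 w2c.
  have S1E : nvol S 1 = ivol S 1 by rewrite /nvol mul1r.
  have ew : e <= w := le_trans (ltW ce) c1.
  have g2 : e / G <= w / G by apply: ler_wpM2r => //; rewrite invr_ge0.
  split; [by []|exact: thD|by rewrite -le| |].
    by rewrite hL; move: c2e; clear; lra.
  by rewrite hL S1E; move: c1 ew gap g2; clear; lra.
- exfalso; move: hkj => /= hj; move: jpos; rewrite -phj hj expr0n.
  by case: eqP => [j0|_]; [move: jd; rewrite j0|rewrite ltxx].
(* At the index -oo, phi_J <= d leaves only d = 1. *)
- have h : D ^+ 2 <= phi S J by exact: hkJ.
  have n0 : n = 0%N.
    have : D ^+ 2 <= D by exact: le_trans h phJD.
    by rewrite expr2 -[leRHS]mulr1 ler_pM2l// lern1 ltnS leqn0 => /eqP.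
  apply: (low1 (D ^+ 2)) => //; first by rewrite n0 expr1n; lra.
    by rewrite EkJ.
  rewrite -phJ ler_pXn2r ?nnegrE ?sqr_ge0//; by case/andP: Jd.
Qed.

End Round.

(** * Monotone potential functions with a slope and a jump *)

Section Ramp.
Context {R : realType}.
Implicit Types (c lo hi k x a : R).

Definition clamp lo hi a : R := if a <= lo then 0 else if a <= hi then a - lo else hi - lo.

(** A decreasing quantity a pays c per unit while it slides through [lo, hi], and k once when it
    falls to x or below. *)
Definition ramp c lo hi k x a : R := c * clamp lo hi a + k * (x < a)%R%:R.

Lemma clamp_bound lo hi a : lo <= hi -> 0 <= clamp lo hi a <= hi - lo.
Proof.
move=> lh; rewrite /clamp.
by case: (leP a lo) => h1; case: (leP a hi) => h2; apply/andP; split; lra.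
Qed.

Lemma le_clamp lo hi a a' : lo <= hi -> a' <= a -> clamp lo hi a' <= clamp lo hi a.
Proof.
move=> lh aa; rewrite /clamp.
by case: (leP a lo) => h1; case: (leP a hi) => h2; case: (leP a' lo) => h3; case: (leP a' hi) => h4; lra.
Qed.

Lemma clampE lo hi a : lo <= a <= hi -> clamp lo hi a = a - lo.
Proof.
move=> /andP[la ah]; rewrite /clamp ah; case: (leP a lo) => // h1; lra.
Qed.

Lemma ramp_bound c lo hi k x a : 0 <= c -> 0 <= k -> lo <= hi ->
  0 <= ramp c lo hi k x a <= c * (hi - lo) + k.
Proof.
move=> c0 k0 lh; have /andP[h1 h2] := clamp_bound a lh; rewrite /ramp addr_ge0 ?mulr_ge0//=.
by apply: lerD; [exact: ler_wpM2l|case: (x < a); rewrite ?mulr1 ?mulr0].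
Qed.

Lemma le_ramp c lo hi k x a a' : 0 <= c -> 0 <= k -> lo <= hi -> a' <= a ->
  ramp c lo hi k x a' <= ramp c lo hi k x a.
Proof.
move=> c0 k0 lh aa; apply: lerD; first by apply: ler_wpM2l => //; exact: le_clamp.
apply: ler_wpM2l => //; rewrite ler_nat.
by case: (ltP x a') => // xa; rewrite (lt_le_trans xa aa).
Qed.

Lemma ramp_jump c lo hi k x a a' : 0 <= c -> lo <= hi -> a' <= x -> x < a ->
  k + ramp c lo hi k x a' <= ramp c lo hi k x a.
Proof.
move=> c0 lh ax xa; rewrite /ramp xa ltNge ax mulr0 mulr1 addr0 addrC lerD2r.
by apply: ler_wpM2l => //; apply: le_clamp => //; exact: le_trans ax (ltW xa).
Qed.

Lemma ramp_slide c lo hi k x a a' : 0 <= k -> lo <= a' -> a' <= a -> a <= hi ->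
  c * (a - a') + ramp c lo hi k x a' <= ramp c lo hi k x a.
Proof.
move=> k0 la aa ah; rewrite /ramp !clampE ?la ?ah ?(le_trans la) ?(le_trans aa)//.
rewrite addrA -mulrDr; apply: lerD.
  by have -> : a - a' + (a' - lo) = a - lo by ring.
apply: ler_wpM2l => //; rewrite ler_nat.
by case: (ltP x a') => // xa; rewrite (lt_le_trans xa aa).
Qed.

Lemma sum_drop (I : finType) (f g : I -> R) i0 y : (forall i, g i <= f i) ->
  y + g i0 <= f i0 -> y + \sum_i g i <= \sum_i f i.
Proof.
move=> gf h; rewrite (bigD1 i0)//= [leRHS](bigD1 i0)//= addrA.
by apply: lerD => //; apply: ler_sum => i _.
Qed.

End Ramp.

(** * The potential of a knowledge set *)

Section Potential.
Context {R : realType} {n : nat} (G : R) (G0 : 0 < G).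
Local Notation d := n.+1.
Local Notation D := (n.+1%:R : R).
Local Notation L := (@scale R n).
Implicit Types (S : set 'rV[R]_d) (z : int).

Let D0 : 0 < D. Proof. by rewrite ltr0n. Qed.
Let D1 : 1 <= D. Proof. by rewrite ler1n. Qed.
Let Lz0 z : 0 < L z. Proof. exact: scale_gt0. Qed.
Let LJ0 z J : 0 < L z ^+ J. Proof. by rewrite exprn_gt0. Qed.
Let e0 z : 0 < L (z + 1) / 2. Proof. by rewrite divr_gt0. Qed.
Let LJle z J : L (z + 1) ^+ J <= L z ^+ J.
Proof. by rewrite lerXn2r ?nnegrE ?(ltW (Lz0 _))// le_scale// lerDl. Qed.

(** With l = l_z and l' = l_(z+1): the slope turns a drop of l'^J / 2 into 4 l, the loss of an
    underpriced round. The jump at l'^J pays d for overpricing and 4 l for an underpriced round that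
    crosses this value. *)
Definition psi J z : R -> R :=
  ramp (8 * L z / L (z + 1) ^+ J) (L (z + 1) ^+ J) (L z ^+ J) (D + 4 * L z) (L (z + 1) ^+ J).

(** For the stalled rounds, which end with V_1 in ]2 e, 3 e]: a drop of e / G inside this range pays
    d by the slope, and the round that enters it from above is paid by the jump. *)
Definition psi1 z : R -> R := let e := L (z + 1) / 2 in
  ramp (D * (G / e)) (2 * e) (3 * e) D (3 * e).

Definition potential_sum N S : R :=
  \sum_(i < N) (\sum_(J < d) psi J.+1 (i%:Z - d%:Z) (nvol S J.+1) + psi1 (i%:Z - d%:Z) (nvol S 1)).

(** The factor 8 pays loss 1 for the drops of 1/8 outside the counted scales. *)
Definition potential N S : R := potential_sum N S + 8 * nvol S 1.

Let cpsi z J : 0 <= 8 * L z / L (z + 1) ^+ J.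
Proof. by rewrite ltW// divr_gt0// mulr_gt0. Qed.
Let kpsi z : 0 <= D + 4 * L z.
Proof. by rewrite addr_ge0 ?(ltW D0)// mulr_ge0// ltW. Qed.
Let cpsi1 z : 0 <= D * (G / (L (z + 1) / 2)).
Proof. by rewrite ltW// mulr_gt0// divr_gt0. Qed.
Let lpsi1 z : 2 * (L (z + 1) / 2) <= 3 * (L (z + 1) / 2).
Proof. by have := e0 z; move: (L (z + 1) / 2) => e ?; lra. Qed.

(** By [scale_ratio] the slope part is at most 8 d^2 - 8 l, and the jump adds d + 4 l. *)
Lemma psi_bound J z a : (J <= d)%N -> 0 <= psi J z a <= 9 * D ^+ 2.
Proof.
move=> Jd; have /andP[-> h] := ramp_bound (L (z + 1) ^+ J) a (cpsi z J) (kpsi z) (LJle z J).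
apply: le_trans h _; have := @scale_ratio R n z J Jd; rewrite (exprS (L z)).
have := LJ0 (z + 1) J; have := LJ0 z J; have := Lz0 z; have DD : D <= D ^+ 2 by rewrite expr2 ler_peMl.
move: (L z) (L z ^+ J) (L (z + 1) ^+ J) (D ^+ 2) DD => l q p X XD l0 q0 p0 h.
have hp : l * q / p <= X by rewrite ler_pdivrMr.
have -> : 8 * l / p * (q - p) = 8 * (l * q / p) - 8 * l by field; rewrite gt_eqF.
by move: (l * q / p) hp => y hp; lra.
Qed.

Lemma psi1_bound z a : 0 <= psi1 z a <= D * G + D.
Proof.
have /andP[-> h] := ramp_bound (3 * (L (z + 1) / 2)) a (cpsi1 z) (ltW D0) (lpsi1 z).
apply: le_trans h _; have := e0 z; move: (L (z + 1) / 2) G => e g e0'.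
by rewrite lerD2r le_eqVlt; apply/orP; left; apply/eqP; field; rewrite gt_eqF.
Qed.

Lemma potential_ge0 N S : body S -> 0 <= potential N S.
Proof.
move=> bS; apply: addr_ge0; last by rewrite mulr_ge0// nvol_ge0.
rewrite /potential_sum; apply: sumr_ge0 => i _.
rewrite addr_ge0//; last by case/andP: (psi1_bound (i%:Z - d%:Z) (nvol S 1)).
by apply: sumr_ge0 => J _; case/andP: (psi_bound (i%:Z - d%:Z) (nvol S J.+1) (ltn_ord J)).
Qed.

Lemma potential_le N S : nvol S 1 <= D -> potential N S <= N%:R * (D * (9 * D ^+ 2) + (D * G + D)) + 8 * D.
Proof.
move=> S1; apply: lerD; last exact: ler_wpM2l.
have -> : N%:R * (D * (9 * D ^+ 2) + (D * G + D)) = \sum_(i < N) (D * (9 * D ^+ 2) + (D * G + D)).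
  by rewrite sumr_const card_ord mulr_natl.
apply: ler_sum => i _; apply: lerD; last by case/andP: (psi1_bound (i%:Z - d%:Z) (nvol S 1)).
have -> : D * (9 * D ^+ 2) = \sum_(J < d) (9 * D ^+ 2) by rewrite sumr_const card_ord mulr_natl.
by apply: ler_sum => J _; case/andP: (psi_bound (i%:Z - d%:Z) (nvol S J.+1) (ltn_ord J)).
Qed.

Lemma potential_step S S' T loss N : body S -> body S' -> S' `<=` S ->
  (forall z, - d%:Z <= z -> @alpha R d ^ z <= ln (2 * D ^+ 2 * T%:R) ->
     exists i : 'I_N, z = i%:Z - d%:Z) ->
  progress G S S' T loss -> loss + potential N S' <= 2 / T%:R + potential N S.
Proof.
move=> bS bS' SS cover pr.
have T0 : 0 <= 2 / T%:R :> R by rewrite divr_ge0.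
have m j : nvol S' j <= nvol S j by exact: le_nvol.
have mpsi J z : psi J z (nvol S' J) <= psi J z (nvol S J) by exact: le_ramp.
have mpsi1 z : psi1 z (nvol S' 1) <= psi1 z (nvol S 1) by apply: le_ramp => //; exact: ltW.
have msum z : \sum_(J < d) psi J.+1 z (nvol S' J.+1) <= \sum_(J < d) psi J.+1 z (nvol S J.+1).
  by apply: ler_sum => J _.
have mono : potential_sum N S' <= potential_sum N S by apply: ler_sum => i _; exact: lerD.
have m1 := m 1%N; rewrite /potential.
case: pr => [h|[h1 h2]|[J [z [/andP[J1 Jd] zd zX /andP[aJ1 aJ2] pr]]]]; first lra.
  lra.
have [i zi] := cover z zd zX.
suff : loss + potential_sum N S' <= potential_sum N S by lra.
apply: (sum_drop (i0 := i)) => [i'|]; first exact: lerD.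
rewrite -zi addrA.
pose J' : 'I_d := Ordinal (n := d) (m := J.-1) (ltac:(by rewrite prednK)).
have J'E : J = J'.+1 by rewrite /= prednK.
have fromJ : loss + psi J z (nvol S' J) <= psi J z (nvol S J) ->
    loss + \sum_(J < d) psi J.+1 z (nvol S' J.+1) + psi1 z (nvol S' 1) <=
    \sum_(J < d) psi J.+1 z (nvol S J.+1) + psi1 z (nvol S 1).
  by move=> h; apply: lerD => //; apply: (sum_drop (i0 := J')) => //; rewrite -J'E.
have jump : loss <= D + 4 * L z -> nvol S' J <= L (z + 1) ^+ J ->
    loss + psi J z (nvol S' J) <= psi J z (nvol S J).
  move=> h1 h2; apply: le_trans (ramp_jump (D + 4 * L z) (cpsi z J) (LJle z J) h2 aJ1).
  by rewrite lerD2r.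
have l0 := Lz0 z.
case: pr => [[h1 h2]|[h1 h2]|[J1' h1 h2 h3 h4]].
(* Underpricing: if a_J leaves the range of the slope, the jump pays; otherwise the full drop lies
   on the slope. *)
- apply: fromJ; have [h3|h3] := leP (nvol S' J) (L (z + 1) ^+ J).
    by apply: jump => //; apply: le_trans h1 _; rewrite lerDr ltW.
  apply: le_trans (ramp_slide (8 * L z / L (z + 1) ^+ J) (L (z + 1) ^+ J) (kpsi z) (ltW h3) (m J) aJ2).
  rewrite lerD2r; apply: le_trans h1 _; have p0 := LJ0 (z + 1) J.
  move: (L (z + 1) ^+ J) (L z) p0 l0 h2 => p l p0 l0 h2.
  have -> : 4 * l = 8 * l / p * (p / 2) by field; rewrite gt_eqF.
  apply: ler_wpM2l; last lra.
  by rewrite divr_ge0 ?(ltW p0)// mulr_ge0// ltW.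
- by apply: fromJ; apply: jump => //; apply: le_trans h1 _; rewrite lerDl mulr_ge0// ltW.
- rewrite -addrA addrCA; apply: lerD => //.
  have [h5|h5] := leP (nvol S 1) (3 * (L (z + 1) / 2)); last first.
    apply: le_trans (ramp_jump D (cpsi1 z) (lpsi1 z) h3 h5); by rewrite lerD2r.
  apply: le_trans (ramp_slide (D * (G / (L (z + 1) / 2))) (3 * (L (z + 1) / 2)) (ltW D0) (ltW h2) m1 h5).
  rewrite lerD2r; apply: le_trans h1 _; have E0 := e0 z; have g0 := G0.
  move: h4; move: (L (z + 1) / 2) G E0 g0 => e g E0 g0 h4.
  rewrite -[leLHS]mulr1; have -> : D * 1 = D * (g / e) * (e / g) by field; rewrite !gt_eqF.
  by apply: ler_wpM2l; [rewrite mulr_ge0 ?divr_ge0 ?(ltW E0) ?(ltW g0) ?(ltW D0)|lra].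
Qed.

End Potential.

(** * Counting the scales *)

Section Logarithms.
Context {R : realType}.

(** From exp(-1/6) >= 5/6 and (5/6)^6 > 1/3. The consequence ln 3 > 1 makes ln (ln (d T)) positive
    for d T >= 3. *)
Lemma expR1_lt_3 : expR 1 < 3 :> R.
Proof.
have h : 5 / 6 <= expR (- 6^-1 : R) by apply: le_trans (expR_ge1Dx _); lra.
have h6 : (5 / 6) ^+ 6 <= expR (- 1 : R).
  have -> : (-1 : R) = 6%:R * - 6^-1 by field.
  by rewrite expRM_natl lerXn2r ?nnegrE ?expR_ge0 ?divr_ge0.
have : expR 1 * expR (- 1) = 1 :> R by rewrite -expRD subrr expR0.
have p := expR_gt0 (1 : R).
have : (1 / 3 : R) < (5 / 6) ^+ 6 by rewrite !exprS expr0; lra.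
by move: (expR 1) (expR (-1)) h6 p => x y; nra.
Qed.

Lemma ln3_gt1 : 1 < ln 3 :> R.
Proof. by rewrite -[ltLHS](expRK 1) ltr_ln ?posrE ?expR_gt0// expR1_lt_3. Qed.

(** The inverse of 1 + 1/D is 1 - 1/(D + 1), whose logarithm is at most -1/(D + 1). *)
Lemma ln_alpha_ge n : (2 * n.+1%:R)^-1 <= ln (@alpha R n.+1).
Proof.
have N1 : 1 <= n.+1%:R :> R by rewrite ler1n.
rewrite /alpha; move: (n.+1%:R : R) N1 => D D1; have D0 : 0 < D by lra.
have x1 : (D + 1)^-1 < 1 by rewrite invf_lt1; lra.
have x0 : 0 < (D + 1)^-1 by rewrite invr_gt0; lra.
have h : ln (1 + - (D + 1)^-1) <= - (D + 1)^-1 by apply: le_ln1Dx; lra.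
have : ln ((1 + D^-1) * (1 + - (D + 1)^-1)) = 0.
  have -> : (1 + D^-1) * (1 + - (D + 1)^-1) = 1 by field; rewrite !gt_eqF//; lra.
  exact: ln1.
have i0 : 0 < D^-1 by rewrite invr_gt0.
rewrite lnM ?posrE; [|lra|lra].
have : (2 * D)^-1 <= (D + 1)^-1 by rewrite lef_pV2 ?posrE; lra.
lra.
Qed.

(** Taking logarithms, z <= ln X / ln alpha <= 2 d ln X; the shift by d makes the range start at
    0. *)
Lemma scale_count n (X : R) (z : int) : 1 <= X -> - n.+1%:Z <= z -> @alpha R n.+1 ^ z <= X ->
  exists i : 'I_(n.+1 + Num.truncn (2 * n.+1%:R * ln X)).+1, z = i%:Z - n.+1%:Z.
Proof.
move=> X1 zd zX; set t := Num.truncn _.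
have h : (`|(z + n.+1%:Z)%R|%N < (n.+1 + t).+1)%N.
  case: z zd zX => [m|m] zd zX; last by clear zX; lia.
  have a0 : 0 < @alpha R n.+1 by apply: lt_trans ltr01 _; exact: alpha_gt1.
  have mt : (m <= t)%N.
    have L0 : 0 <= ln X by exact: ln_ge0.
    rewrite truncn_ge_nat; last by rewrite mulr_ge0.
    move: zX; rewrite -exprnP -ler_ln ?posrE ?exprn_gt0//; last exact: lt_le_trans X1.
    rewrite lnXn// => zX; rewrite -(mulr_natl (ln _)) in zX.
    have : m%:R * (2 * n.+1%:R)^-1 <= ln X.
      by apply: le_trans zX; apply: ler_wpM2l => //; exact: ln_alpha_ge.
    by rewrite ler_pdivrMr ?mulr_gt0// mulrC.
  by clear zX; lia.
by exists (Ordinal h); clear zX; rewrite /=; lia.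
Qed.

End Logarithms.

(** * Summation over all rounds and the final estimate *)

Section TotalLoss.
Context {R : realType} {n : nat}.
Local Notation d := n.+1.
Local Notation D := (n.+1%:R : R).

Lemma slice_gap_ex : exists2 M : R, 0 < M & forall m, @slice_gap R m (M * m.+1%:R ^+ 2).
Proof.
exists 10240; first by rewrite ltr0n.
by move=> m K S u p a b w; exact: ivol1_slice_gap.
Qed.

Lemma total_loss G N T (v : 'rV[R]_d) (u : nat -> 'rV[R]_d) (p : nat -> R) :
  0 < G -> @slice_gap R n G -> (0 < T)%N -> unit_cube v ->
  (forall z, - d%:Z <= z -> @alpha R d ^ z <= ln (2 * D ^+ 2 * T%:R) ->
     exists i : 'I_N, z = i%:Z - d%:Z) ->
  (forall t, (t < T)%N -> dot (u t) (u t) = 1) ->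
  (forall t, (t < T)%N -> pricing_search T (knowledge_set v u p t) (u t) (p t)) ->
  \sum_(t < T) pricing_loss (dot (u t) v) (p t) <=
    2 + (N%:R * (D * (9 * D ^+ 2) + (D * G + D)) + 8 * D).
Proof.
move=> G0 gapG T0 vc cover u1 search; pose A t := knowledge_set v u p t.
have inv t : [/\ body (A t), A t v & A t `<=` @unit_cube R d].
  elim: t => [|t [bA Av Ac]]; first by split=> //; exact: body_unit_cube.
  rewrite /A /= -/(A t); case: ifPn => h; split.
  - exact: body_upper_part.
  - by split.
  - by move=> x [/Ac].
  - exact: body_lower_part.
  - by split=> //; rewrite ltW// ltNge.
  - by move=> x [/Ac].
have cube1 S : body S -> S `<=` @unit_cube R d -> nvol S 1 <= D.
  move=> bS Sc; rewrite /nvol mul1r; apply: le_trans (@ivol1_cube R n).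
  by apply: le_ivol => //; exact: body_unit_cube.
(* Every round is granted 2 / T on top of the potential, which pays for the narrow rounds and adds
   up to 2. *)
have main t : (t <= T)%N -> \sum_(s < t) pricing_loss (dot (u s) v) (p s) + potential G N (A t)
    <= t%:R * (2 / T%:R) + potential G N (A 0%N).
  elim: t => [|t IH] tT; first by rewrite big_ord0 mul0r.
  rewrite big_ord_recr /=; have {}IH := IH (ltnW tT).
  have [bA Av Ac] := inv t; have [bA' _ _] := inv t.+1.
  have AA : A t.+1 `<=` A t by rewrite /A /= -/(A t); case: ifP => _ x [].
  have pr := round_progress (ltW G0) gapG bA Av (u1 t tT) vc (cube1 _ bA Ac) T0 (search t tT).
  have step := potential_step G0 bA bA' AA cover pr.
  by move: IH step; rewrite -natr1; lra.
have := main T (leqnn T); rewrite mulrCA divff ?mulr1 ?pnatr_eq0 -?lt0n// => h.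
have [bT _ _] := inv T; have [b0 _ c0] := inv 0%N.
have := potential_ge0 G0 N bT; have := potential_le G0 N (cube1 _ b0 c0); lra.
Qed.

End TotalLoss.

(** Since d T >= 3, the argument 2 d^2 T is at most (d T)^3; the exponent becomes the additive term
    ln 3. *)
Lemma log_bounds (R : realType) (D T : R) : 1 <= D -> 1 <= T -> 3 <= D * T ->
  1 <= ln (2 * D ^+ 2 * T) /\ ln (ln (2 * D ^+ 2 * T)) <= ln 3 + ln (ln (D * T)).
Proof.
move=> D1 T1 Q3; have l3 := @ln3_gt1 R.
have D0 : 0 < D by lra. have T0 : 0 < T by lra.
have Q0 : 0 < D * T by exact: mulr_gt0.
have X0 : 0 < 2 * D ^+ 2 * T by rewrite !mulr_gt0// exprn_gt0.
have lQ : ln 3 <= ln (D * T) by rewrite ler_ln ?posrE.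
have h1 : ln (D * T) <= ln (2 * D ^+ 2 * T).
  by rewrite ler_ln ?posrE// ler_pM2r// expr2; nra.
have h2 : ln (2 * D ^+ 2 * T) <= 3 * ln (D * T).
  have -> : 3 * ln (D * T) = ln ((D * T) ^+ 3) by rewrite lnXn// mulr_natl.
  rewrite ler_ln ?posrE ?exprn_gt0//.
  have -> : (D * T) ^+ 3 = (D * T * T) * (D ^+ 2 * T) by ring.
  rewrite -mulrA ler_pM2r ?mulr_gt0 ?exprn_gt0//; nra.
split; first by lra.
rewrite -lnM ?posrE; [|by []|lra]; rewrite ler_ln ?posrE//; lra.
Qed.

Unset Implicit Arguments.
Set Strict Implicit.
Set Printing Implicit Defensive.

Theorem theorem24 (R : realType) :
  exists C : R, forall (d T : nat) (v : 'rV[R]_d)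
    (u : nat -> 'rV[R]_d) (p : nat -> R),
    (3 <= d * T)%N ->
    unit_cube v ->
    (forall t, (t < T)%N -> dot (u t) (u t) = 1) ->
    (forall t, (t < T)%N ->
       pricing_search T (knowledge_set v u p t) (u t) (p t)) ->
    \sum_(t < T) pricing_loss (dot (u t) v) (p t)
      <= C * d%:R ^+ 4 * ln (ln (d * T)%:R).
Proof.
have [M M0 gap] := @slice_gap_ex R; have l3 := @ln3_gt1 R.
pose c0 : R := ln (ln 3); have c00 : 0 < c0 by rewrite ln_gt0.
(* [B] multiplies ln (ln (d T)); [A] collects the additive constants, its 10 coming from 2 + 8 d.
   Dividing by [c0], a lower bound for ln (ln (d T)), absorbs them. *)
pose B : R := 2 * (10 + M); pose A : R := 10 + B * (1 + ln 3).
have B0 : 0 < B by rewrite /B; lra.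
have A0 : 0 < A by rewrite /A; have := mulr_gt0 B0 (lt_trans ltr01 l3); lra.
exists (A / c0 + B) => -[|n] T v u p; first by rewrite mul0n.
move=> dT vc u1 search; have T0 : (0 < T)%N by move: dT; case: (T) => //; rewrite muln0.
have D1 : 1 <= n.+1%:R :> R by rewrite ler1n.
have T1 : 1 <= T%:R :> R by rewrite ler1n.
have Q3 : 3 <= n.+1%:R * T%:R :> R by rewrite -natrM ler_nat.
have [X1 lX] := log_bounds D1 T1 Q3.
have DD0 : 0 < n.+1%:R :> R by rewrite ltr0n.
have G0 : 0 < M * n.+1%:R ^+ 2 by rewrite mulr_gt0// exprn_gt0.
have := total_loss G0 (gap n) T0 vc (fun z => @scale_count R n _ z X1) u1 search.
move: X1 lX; set X := ln (2 * _ * _) => X1; rewrite natrM.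
have Yc : c0 <= ln (ln (n.+1%:R * T%:R)).
  have Q1 : ln 3 <= ln (n.+1%:R * T%:R) :> R by rewrite ler_ln ?posrE//; lra.
  by rewrite ler_ln ?posrE//; lra.
have lX0 : 0 <= ln X by exact: ln_ge0.
move: (ln (ln (n.+1%:R * T%:R))) Yc => Y Yc lXY.
set N := (_ + Num.truncn _).+1.
(* The d scales below 0 and scale 0 itself are covered by 2 d, since d + 1 <= 2 d. *)
have NX : N%:R <= 2 * n.+1%:R * (1 + ln X).
  have : (Num.truncn (2 * n.+1%:R * ln X))%:R <= 2 * n.+1%:R * ln X by rewrite truncn_le mulr_ge0.
  have -> : N%:R = n.+1%:R + (Num.truncn (2 * n.+1%:R * ln X))%:R + 1 :> R by rewrite -natrD natr1.
  clearbody N; move: (Num.truncn (2 * n.+1%:R * ln X)) => t.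
  by move: (n.+1%:R : R) (t%:R : R) (ln X) D1 => D s l D1; lra.
move=> h; apply: le_trans h _.
have Nge : 0 <= N%:R :> R by [].
move: (n.+1%:R : R) (N%:R : R) D1 DD0 NX Nge => D x D1 D0 NX x0.
have P1 : 1 <= D ^+ 3 by exact: exprn_ege1.
have DP : D <= D ^+ 3 by rewrite exprS ler_peMr ?(ltW D0)// exprn_ege1.
have PP : D ^+ 3 <= D ^+ 4 by rewrite (exprS D 3) ler_peMl// (le_trans ler01).
have e1 : D * (9 * D ^+ 2) + (D * (M * D ^+ 2) + D) <= (10 + M) * D ^+ 3.
  have -> : D * (9 * D ^+ 2) + (D * (M * D ^+ 2) + D) = (9 + M) * D ^+ 3 + D by ring.
  by lra.
have e2 : x * (D * (9 * D ^+ 2) + (D * (M * D ^+ 2) + D)) <= B * (1 + ln 3 + Y) * D ^+ 4.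
  apply: le_trans (ler_wpM2l x0 e1) _.
  have -> : B * (1 + ln 3 + Y) * D ^+ 4 = (2 * D * (1 + ln 3 + Y)) * ((10 + M) * D ^+ 3) by rewrite /B; ring.
  apply: ler_wpM2r; first by rewrite mulr_ge0 ?exprn_ge0 ?(ltW D0)//; lra.
  by apply: le_trans NX _; apply: ler_wpM2l; [rewrite mulr_ge0// ltW|lra].
have e3 : A <= A / c0 * Y.
  have cn : c0 != 0 by rewrite gt_eqF.
  by rewrite -[leLHS](divfK cn A) ler_wpM2l// divr_ge0 ?(ltW A0) ?(ltW c00).
have : A * D ^+ 4 <= A / c0 * Y * D ^+ 4 by apply: ler_wpM2r => //; rewrite exprn_ge0// ltW.
have -> : (A / c0 + B) * D ^+ 4 * Y = A / c0 * Y * D ^+ 4 + B * Y * D ^+ 4 by ring.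
move: (A / c0 * Y * D ^+ 4) => W hW.
have E : B * (1 + ln 3 + Y) * D ^+ 4 = A * D ^+ 4 - 10 * D ^+ 4 + B * Y * D ^+ 4 by rewrite /A; ring.
rewrite E in e2.
lra.
Qed.
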